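(* Let $n$ be a positive integer, let $q\in\mathbb{C}$ be nonzero and not a root of unity, and let $L$ be an arbitrary link, presented as the canonical closure of a braid on $f\ge 2$ strings with braid group element $b\in B_f$. Let $\Phi^{osp(1|2n)}_{L}(q)$ and $\Phi^{so(2n+1)}_{L}(-q)$ be the quantum link invariants of $L$ associated with the $(2n+1)$-dimensional vector representations of $U_q(osp(1|2n))$ and $U_{-q}(so(2n+1))$, and let $F_L(t,p)$ denote the Kauffman link invariant of $L$ defined from the Birman--Wenzl--Murakami algebra with parameters $(t,p)$. Then (i) $\Phi^{osp(1|2n)}_{L}(q) = F_{L}(-q^{2n},q)$, and (ii) $\Phi^{so(2n+1)}_{L}(-q) = F_{L}(q^{2n},-q)$.
   Context: **Braid groups and link polynomials.** $B_f$ has generators $\sigma_1,\dots,\sigma_{f-1}$ with $\sigma_i\sigma_j=\sigma_j\sigma_i$ for $|i-j|>1$ and $\sigma_i\sigma_{i+1}\sigma_i=\sigma_{i+1}\sigma_i\sigma_{i+1}$. For $b=\sigma_{i_1}^{m_1}\cdots\sigma_{i_j}^{m_j}$ put $e(b)=\sum_k m_k$. If $\rho$ is a representation of $B_f$ and $\psi$ is a functional with $\psi(\rho(\theta\theta'))=\psi(\rho(\theta'\theta))$ for $\theta,\theta'\in B_f$, $\psi(\rho(\theta\sigma_{f-1}))=z\,\psi(\rho(\theta))$ and $\psi(\rho(\theta\sigma_{f-1}^{-1}))=\widetilde z\,\psi(\rho(\theta))$ for $\theta\in B_{f-1}$ (a Markov trace, with $z,\widetilde z\in\mathbb{C}$),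 then the associated link polynomial of the closure $L$ of $b\in B_f$ is $\widetilde F(L)=(z\widetilde z)^{-(f-1)/2}(\widetilde z/z)^{e(b)/2}\psi(\rho(b))$. **Roots.** Let $\epsilon_1,\dots,\epsilon_n$ be a basis of $H^*\cong\mathbb{C}^n$ with bilinear form $(\epsilon_i,\epsilon_j)=\delta_{ij}$; $\alpha_i=\epsilon_i-\epsilon_{i+1}$ for $i<n$, $\alpha_n=\epsilon_n$; $a_{ij}=2(\alpha_i,\alpha_j)/(\alpha_i,\alpha_i)$; $2\rho=\sum_{i=1}^n(2n-2i+1)\epsilon_i$. **$U_q(osp(1|2n))$** is the $\mathbb{Z}_2$-graded algebra generated by $e_i,f_i,k_i^{\pm1}$ ($1\le i\le n$), all even except $e_n,f_n$, which are odd, with relations: $k_i^{\pm1}$ commute and $k_ik_i^{-1}=1$; $k_ie_jk_i^{-1}=q^{(\alpha_i,\alpha_j)}e_j$; $k_if_jk_i^{-1}=q^{-(\alpha_i,\alpha_j)}f_j$; $e_if_j-(-1)^{[e_i][f_j]}f_je_i=\delta_{ij}\frac{k_i-k_i^{-1}}{q-q^{-1}}$; and the quantum Serre relations $(\mathrm{ad}\,e_i)^{1-a_{ij}}(e_j)=0=(\mathrm{ad}\,f_i)^{1-a_{ij}}(f_j)$ for $i\ne j$, where $(\mathrm{ad}\,e_i)(y)=e_iy-(-1)^{[e_i][y]}q^{(\alpha_i,\mathrm{wt}\,y)}ye_i$ and $(\mathrm{ad}\,f_i)(y)=f_iy-(-1)^{[f_i][y]}q^{(-\alpha_i,\mathrm{wt}\,y)}yf_i$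 for homogeneous weight elements $y$. Co-multiplication: $\Delta(e_i)=e_i\otimes k_i+1\otimes e_i$, $\Delta(f_i)=f_i\otimes1+k_i^{-1}\otimes f_i$, $\Delta(k_i^{\pm1})=k_i^{\pm1}\otimes k_i^{\pm1}$; tensor products are multiplied by $(a\otimes b)(x\otimes y)=(-1)^{[b][x]}ax\otimes by$. **$U_{p}(so(2n+1))$** (used with $p=-q$) is generated by $E_i,F_i,K_i^{\pm1}$ with the same relations and co-multiplication, with $q$ replaced by $p$, all generators even and all signs $(-1)^{[\cdot][\cdot]}$ omitted. **Vector representation.** $V$ denotes the $(2n+1)$-dimensional irreducible module with highest weight $\epsilon_1$ of either algebra (a vector $v$ has weight $\mu$ if $k_iv=q^{(\alpha_i,\mu)}v$, respectively $K_iv=(-q)^{(\alpha_i,\mu)}v$); as a $U_q(osp(1|2n))$-module its highest weight vector is taken to be odd. In both cases $V\otimes V=V_{2\epsilon_1}\oplus V_{\mu}\oplus V_0$, with $V_\lambda$ the irreducible submodule of highest weight $\lambda$, where $\mu=\epsilon_1+\epsilon_2$ if $n\ge2$ and $\mu=\epsilon_1$ if $n=1$. **Braid generators.** $\check R^{A}_{VV}$, $A\in\{so(2n+1),osp(1|2n)\}$, is $P\circ R^A_{VV}$, where $P$ is the (graded, in the $osp$ case) permutation and $R^A_{VV}$ is the $R$-matrix of $V\otimes V$, satisfying $R^A_{VV}\Delta(x)=(P\circ\Delta)(x)R^A_{VV}$ on $V\otimes V$. It commutes with the quantum (super)algebra and acts on $V_{2\epsilon_1},V_\mu,V_0$ by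 the scalars $-q,\ q^{-1},\ q^{-2n}$ respectively (for both $A=osp(1|2n)$ over $U_q$ and $A=so(2n+1)$ over $U_{-q}$). The braid group $B_f$ acts on $V^{\otimes f}$ by $\sigma_i^{\pm1}\mapsto \mathrm{id}^{\otimes(i-1)}\otimes(\check R^A_{VV})^{\pm1}\otimes\mathrm{id}^{\otimes(f-i-1)}$. **Markov traces.** $\mathrm{str}_q(X)=\mathrm{str}(k_{2\rho}\circ X)$ and $\mathrm{tr}_{-q}(X)=\mathrm{tr}(K_{2\rho}\circ X)$, where $\mathrm{str}$ is the supertrace, $\mathrm{tr}$ the trace, and $k_{2\rho}$ (resp. $K_{2\rho}$) is the product of the $k_i$ (resp. $K_i$) with $k_{2\rho}e_ik_{2\rho}^{-1}=q^{(2\rho,\alpha_i)}e_i$ (resp. $K_{2\rho}E_iK_{2\rho}^{-1}=(-q)^{(2\rho,\alpha_i)}E_i$) for all $i$. Put $\mathrm{sdim}_q(V)=\mathrm{str}_q(\mathrm{id}_V)$, $\dim_{-q}(V)=\mathrm{tr}_{-q}(\mathrm{id}_V)$; both equal $D:=\frac{-q^{2n}+q^{-2n}}{q-q^{-1}}+1$. On the algebras generated by the images of the $\sigma_i^{\pm1}$ in $\mathrm{End}(V^{\otimes f})$, $\psi^{so(2n+1)}(X)=\mathrm{tr}_{-q}(X)/D^f$ and $\psi^{osp(1|2n)}(X)=\mathrm{str}_q(X)/D^f$ are Markov traces with $z=q^{2n}/D$, $\widetilde z=q^{-2n}/D$. $\Phi^{so(2n+1)}_L(-q)$ and $\Phi^{osp(1|2n)}_L(q)$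 are the corresponding link polynomials $\widetilde F(L)$, with the square roots $(z\widetilde z)^{-1/2}=D$ and $(\widetilde z/z)^{1/2}=q^{-2n}$. **Kauffman invariant.** For $f\ge2$, the Birman--Wenzl--Murakami algebra $BWM_f$ over $\mathbb{C}(r,s)$ ($r,s$ indeterminates) is generated by invertible $g_1,\dots,g_{f-1}$ with $g_ig_j=g_jg_i$ ($|i-j|>1$), $g_ig_{i+1}g_i=g_{i+1}g_ig_{i+1}$, $e_ig_i=r^{-1}e_i$, $e_ig_{i-1}^{\pm1}e_i=r^{\pm1}e_i$ (for $i\ge2$), where $e_i$ is defined by $(s-s^{-1})(1-e_i)=g_i-g_i^{-1}$ ($BWM_1=\mathbb{C}(r,s)$). Put $x=\frac{r-r^{-1}}{s-s^{-1}}+1$. There is a linear functional $\mathrm{tr}$ on $BWM_f$ with $\mathrm{tr}(1)=1$, $\mathrm{tr}(ab)=\mathrm{tr}(ba)$, $\mathrm{tr}(e_i)=1/x$, $\mathrm{tr}(g_i^{\pm1})=r^{\pm1}/x$, and $\mathrm{tr}(a\chi b)=\mathrm{tr}(\chi)\mathrm{tr}(ab)$ for $a,b\in BWM_{f-1}$, $\chi\in\{g_{f-1},e_{f-1}\}$. If $L$ is the closure of $b\in B_f$ and $\beta\in BWM_f$ is the image of $b$ under $\sigma_i^{\pm1}\mapsto g_i^{\pm1}$, then with $\widehat{\mathrm{tr}}(b)=r^{-e(b)}\mathrm{tr}(\beta)$ the Kauffman invariant is $F_L(r,s)=\widehat{\mathrm{tr}}(\sigma_1)^{1-f}\,\widehat{\mathrm{tr}}(b)=x^{f-1}r^{-e(b)}\mathrm{tr}(\beta)$.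 For complex numbers $t,p$, $F_L(t,p)$ is defined the same way from $BWM_f(t,p)$, obtained by replacing $(r,s)$ by $(t,p)$. *)

(* Defs.v *)
From HB Require Import structures.
From mathcomp Require Import all_boot all_order all_algebra.
From mathcomp Require Import ring_quotient generic_quotient.
From mathcomp Require Import boolp classical_sets reals.
From mathcomp Require Import complex mxtens.
From mathcomp.multinomials Require Import monalg.

Set Implicit Arguments.
Unset Strict Implicit.
Unset Printing Implicit Defensive.

Import GRing.Theory.
Local Open Scope ring_scope.

(** * Quotient of an algebra by the two-sided ideal generated by a set *)

Section QuotientAlgebra.
Local Open Scope quotient_scope.
Variables (C : fieldType) (A : lalgType C) (S : A -> Prop).

Inductive two_sided_ideal : A -> Prop :=
| Ideal_gen x : S x -> two_sided_ideal x
| Ideal_0 : two_sided_ideal 0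
| Ideal_D x y : two_sided_ideal x -> two_sided_ideal y -> two_sided_ideal (x + y)
| Ideal_Ml a x : two_sided_ideal x -> two_sided_ideal (a * x)
| Ideal_Mr a x : two_sided_ideal x -> two_sided_ideal (x * a).

Definition ideal_pred : {pred A} := fun x => `[< two_sided_ideal x >].

Fact ideal_zmod_closed : zmod_closed ideal_pred.
Proof.
split=> [|x y /asboolP Ix /asboolP Iy]; apply/asboolP; first exact: Ideal_0.
by apply: Ideal_D => //; rewrite -mulN1r; apply: Ideal_Ml.
Qed.

HB.instance Definition _ := GRing.isZmodClosed.Build A ideal_pred ideal_zmod_closed.

Definition quot_alg := {ideal_quot ideal_pred}.
HB.instance Definition _ := GRing.Zmodule.on quot_alg.

Definition quot_class (x : A) : quot_alg := \pi_{ideal_quot ideal_pred} x.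

Lemma quot_classP (x y : A) :
  quot_class x = quot_class y <-> two_sided_ideal (x - y).
Proof.
have -> : (quot_class x = quot_class y) <-> (x - y \in ideal_pred).
  by rewrite Quotient.idealrBE; split=> /eqP.
by split=> /asboolP.
Qed.

Lemma quot_class_repr (u : quot_alg) : quot_class (repr u) = u.
Proof. exact: reprK. Qed.

Lemma quot_classD : {morph quot_class : x y / x + y}.
Proof. by move=> x y; rewrite /quot_class !piE. Qed.

Definition quot_mul (u v : quot_alg) : quot_alg := quot_class (repr u * repr v).
Definition quot_scale (c : C) (u : quot_alg) : quot_alg := quot_class (c *: repr u).

Lemma quot_classM x y : quot_class (x * y) = quot_mul (quot_class x) (quot_class y).
Proof.
apply/quot_classP; set x' := repr _; set y' := repr _.
have Ix : two_sided_ideal (x - x') by apply/quot_classP; rewrite quot_class_repr.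
have Iy : two_sided_ideal (y - y') by apply/quot_classP; rewrite quot_class_repr.
have -> : x * y - x' * y' = (x - x') * y + x' * (y - y').
  by rewrite mulrBl mulrBr addrA subrK.
by apply: Ideal_D; [apply: Ideal_Mr | apply: Ideal_Ml].
Qed.

Lemma quot_classZ c x : quot_class (c *: x) = quot_scale c (quot_class x).
Proof.
apply/quot_classP; set x' := repr _.
have Ix : two_sided_ideal (x - x') by apply/quot_classP; rewrite quot_class_repr.
by rewrite -scalerBr -[_ - _]mul1r scalerAl; apply: Ideal_Ml.
Qed.

Let quotW (P : quot_alg -> Prop) : (forall x, P (quot_class x)) -> forall u, P u.
Proof. by move=> Px u; rewrite -[u]quot_class_repr. Qed.

Fact quot_mulA : associative quot_mul.
Proof.
by elim/quotW=> x; elim/quotW=> y; elim/quotW=> z; rewrite -!quot_classM mulrA.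
Qed.
Fact quot_mul1l : left_id (quot_class 1) quot_mul.
Proof. by elim/quotW=> x; rewrite -quot_classM mul1r. Qed.
Fact quot_mul1r : right_id (quot_class 1) quot_mul.
Proof. by elim/quotW=> x; rewrite -quot_classM mulr1. Qed.
Fact quot_mulDl : left_distributive quot_mul +%R.
Proof.
elim/quotW=> x; elim/quotW=> y; elim/quotW=> z.
by rewrite -!(quot_classM, quot_classD) mulrDl.
Qed.
Fact quot_mulDr : right_distributive quot_mul +%R.
Proof.
elim/quotW=> x; elim/quotW=> y; elim/quotW=> z.
by rewrite -!(quot_classM, quot_classD) mulrDr.
Qed.

HB.instance Definition _ := GRing.Zmodule_isPzRing.Build quot_alg
  quot_mulA quot_mul1l quot_mul1r quot_mulDl quot_mulDr.

Fact quot_scaleA a b u : quot_scale a (quot_scale b u) = quot_scale (a * b) u.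
Proof. by elim/quotW: u => x; rewrite -!quot_classZ scalerA. Qed.
Fact quot_scale1 : left_id 1 quot_scale.
Proof. by elim/quotW=> x; rewrite -quot_classZ scale1r. Qed.
Fact quot_scaleDr : right_distributive quot_scale +%R.
Proof.
move=> c; elim/quotW=> x; elim/quotW=> y.
by rewrite -!(quot_classZ, quot_classD) scalerDr.
Qed.
Fact quot_scaleDl u : {morph quot_scale^~ u : a b / a + b}.
Proof.
by elim/quotW: u => x a b; rewrite -!quot_classZ -quot_classD scalerDl.
Qed.

HB.instance Definition _ := GRing.Zmodule_isLmodule.Build C quot_alg
  quot_scaleA quot_scale1 quot_scaleDr quot_scaleDl.

End QuotientAlgebra.

(** * Braids *)

(* The word [:: (i_1, m_1); ...; (i_j, m_j)] stands for the element
   sigma_{i_1}^{m_1} ... sigma_{i_j}^{m_j} of B_f. Generators are numbered from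
   0: i : 'I_f.-1 is sigma_{i+1}, which acts on the strings i and i+1. *)
Definition braid_word (f : nat) : Type := seq ('I_f.-1 * int).

Definition exponent_sum f (b : braid_word f) : int := \sum_(s <- b) s.2.

(* The image of a word under sigma_i |-> g i, sigma_i^{-1} |-> g' i. *)
Definition braid_eval (A : pzRingType) f (g g' : 'I_f.-1 -> A)
    (b : braid_word f) : A :=
  \prod_(s <- b) match s.2 with
                 | Posz m => g s.1 ^+ m
                 | Negz m => g' s.1 ^+ m.+1
                 end.

(** * The Birman-Wenzl-Murakami algebra and the Kauffman invariant *)

Section BWM.
Variables (C : fieldType) (r s : C) (f : nat).

Definition bwm_free : lalgType C := {malg C[{fmonom ('I_f.-1 * bool)%type}]}.

Definition free_g (i : 'I_f.-1) : bwm_free := mkmalgU (fmu (i, false)) 1.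
Definition free_gV (i : 'I_f.-1) : bwm_free := mkmalgU (fmu (i, true)) 1.
Definition free_e (i : 'I_f.-1) : bwm_free :=
  1 - (s - s^-1)^-1 *: (free_g i - free_gV i).

(* [bwm_relator x] : the relation x = 0 is imposed. *)
Inductive bwm_relator : bwm_free -> Prop :=
| BWM_gV i : bwm_relator (free_g i * free_gV i - 1)
| BWM_Vg i : bwm_relator (free_gV i * free_g i - 1)
| BWM_comm (i j : 'I_f.-1) : (i.+1 < j)%N ->
    bwm_relator (free_g i * free_g j - free_g j * free_g i)
| BWM_braid (i j : 'I_f.-1) : j = i.+1 :> nat ->
    bwm_relator (free_g i * free_g j * free_g i - free_g j * free_g i * free_g j)
| BWM_eg i : bwm_relator (free_e i * free_g i - r^-1 *: free_e i)
| BWM_ege (i j : 'I_f.-1) : j = i.+1 :> nat ->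
    bwm_relator (free_e j * free_g i * free_e j - r *: free_e j)
| BWM_egVe (i j : 'I_f.-1) : j = i.+1 :> nat ->
    bwm_relator (free_e j * free_gV i * free_e j - r^-1 *: free_e j).

Definition BWM := quot_alg bwm_relator.
HB.instance Definition _ := GRing.PzRing.on BWM.
HB.instance Definition _ := GRing.Lmodule.on BWM.

Definition bwm_g (i : 'I_f.-1) : BWM := quot_class bwm_relator (free_g i).
Definition bwm_gV (i : 'I_f.-1) : BWM := quot_class bwm_relator (free_gV i).
Definition bwm_e (i : 'I_f.-1) : BWM := quot_class bwm_relator (free_e i).

(* The unital subalgebra generated by the first f - 2 generators and their inverses,
   i.e. the image of BWM_{f-1} in BWM_f. *)
Inductive bwm_lower : BWM -> Prop :=
| Lower_g (i : 'I_f.-1) : (i.+2 < f)%N -> bwm_lower (bwm_g i)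
| Lower_gV (i : 'I_f.-1) : (i.+2 < f)%N -> bwm_lower (bwm_gV i)
| Lower_1 : bwm_lower 1
| Lower_D a b : bwm_lower a -> bwm_lower b -> bwm_lower (a + b)
| Lower_Z c a : bwm_lower a -> bwm_lower (c *: a)
| Lower_M a b : bwm_lower a -> bwm_lower b -> bwm_lower (a * b).

Definition bwm_x : C := (r - r^-1) / (s - s^-1) + 1.

Record is_bwm_trace (tr : BWM -> C) : Prop := {
  bwm_tr_linear : scalar tr;
  bwm_tr1 : tr 1 = 1;
  bwm_trC : forall a b, tr (a * b) = tr (b * a);
  bwm_tr_e : forall i, tr (bwm_e i) = bwm_x^-1;
  bwm_tr_g : forall i, tr (bwm_g i) = r / bwm_x;
  bwm_tr_gV : forall i, tr (bwm_gV i) = r^-1 / bwm_x;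
  bwm_tr_markov : forall (i : 'I_f.-1) chi a b, i.+2 = f ->
    chi = bwm_g i \/ chi = bwm_e i -> bwm_lower a -> bwm_lower b ->
    tr (a * chi * b) = tr chi * tr (a * b)
}.

(* The functional is unique; xget selects it. *)
Definition bwm_trace : BWM -> C :=
  xget (fun=> 0) [set tr : BWM -> C | is_bwm_trace tr]%classic.

(* F_L(r, s) for the closure L of the braid b. *)
Definition kauffman (b : braid_word f) : C :=
  bwm_x ^+ f.-1 * r ^ (- exponent_sum b)
  * bwm_trace (braid_eval bwm_g bwm_gV b).

End BWM.

(** * Roots *)

Section Roots.
Variable n : nat.

Definition weight := 'rV[int]_n.

Definition wform (x y : weight) : int := \sum_(k < n) x 0 k * y 0 k.

(* Indices are shifted by one with respect to the usual numbering; weps k = 0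
   when n <= k, so that wroot i = weps i for the last index i. *)
Definition weps (k : nat) : weight := \row_(j < n) (j == k :> nat)%:Z.
Definition wroot (i : 'I_n) : weight := weps i - weps i.+1.

Definition cartan (i j : 'I_n) : int :=
  ((2 * wform (wroot i) (wroot j)) %/ wform (wroot i) (wroot i))%Z.

Definition two_rho (i : 'I_n) : nat := (2 * (n - i)).-1.

(* The coefficient of wroot j in \sum_i two_rho i *: weps i. *)
Definition two_rho_coef (j : 'I_n) : nat := \sum_(i < n | (i <= j)%N) two_rho i.

End Roots.

(** * Modules over U_q(osp(1|2n)) and U_{-q}(so(2n+1)) *)

Inductive qtype := SO | OSP.

Definition is_osp (A : qtype) : bool := if A is OSP then true else false.

Section QuantumGroup.
Variables (C : fieldType) (n : nat) (A : qtype) (q : C).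

Definition qparam : C := if is_osp A then q else - q.
Let p := qparam.

Definition gen_odd (i : 'I_n) : bool := is_osp A && (i.+1 == n).

(* The action of the generators on a Z_2-graded space with a fixed homogeneous
   basis; qpar a is the parity of the a-th basis vector. Operators act on
   column vectors. *)
Record qops (m : nat) := QOps {
  qE : 'I_n -> 'M[C]_m;
  qF : 'I_n -> 'M[C]_m;
  qK : 'I_n -> 'M[C]_m;
  qpar : 'I_m -> bool
}.

Definition homog m (par : 'I_m -> bool) (c : bool) (X : 'M[C]_m) : Prop :=
  forall a b, X a b != 0 -> par a (+) par b = c.

(* v |-> (-1)^{c [v]} v *)
Definition psign m (par : 'I_m -> bool) (c : bool) : 'M[C]_m :=
  diag_mx (\row_a (-1) ^+ (c && par a)).

(* (ad x_i)^k (x_j), for x = e or x = f; the exponent is the same in both cases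
   because (- alpha_i, - mu) = (alpha_i, mu). *)
Fixpoint ad_iter m (x : 'I_n -> 'M[C]_m) (i j : 'I_n) (k : nat) : 'M[C]_m :=
  if k is l.+1 then
    let y := ad_iter x i j l in
    let y_odd := gen_odd j (+) (odd l && gen_odd i) in
    x i * y - ((-1) ^+ (gen_odd i && y_odd)
               * p ^ wform (wroot i) (wroot j + wroot i *+ l)) *: (y * x i)
  else x j.

Definition serre m (x : 'I_n -> 'M[C]_m) : Prop :=
  forall i j, i != j -> ad_iter x i j `|1 - cartan i j|%N = 0.

Record is_qmodule m (M : qops m) : Prop := {
  qE_homog : forall i, homog (qpar M) (gen_odd i) (qE M i);
  qF_homog : forall i, homog (qpar M) (gen_odd i) (qF M i);
  qK_homog : forall i, homog (qpar M) false (qK M i);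
  (* so(2n+1)-modules are not graded *)
  qpar_so : forall a, qpar M a -> is_osp A;
  qK_unit : forall i, qK M i \in unitmx;
  qK_comm : forall i j, qK M i * qK M j = qK M j * qK M i;
  qKE : forall i j, qK M i * qE M j * invmx (qK M i)
                    = p ^ wform (wroot i) (wroot j) *: qE M j;
  qKF : forall i j, qK M i * qF M j * invmx (qK M i)
                    = p ^ (- wform (wroot i) (wroot j)) *: qF M j;
  qEF : forall i j,
    qE M i * qF M j - (-1) ^+ (gen_odd i && gen_odd j) *: (qF M j * qE M i)
    = if i == j then (p - p^-1)^-1 *: (qK M i - invmx (qK M i)) else 0;
  qE_serre : serre (qE M);
  qF_serre : serre (qF M)
}.

Definition is_submodule m (M : qops m) (W : {vspace 'cV[C]_m}) : Prop :=
  forall v, v \in W ->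
    [/\ forall i, qE M i *m v \in W, forall i, qF M i *m v \in W,
        forall i, qK M i *m v \in W, forall i, invmx (qK M i) *m v \in W
      & psign (qpar M) true *m v \in W].

Definition is_irreducible m (M : qops m) (W : {vspace 'cV[C]_m}) : Prop :=
  [/\ is_submodule M W, W != 0%VS
    & forall U, is_submodule M U -> (U <= W)%VS -> U = 0%VS \/ U = W].

Definition is_hwv m (M : qops m) (lambda : weight n) (v : 'cV[C]_m) : Prop :=
  [/\ v != 0, forall i, qE M i *m v = 0
    & forall i, qK M i *m v = p ^ wform (wroot i) lambda *: v].

Definition is_irr_hw m (M : qops m) (lambda : weight n)
    (W : {vspace 'cV[C]_m}) : Prop :=
  is_irreducible M W /\ exists2 v, v \in W & is_hwv M lambda v.

Definition is_vector_module (M : qops (2 * n).+1) : Prop :=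
  [/\ is_qmodule M, is_irreducible M fullv
    & exists2 v, is_hwv M (weps n 0) v
                 & psign (qpar M) true *m v = (-1) ^+ is_osp A *: v].

(** ** Tensor squares and R-matrices *)

(* The operator X (x) Y on V (x) V for Y of parity c:
   (X (x) Y)(v (x) w) = (-1)^{[Y][v]} X v (x) Y w. *)
Definition gtens m (par : 'I_m -> bool) (X : 'M[C]_m) (c : bool) (Y : 'M[C]_m)
    : 'M[C]_(m * m) :=
  (X *m psign par c) *t Y.

Definition tpar m (par : 'I_m -> bool) (k : 'I_(m * m)) : bool :=
  let: (a, b) := mxtens_unindex k in par a (+) par b.

(* V (x) V via the co-multiplication Delta. *)
Definition tens_module m (M : qops m) : qops (m * m) := {|
  qE := fun i => gtens (qpar M) (qE M i) false (qK M i)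
                 + gtens (qpar M) 1%:M (gen_odd i) (qE M i);
  qF := fun i => gtens (qpar M) (qF M i) false 1%:M
                 + gtens (qpar M) (invmx (qK M i)) (gen_odd i) (qF M i);
  qK := fun i => gtens (qpar M) (qK M i) false (qK M i);
  qpar := tpar (qpar M)
|}.

(* V (x) V via the opposite co-multiplication P \o Delta. No sign arises from
   P(a (x) b) = (-1)^{[a][b]} b (x) a, since a or b is even in each term. *)
Definition tens_module_op m (M : qops m) : qops (m * m) := {|
  qE := fun i => gtens (qpar M) (qK M i) (gen_odd i) (qE M i)
                 + gtens (qpar M) (qE M i) false 1%:M;
  qF := fun i => gtens (qpar M) 1%:M (gen_odd i) (qF M i)
                 + gtens (qpar M) (qF M i) false (invmx (qK M i));
  qK := fun i => gtens (qpar M) (qK M i) false (qK M i);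
  qpar := tpar (qpar M)
|}.

(* v (x) w |-> (-1)^{[v][w]} w (x) v *)
Definition graded_perm m (par : 'I_m -> bool) : 'M[C]_(m * m) :=
  \matrix_(k, l) let: (a, b) := mxtens_unindex k in
                 let: (c, d) := mxtens_unindex l in
                 (-1) ^+ (par c && par d) *+ ((a == d) && (b == c)).

Definition acts_by_scalar m (X : 'M[C]_m) (W : {vspace 'cV[C]_m}) (c : C) : Prop :=
  forall v, v \in W -> X *m v = c *: v.

Definition mu_weight : weight n :=
  if (2 <= n)%N then weps n 0 + weps n 1 else weps n 0.

(* Rm is the R-matrix of V (x) V, where V is the module M: it intertwines Delta
   and P \o Delta, and P Rm acts by the scalars -q, q^-1, q^-2n (for either type)
   on the summands of highest weights 2 eps_1, mu, 0 of V (x) V. *)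
Definition is_R_matrix m (M : qops m) (Rm : 'M[C]_(m * m)) : Prop :=
  let VV := tens_module M in
  let VVop := tens_module_op M in
  [/\ forall i, Rm *m qE VV i = qE VVop i *m Rm,
      forall i, Rm *m qF VV i = qF VVop i *m Rm,
      forall i, Rm *m qK VV i = qK VVop i *m Rm
    & exists W2 Wmu W0 : {vspace 'cV[C]_(m * m)},
      [/\ is_irr_hw VV (weps n 0 *+ 2) W2,
          is_irr_hw VV mu_weight Wmu,
          is_irr_hw VV 0 W0,
          (W2 + Wmu + W0)%VS = fullv /\ directv (W2 + Wmu + W0)
        & let Rv := graded_perm (qpar M) *m Rm in
          [/\ acts_by_scalar Rv W2 (- q), acts_by_scalar Rv Wmu q^-1
            & acts_by_scalar Rv W0 (q ^- (2 * n))]]].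

(** ** The braid group action on tensor powers and the link invariant *)

(* A multi-index x : tidx f m labels the basis vector
   v_{x 0} (x) ... (x) v_{x (f-1)} of the f-th tensor power. *)
Definition tidx (f m : nat) := {ffun 'I_f -> 'I_m}.

Lemma string_next_proof f (i : 'I_f.-1) : (i.+1 < f)%N.
Proof. by rewrite -ltn_predRL. Qed.
Definition string (f : nat) (i : 'I_f.-1) : 'I_f := widen_ord (leq_pred f) i.
Definition string_next (f : nat) (i : 'I_f.-1) : 'I_f := Ordinal (string_next_proof i).

(* id (x) ... (x) X (x) ... (x) id, with X even acting on the strings i, i+1. *)
Definition local_op f m (X : 'M[C]_(m * m)) (i : 'I_f.-1) : 'M[C]_#|tidx f m| :=
  \matrix_(k, l)
    let x : tidx f m := enum_val k in
    let y : tidx f m := enum_val l in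
    let: s := string i in let: t := string_next i in
    X (mxtens_index (x s, x t)) (mxtens_index (y s, y t))
      *+ [forall j, (j != s) && (j != t) ==> (x j == y j)].

(* X (x) ... (x) X for X even *)
Definition tens_power f m (X : 'M[C]_m) : 'M[C]_#|tidx f m| :=
  \matrix_(k, l) \prod_(j < f) X ((enum_val k : tidx f m) j)
                                 ((enum_val l : tidx f m) j).

Definition K2rho m (M : qops m) : 'M[C]_m :=
  \prod_(j < n) qK M j ^+ two_rho_coef j.

(* The supertrace on the f-th tensor power; it is the trace when all parities
   vanish. *)
Definition str f m (par : 'I_m -> bool) (X : 'M[C]_#|tidx f m|) : C :=
  \sum_k (-1) ^+ (\sum_(j < f) par ((enum_val k : tidx f m) j)) * X k k.

(* str_q in type osp and tr_{-q} in type so; k_{2rho} is grouplike. *)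
Definition qtrace f m (M : qops m) (X : 'M[C]_#|tidx f m|) : C :=
  str (qpar M) (tens_power f (K2rho M) *m X).

Definition qdimV : C := (- q ^+ (2 * n) + q ^- (2 * n)) / (q - q^-1) + 1.

Definition braid_rep f m (M : qops m) (Rm : 'M[C]_(m * m)) :
    braid_word f -> 'M[C]_#|tidx f m| :=
  let Rv := graded_perm (qpar M) *m Rm in
  braid_eval (local_op Rv) (local_op (invmx Rv)).

Definition markov_trace f m (M : qops m) (X : 'M[C]_#|tidx f m|) : C :=
  qtrace M X / qdimV ^+ f.

(* (z z~)^{-(f-1)/2} (z~/z)^{e(b)/2} psi(rho(b)) with z = q^{2n} / D,
   z~ = q^{-2n} / D, (z z~)^{-1/2} = D and (z~/z)^{1/2} = q^{-2n}. *)
Definition link_invariant f m (M : qops m) (Rm : 'M[C]_(m * m))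
    (b : braid_word f) : C :=
  qdimV ^+ f.-1 * (q ^- (2 * n)) ^ exponent_sum b
  * markov_trace M (braid_rep M Rm b).

End QuantumGroup.

(* Main.v *)
(* Let p be the deformation parameter (p = q for osp, p = -q for so), let sg = -1 for osp
   and sg = 1 for so, and put r = sg p^(2n). Rescaled by sg, the R-matrix becomes an
   operator g with eigenvalues p, -1/p, 1/r, so that the claim compares the quantum trace
   of a braid in g with the trace of the Birman-Wenzl-Murakami algebra at (r, p).

   That trace is unique: a word in g_0, ..., g_k is a combination of words in which g_k and
   e_k occur at most once, and there the Markov property determines it. Hence it suffices
   that g satisfies the BWM relations on tensor powers of V and that its quantum trace is a
   Markov trace. An sl_2-type argument on each simple root shows that V has a basis
   u_0, ..., u_2n, obtained by applying the f_i to the highest weight vector u_0.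

   The key formula is g (u_0 (x) u_a) = tau_a u_a (x) u_0: by induction on a, the difference
   of the two sides is a highest weight vector of a weight at which V (x) V has none, up to
   the three known ones, which are checked separately. It gives the braid relation on
   u_0 (x) V (x) V, hence everywhere since the f_i generate V. The trivial summand of
   V (x) V is a line, so e = 1 - (g - g^-1) / (p - p^-1) has rank one, which gives the
   relations for e g e; partial quantum traces of g and g^-1 commute with the f_i and
   preserve weights, hence are scalars, read off on u_0. *)

(* The hypotheses give the R-matrix only through its intertwining property and its spectrum, so the
   braid relation has to be extracted from these data. The functional on the BWM algebra at (r, p)
   is selected by [xget]; hence the normalised quantum trace must supply the existence of a trace as
   well as its value.

   The sign sg makes both types uniform: -q = sg p, so the eigenvalues -q, 1/q, q^-2n times sg are
   p, -1/p, 1/r. The function a - 1/a equals p - 1/p at a = p and a = -1/p, so e vanishes on the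
   first two summands. In the invariant the sign returns as sg^e(b), which is absorbed by r^-e(b).

   Weights are tracked by one integer, the pairing with 2 rho, which separates the 2n + 1 weights of
   V. A highest weight vector of V (x) V is determined by its coefficients at the u_a (x) u_0, and
   for a given height at most one of these is nonzero; so each height occurring there carries at
   most a line of highest weight vectors. That x is nonzero is used to normalise the trace, to match
   the coefficients of cup and cap with the quantum trace, and to exclude a defect at weight
   zero. *)
Require Import Defs.
From HB Require Import structures.
From mathcomp Require Import all_boot all_order all_algebra.
From mathcomp Require Import boolp classical_sets reals.
From mathcomp Require Import complex mxtens.
From mathcomp.multinomials Require Import monalg.
From mathcomp.finmap Require Import finmap.
From mathcomp Require Import zify ring.

Set Implicit Arguments.
Unset Strict Implicit.
Unset Printing Implicit Defensive.

Import GRing.Theory.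
Local Open Scope ring_scope.

(** * Uniqueness of the trace on the Birman-Wenzl-Murakami algebra *)

(* Scalars enter through the central morphism [K]; [G k] and [GV k] are meaningful only
   for [k < N]. *)
Section BWMTraceUnique.
Variables (C : fieldType) (A : pzRingType) (K : {rmorphism C -> A}) (r s : C) (N : nat).
Variables (G GV E : nat -> A).
Local Notation z := (s - s^-1).
Local Notation x := (bwm_x r s).
Hypotheses (r0 : r != 0) (z0 : z != 0).
Hypothesis Edef : forall k, E k = 1 - K z^-1 * (G k - GV k).
Hypothesis KC : forall c u, K c * u = u * K c.
Hypotheses (gVK : forall k, G k * GV k = 1) (gKV : forall k, GV k * G k = 1).
Hypothesis g_comm : forall i j, (i.+1 < j)%N -> G i * G j = G j * G i.
Hypothesis g_braid : forall k, (k.+1 < N)%N -> G k * G k.+1 * G k = G k.+1 * G k * G k.+1.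
Hypothesis eg : forall k, (k < N)%N -> E k * G k = K r^-1 * E k.
Hypothesis ege : forall k, (k.+1 < N)%N -> E k.+1 * G k * E k.+1 = K r * E k.+1.
Hypothesis egVe : forall k, (k.+1 < N)%N -> E k.+1 * GV k * E k.+1 = K r^-1 * E k.+1.
Implicit Types u v w : A.

Lemma KCA c u v : u * (K c * v) = K c * (u * v).
Proof. by rewrite mulrA -KC mulrA. Qed.

Lemma KK c d u : K c * (K d * u) = K (c * d) * u.
Proof. by rewrite rmorphM mulrA. Qed.

Lemma gV_skein k : GV k = G k - K z * (1 - E k).
Proof. by rewrite Edef subKr KK divff // rmorph1 mul1r subKr. Qed.

Lemma intertwine_gV u j k : u * G j = G k * u -> u * GV j = GV k * u.
Proof.
move=> H; rewrite -[u in RHS]mulr1 -(gVK j) (mulrA u) H.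
by rewrite !mulrA gKV mul1r.
Qed.

(** Since e is a polynomial in g and its inverse, every braid identity of this shape yields one for
    e; u = g_k g_(k+1) is the main case. *)
Lemma intertwine_e u j k : u * G j = G k * u -> u * E j = E k * u.
Proof.
move=> H; have HV := intertwine_gV H.
by rewrite !Edef (mulrBr u) (mulrBl u) mulr1 mul1r KCA mulrBr H HV -mulrBl mulrA.
Qed.

Lemma ge k : (k < N)%N -> G k * E k = K r^-1 * E k.
Proof. by move=> lt_k; rewrite (intertwine_e (erefl (G k * G k))) eg. Qed.

Lemma egV k : (k < N)%N -> E k * GV k = K r * E k.
Proof.
move=> lt_k; rewrite -[E k in RHS]mulr1 -(gVK k) (mulrA (E k)) eg //.
by rewrite -(mulrA (K r^-1)) KK divff // rmorph1 mul1r.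
Qed.

Lemma ee k : (k < N)%N -> E k * E k = K x * E k.
Proof.
move=> lt_k; rewrite {2}Edef (mulrBr (E k) 1) mulr1 KCA mulrBr eg // egV //.
rewrite -mulrBl -rmorphB KK -[X in X - _]mul1r -(rmorph1 K) -mulrBl -rmorphB.
by congr (K _ * _); rewrite /bwm_x; move: z z0 => w w0; field; rewrite ?w0 ?r0.
Qed.

Lemma gg k : (k < N)%N -> G k * G k = 1 + K z * G k - K (z * r^-1) * E k.
Proof.
move=> lt_k; have := gKV k; rewrite {1}gV_skein mulrBl -mulrA mulrBl mul1r eg //.
by move=> <-; rewrite (mulrBr (K z)) KK opprB addrA subrK addrK.
Qed.

(** Expanding the middle e by its definition leaves the scalar x - (r - r^-1) / (s - s^-1) = 1. *)
Lemma ege_lower k : (k.+1 < N)%N -> E k.+1 * E k * E k.+1 = E k.+1.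
Proof.
move=> lt_k; rewrite (Edef k) (mulrBr (E k.+1) 1) mulr1 mulrBl KCA -mulrA mulrBr mulrBl.
rewrite ege // egVe // ee // -mulrBl -rmorphB KK -mulrBl -rmorphB.
rewrite -[RHS]mul1r -(rmorph1 K); congr (K _ * _).
by rewrite /bwm_x; move: z z0 => w w0; field; rewrite ?w0 ?r0.
Qed.

Lemma gge k : (k.+1 < N)%N -> G k * G k.+1 * E k = E k.+1 * (G k * G k.+1).
Proof. by move=> lt_k; apply: intertwine_e; rewrite g_braid // mulrA. Qed.

Lemma gge' k : (k.+1 < N)%N -> G k.+1 * G k * E k.+1 = E k * (G k.+1 * G k).
Proof. by move=> lt_k; apply: intertwine_e; rewrite -g_braid // mulrA. Qed.

Lemma ge_lower k : (k.+1 < N)%N -> G k.+1 * E k = GV k * E k.+1 * (G k * G k.+1).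
Proof.
by move=> lt_k; rewrite -(mulrA (GV k)) -gge // (mulrA (GV k)) (mulrA (GV k)) gKV mul1r.
Qed.

Lemma eg_lower k : (k.+1 < N)%N -> E k * G k.+1 = G k.+1 * G k * E k.+1 * GV k.
Proof. by move=> lt_k; rewrite gge' // -(mulrA (E k)) -(mulrA (G k.+1)) gVK mulr1. Qed.

(** The image of the algebra on k + 1 strings. *)
Inductive gsub (k : nat) : A -> Prop :=
| Gsub_g i : (i < k)%N -> gsub k (G i)
| Gsub_gV i : (i < k)%N -> gsub k (GV i)
| Gsub_K c : gsub k (K c)
| Gsub_D u v : gsub k u -> gsub k v -> gsub k (u + v)
| Gsub_M u v : gsub k u -> gsub k v -> gsub k (u * v).

Definition ge_gen (t : bool) (k : nat) : A := if t then E k else G k.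

Inductive gspan (k : nat) : A -> Prop :=
| Gspan_sub u : gsub k u -> gspan k u
| Gspan_M t u v : gsub k u -> gsub k v -> gspan k (u * ge_gen t k * v)
| Gspan_D u v : gspan k u -> gspan k v -> gspan k (u + v).

Lemma gsub1 k : gsub k 1.
Proof. by rewrite -(rmorph1 K); apply: Gsub_K. Qed.

Lemma gsubZ k c u : gsub k u -> gsub k (K c * u).
Proof. by move=> ku; apply: Gsub_M => //; apply: Gsub_K. Qed.

Lemma gsubN k u : gsub k u -> gsub k (- u).
Proof. by move=> ku; rewrite -mulN1r -(rmorph1 K) -rmorphN; apply: gsubZ. Qed.

Lemma gsub_ge t k i : (i < k)%N -> gsub k (ge_gen t i).
Proof.
case: t => lt_ik; last exact: Gsub_g.
rewrite /ge_gen Edef; apply: Gsub_D; first exact: gsub1.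
apply/gsubN/gsubZ/Gsub_D; first exact: Gsub_g.
exact/gsubN/Gsub_gV.
Qed.

Lemma gspan_mull k u v : gsub k u -> gspan k v -> gspan k (u * v).
Proof.
move=> ku; elim=> [w kw|t w1 w2 k1 k2|w1 w2 _ k1 _ k2].
- exact/Gspan_sub/Gsub_M.
- by rewrite 2!mulrA; apply: Gspan_M => //; apply: Gsub_M.
by rewrite mulrDr; apply: Gspan_D.
Qed.

Lemma gspan_mulr k u v : gsub k u -> gspan k v -> gspan k (v * u).
Proof.
move=> ku; elim=> [w kw|t w1 w2 k1 k2|w1 w2 _ k1 _ k2].
- exact/Gspan_sub/Gsub_M.
- by rewrite -mulrA; apply: Gspan_M => //; apply: Gsub_M.
by rewrite mulrDl; apply: Gspan_D.
Qed.

Lemma gspanZ k c u : gspan k u -> gspan k (K c * u).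
Proof. by apply: gspan_mull; apply: Gsub_K. Qed.

Lemma gspanN k u : gspan k u -> gspan k (- u).
Proof. by move=> ku; rewrite -mulN1r -(rmorph1 K) -rmorphN; apply: gspanZ. Qed.

Lemma gspan_ge t k : gspan k (ge_gen t k).
Proof. by rewrite -[ge_gen t k]mulr1 -[ge_gen t k]mul1r; apply: Gspan_M; apply: gsub1. Qed.

Lemma gspan_ge2 t t' k : (k < N)%N -> gspan k (ge_gen t k * ge_gen t' k).
Proof.
move=> lt_k; case: t; case: t' => /=.
- by rewrite ee //; apply/gspanZ/(gspan_ge true).
- by rewrite eg //; apply/gspanZ/(gspan_ge true).
- by rewrite ge //; apply/gspanZ/(gspan_ge true).
rewrite gg //; apply: Gspan_D; last exact/gspanN/gspanZ/(gspan_ge true).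
by apply: Gspan_D; [apply/Gspan_sub/gsub1 | apply/gspanZ/(gspan_ge false)].
Qed.

(** The eight words on three strings. An e sandwiched between two letters of the other index
    collapses, and an e next to a g of the other index can be carried across it by the braid
    relation, until a single letter of index k + 1 is left. *)
Lemma gspan_ge3 t t' t'' k : (k.+1 < N)%N ->
  gspan k.+1 (ge_gen t k.+1 * ge_gen t' k * ge_gen t'' k.+1).
Proof.
move=> lt_k; have kG : gsub k.+1 (G k) by apply: Gsub_g.
have kV : gsub k.+1 (GV k) by apply: Gsub_gV.
have kE : gsub k.+1 (E k) := gsub_ge true (ltnSn k).
have sE : gspan k.+1 (E k.+1) := gspan_ge true _.
have lk1 := ltnW lt_k.
have heb : E k.+1 * E k * G k.+1 = E k.+1 * GV k.
  rewrite -(mulrA (E k.+1)) eg_lower // !mulrA eg // -(mulrA (K _)) -(mulrA (K _)).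
  by rewrite ege // KK mulVf // rmorph1 mul1r.
have bE : G k.+1 * E k = GV k * E k.+1 * G k * G k.+1 by rewrite ge_lower // mulrA.
case: t t' t'' => [] [] [] /=.
- by rewrite ege_lower.
- by rewrite heb; apply: gspan_mulr.
- by rewrite ege //; apply: gspanZ.
- by rewrite -(mulrA (E k.+1)) -gge //; apply: gspan_mulr => //;
    apply: gspan_mull => //; apply: (gspan_ge false).
- rewrite bE -(mulrA _ _ (E k.+1)) ge // KCA -(mulrA (GV k)) -(mulrA (GV k)) ege //.
  by apply: gspanZ; apply: gspan_mull => //; apply: gspanZ.
(* The one case that uses the quadratic relation: carrying e_k across with [ge_lower] produces
   g_(k+1)^2. *)
- have -> : G k.+1 * E k * G k.+1 =
      GV k * E k.+1 * G k + K z * (G k.+1 * E k) - K z * (GV k * E k.+1).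
    rewrite {1}bE -(mulrA _ (G k.+1)) gg // mulrBr mulrDr mulr1 KCA -bE; congr (_ - _).
    by rewrite KCA -(mulrA (GV k)) -(mulrA (GV k)) ege // KCA KK -mulrA mulVf // mulr1.
  apply: Gspan_D; first apply: Gspan_D.
  + by apply: gspan_mulr => //; apply: gspan_mull.
  + by apply/gspanZ/gspan_mulr => //; apply: (gspan_ge false).
  by apply/gspanN/gspanZ/gspan_mull.
- rewrite gge' // mulrA; apply: gspan_mulr => //.
  by apply: gspan_mull => //; apply: (gspan_ge false).
rewrite -g_braid //; apply: gspan_mulr => //.
by apply: gspan_mull => //; apply: (gspan_ge false).
Qed.

Lemma gsub_comm k t u : gsub k u -> ge_gen t k.+1 * u = u * ge_gen t k.+1.
Proof.
have ge_comm v : v * G k.+1 = G k.+1 * v -> ge_gen t k.+1 * v = v * ge_gen t k.+1.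
  by case: t => H //=; rewrite -(intertwine_e H).
elim=> [i lt_ik|i lt_ik|c|v w _ IHv _ IHw|v w _ IHv _ IHw].
- by apply/ge_comm/g_comm.
- by apply/ge_comm/esym/intertwine_gV/esym/g_comm.
- by rewrite KC.
- by rewrite mulrDl mulrDr IHv IHw.
by rewrite mulrA IHv -!mulrA IHw.
Qed.

Lemma gsub0 u : gsub 0 u -> exists c, u = K c.
Proof.
elim=> [i|i|c|v w _ [c ->] _ [d ->]|v w _ [c ->] _ [d ->]] //; first by exists c.
  by exists (c + d); rewrite rmorphD.
by exists (c * d); rewrite rmorphM.
Qed.

Lemma gsub_gspan_step k :
  (k < N)%N ->
  (forall t t' w, gsub k w -> gspan k (ge_gen t k * w * ge_gen t' k)) ->
  forall u, gsub k.+1 u -> gspan k u.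
Proof.
move=> lt_k sandwich u ku; rewrite -[u]mulr1.
have mul_ge t v : gspan k v -> gspan k (ge_gen t k * v).
  elim=> [w kw|t' w1 w2 k1 k2|w1 w2 _ k1 _ k2].
  - by apply: gspan_mulr => //; apply: gspan_ge.
  - by rewrite !mulrA; apply: gspan_mulr => //; apply: sandwich.
  by rewrite mulrDr; apply: Gspan_D.
have mul_g i v : (i < k.+1)%N -> gspan k v -> gspan k (G i * v).
  rewrite ltnS leq_eqVlt => /orP[/eqP->|lt_ik]; first exact: (mul_ge false).
  by apply/gspan_mull/Gsub_g.
(* The induction shows that left multiplication by u preserves the whole of [gspan k]; the claim is
   the case of the right factor 1. *)
elim: ku 1 (Gspan_sub (gsub1 k)) => {u}
  [i lt_ik|i lt_ik|c|u u' _ IHu _ IHu'|u u' _ IHu _ IHu'] v kv.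
- exact: mul_g.
- move: lt_ik; rewrite ltnS leq_eqVlt => /orP[/eqP->|lt_ik].
    rewrite gV_skein mulrBl; apply: Gspan_D; first exact: (mul_ge false).
    rewrite -mulrA; apply/gspanN/gspanZ; rewrite mulrBl mul1r; apply: Gspan_D => //.
    exact/gspanN/(mul_ge true).
  by apply/gspan_mull => //; apply: Gsub_gV.
- exact: gspanZ.
- by rewrite mulrDl; apply: Gspan_D; [apply: IHu|apply: IHu'].
by rewrite -mulrA; apply/IHu/IHu'.
Qed.

(* Every element on k + 2 strings is a combination of words in which g_k and e_k
   together occur at most once. *)
Lemma gsub_gspan k u : (k < N)%N -> gsub k.+1 u -> gspan k u.
Proof.
elim: k u => [|k IHk] u lt_k; apply: gsub_gspan_step => // {u} t t' w.
  by move=> /gsub0[c ->]; rewrite -KC -mulrA; apply/gspanZ/gspan_ge2.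
(* By induction w contains at most one letter of index k. Without such a letter w commutes with the
   outer letters and two of them meet; with one, the remaining factors commute outwards and a word
   of three letters is left. *)
move=> /IHk - /(_ (ltnW lt_k)); elim=> [v kv|t'' v1 v2 k1 k2|v1 v2 _ s1 _ s2].
- rewrite gsub_comm // -mulrA; apply: gspan_mull; last exact: gspan_ge2.
  by elim: kv => *; [apply: Gsub_g; lia|apply: Gsub_gV; lia|apply: Gsub_K|apply: Gsub_D
                    |apply: Gsub_M].
- have up v : gsub k v -> gsub k.+1 v.
    by elim=> *; [apply: Gsub_g; lia|apply: Gsub_gV; lia|apply: Gsub_K|apply: Gsub_D
                 |apply: Gsub_M].
  rewrite -!mulrA (mulrA (ge_gen t _)) gsub_comm // -!mulrA -gsub_comm //.
  rewrite (mulrA (ge_gen t'' _)) (mulrA (ge_gen t _)) (mulrA (ge_gen t _)).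
  by apply: gspan_mull; [apply: up|apply: gspan_mulr; [apply: up|apply: gspan_ge3]].
by rewrite mulrDr mulrDl; apply: Gspan_D.
Qed.

(** Conjugation by the braid g_0 ... g_(k-1) raises the index of each g_i with i + 1 < k by one. *)
Fixpoint coxeter (k : nat) : A := if k is l.+1 then coxeter l * G l else 1.
Fixpoint coxeterV (k : nat) : A := if k is l.+1 then GV l * coxeterV l else 1.

Lemma coxeterK k : coxeter k * coxeterV k = 1.
Proof.
by elim: k => [|k IH] /=; rewrite ?mulr1 // mulrA -(mulrA (coxeter k)) gVK mulr1.
Qed.

Lemma coxeterVK k : coxeterV k * coxeter k = 1.
Proof.
by elim: k => [|k IH] /=; rewrite ?mulr1 // mulrA -(mulrA (GV k)) IH mulr1 gKV.
Qed.

Lemma coxeter_comm k i : (k < i)%N -> coxeter k * G i = G i * coxeter k.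
Proof.
elim: k => [|k IH] lt_ki /=; first by rewrite mul1r mulr1.
by rewrite -mulrA g_comm // mulrA IH ?mulrA //; lia.
Qed.

Lemma coxeter_shift k i : (k <= N)%N -> (i.+1 < k)%N -> coxeter k * G i = G i.+1 * coxeter k.
Proof.
elim: k => // k IH le_kN; rewrite ltnS leq_eqVlt => /orP[/eqP ek|lt_ik] /=.
  rewrite -ek /= -!mulrA (mulrA (G i)) g_braid ?ek // !mulrA.
  by rewrite coxeter_comm // -ek.
by rewrite -mulrA -g_comm // mulrA IH ?mulrA // ltnW.
Qed.

Lemma coxeter_shift_sub k u : (k < N)%N -> gsub k u ->
  exists2 v, gsub k.+1 v & coxeter N * u = v * coxeter N.
Proof.
move=> lt_k; elim=> [i lt_i|i lt_i|c|u1 u2 _ [v1 k1 e1] _ [v2 k2 e2]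
  |u1 u2 _ [v1 k1 e1] _ [v2 k2 e2]].
- exists (G i.+1); [exact: Gsub_g|apply: coxeter_shift => //; lia].
- exists (GV i.+1); [exact: Gsub_gV|apply: intertwine_gV; apply: coxeter_shift => //; lia].
- by exists (K c); [apply: Gsub_K|rewrite KC].
- by exists (v1 + v2); [apply: Gsub_D|rewrite mulrDr mulrDl e1 e2].
by exists (v1 * v2); [apply: Gsub_M|rewrite mulrA e1 -!mulrA e2].
Qed.

Record bwm_markov (tg te : C) (tr : A -> C) : Prop := {
  markovD : {morph tr : u v / u + v};
  markovZ : forall c u, tr (K c * u) = c * tr u;
  markov1 : tr 1 = 1;
  markovC : forall u v, tr (u * v) = tr (v * u);
  markov_ge : forall t k u v, k.+1 = N -> gsub k u -> gsub k v ->
    tr (u * ge_gen t k * v) = (if t then te else tg) * tr (u * v)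
}.

(** The Markov property is assumed for the last generator only. Conjugation by the Coxeter word
    preserves the trace and raises all indices by one, so the property descends to every smaller
    k. *)
Lemma markov_lower tg te tr t k u v : bwm_markov tg te tr -> (k < N)%N ->
  gsub k u -> gsub k v -> tr (u * ge_gen t k * v) = (if t then te else tg) * tr (u * v).
Proof.
move=> tr_m lt_k; have [d ed] : exists d, (d + k.+1)%N = N by exists (N - k.+1)%N; lia.
elim: d k u v ed lt_k => [|d IHd] k u v ed lt_k ku kv; first exact: (markov_ge tr_m).
have lt_k1 : (k.+1 < N)%N by lia.
have conj w w' : coxeter N * w = w' * coxeter N -> tr w = tr w'.
  move=> e; rewrite -[w]mul1r -(coxeterVK N) -mulrA e mulrA.
  by rewrite (markovC tr_m) mulrA coxeterK mul1r.
have [u' ku' eu] := coxeter_shift_sub lt_k ku.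
have [v' kv' ev] := coxeter_shift_sub lt_k kv.
have eg' : coxeter N * ge_gen t k = ge_gen t k.+1 * coxeter N.
  have e := @coxeter_shift N k (leqnn N) lt_k1.
  by case: (t) => //=; apply: intertwine_e.
rewrite (conj _ (u' * ge_gen t k.+1 * v')).
  have ed' : (d + k.+2)%N = N by lia.
  rewrite (IHd _ _ _ ed' lt_k1 ku' kv'); congr (_ * _); apply/esym/conj.
  by rewrite mulrA eu -!mulrA ev.
rewrite !mulrA eu -(mulrA u') eg' (mulrA u') -(mulrA (u' * _) (coxeter N) v) ev.
by rewrite !mulrA.
Qed.

Lemma bwm_markov_unique tg te tr tr' u : bwm_markov tg te tr -> bwm_markov tg te tr' ->
  gsub N u -> tr u = tr' u.
Proof.
move=> tr_m tr_m'; have : (N <= N)%N by [].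
elim: {-2}N u => [|k IHk] u lt_k.
  move=> /gsub0[c ->]; rewrite -[K c]mulr1 (markovZ tr_m) (markovZ tr_m').
  by rewrite (markov1 tr_m) (markov1 tr_m').
move=> /(gsub_gspan lt_k); elim=> [v kv|t v1 v2 k1 k2|v1 v2 _ e1 _ e2].
- by apply: IHk => //; apply: ltnW.
- rewrite (markov_lower t tr_m lt_k k1 k2) (markov_lower t tr_m' lt_k k1 k2).
  by congr (_ * _); apply: IHk (ltnW lt_k) (Gsub_M k1 k2).
by rewrite (markovD tr_m) (markovD tr_m') e1 e2.
Qed.

End BWMTraceUnique.

(** * Scalars and relations in a quotient algebra *)

Section QuotientScale.
Variables (C : fieldType) (A : lalgType C) (S : A -> Prop).
Implicit Types u v : quot_alg S.

Lemma quot_scale_mull (c : C) u v : c *: (u * v) = (c *: u) * v.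
Proof.
rewrite -[u]quot_class_repr -[v]quot_class_repr; set x := repr u; set y := repr v.
change (quot_scale c (quot_mul (quot_class S x) (quot_class S y)) =
  quot_mul (quot_scale c (quot_class S x)) (quot_class S y)).
by rewrite -quot_classM -!quot_classZ -quot_classM scalerAl.
Qed.

Local Notation cls := (quot_class S).

Lemma quot_class_mul (a b : A) : cls (a * b) = (cls a : quot_alg S) * cls b.
Proof. exact: quot_classM. Qed.

Lemma quot_class_scale (k : C) (a : A) : cls (k *: a) = k *: (cls a : quot_alg S).
Proof. exact: quot_classZ. Qed.

Lemma quot_class_sub (a b : A) : cls (a - b) = (cls a : quot_alg S) - cls b.
Proof. by rewrite -[b in LHS]scale1r -scaleNr quot_classD quot_classZ -scaleN1r. Qed.

Lemma quot_class_add (a b : A) : cls (a + b) = (cls a : quot_alg S) + cls b.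
Proof. exact: quot_classD. Qed.

Lemma quot_rel (a b : A) : S (a - b) -> cls a = cls b.
Proof. by move=> Sab; apply/quot_classP/Ideal_gen. Qed.

Lemma quot_rel1 (a b : A) : S (a * b - 1) -> (cls a : quot_alg S) * cls b = 1.
Proof. by move/quot_rel; rewrite quot_class_mul. Qed.

Lemma quot_rel2 (a b c d : A) :
  S (a * b - c * d) -> (cls a : quot_alg S) * cls b = (cls c : quot_alg S) * cls d.
Proof. by move/quot_rel; rewrite !quot_class_mul. Qed.

Lemma quot_rel2Z (a b c : A) (k : C) :
  S (a * b - k *: c) -> (cls a : quot_alg S) * cls b = k *: (cls c : quot_alg S).
Proof. by move/quot_rel; rewrite quot_class_mul quot_class_scale. Qed.

Lemma quot_rel3 (a b c d e h : A) : S (a * b * c - d * e * h) ->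
  (cls a : quot_alg S) * cls b * cls c = (cls d : quot_alg S) * cls e * cls h.
Proof. by move/quot_rel; rewrite !quot_class_mul. Qed.

Lemma quot_rel3Z (a b c d : A) (k : C) : S (a * b * c - k *: d) ->
  (cls a : quot_alg S) * cls b * cls c = k *: (cls d : quot_alg S).
Proof. by move/quot_rel; rewrite !quot_class_mul quot_class_scale. Qed.

Hypothesis scale_mulr : forall (c : C) (x y : A), c *: (x * y) = x * (c *: y).

Lemma quot_scale_mulr (c : C) u v : c *: (u * v) = u * (c *: v).
Proof.
rewrite -[u]quot_class_repr -[v]quot_class_repr; set x := repr u; set y := repr v.
change (quot_scale c (quot_mul (quot_class S x) (quot_class S y)) =
  quot_mul (quot_class S x) (quot_scale c (quot_class S y))).
by rewrite -quot_classM -!quot_classZ -quot_classM scale_mulr.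
Qed.

End QuotientScale.

(** [bwm_free] is typed as an [lalgType]; this second compatibility, checked on monomials, makes
    scalars central in the quotient. *)
Lemma malg_scale_mulr (C : fieldType) (K : monomType) (c : C) (x y : {malg C[K]}) :
  c *: (x * y) = x * (c *: y).
Proof.
rewrite [x]monalgE !mulr_suml scaler_sumr; apply: eq_bigr => k _.
rewrite [y]monalgE mulr_sumr [in RHS]scaler_sumr mulr_sumr scaler_sumr.
apply: eq_bigr => l _.
have sc (a b : C) j : a *: << b *g j >> = << a * b *g j >> :> {malg C[K]}.
  by apply/malgP=> i; rewrite mcoeffZ !mcoeffU mulrnAr.
by rewrite !malgM_def sc !fgmulUU sc mulrCA.
Qed.

Section BWMAlgebra.
Variables (C : fieldType) (r s : C) (f : nat).
Local Notation B := (BWM r s f).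
Local Notation z := (s - s^-1).
Implicit Types u v : B.

Lemma bwm_scale_mull (c : C) u v : c *: (u * v) = (c *: u) * v.
Proof. exact: quot_scale_mull. Qed.

Lemma bwm_scale_mulr (c : C) u v : c *: (u * v) = u * (c *: v).
Proof. by apply: quot_scale_mulr => d y w; apply: malg_scale_mulr. Qed.

(* The generators indexed by nat, with value 1 out of range. *)
Definition gen_g (k : nat) : B := if insub k is Some i then bwm_g r s i else 1.
Definition gen_gV (k : nat) : B := if insub k is Some i then bwm_gV r s i else 1.
Definition gen_e (k : nat) : B := 1 - z^-1 *: (gen_g k - gen_gV k).

Lemma gen_gE (i : 'I_f.-1) : gen_g i = bwm_g r s i.
Proof. by rewrite /gen_g valK. Qed.

Lemma gen_gVE (i : 'I_f.-1) : gen_gV i = bwm_gV r s i.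
Proof. by rewrite /gen_gV valK. Qed.

Lemma gen_eE (i : 'I_f.-1) : gen_e i = bwm_e r s i.
Proof.
rewrite /gen_e gen_gE gen_gVE /bwm_e /free_e quot_class_sub quot_class_scale.
by rewrite quot_class_sub.
Qed.

Local Notation rel := (@bwm_relator C r s f).
Local Notation fg := (@free_g C f).
Local Notation fgV := (@free_gV C f).
Local Notation fe := (@free_e C s f).

Lemma gVK k : gen_g k * gen_gV k = 1.
Proof.
rewrite /gen_g /gen_gV; case: insubP => [i _ _|_]; last exact: mulr1.
exact: (@quot_rel1 C _ rel (fg i) (fgV i) (BWM_gV r s i)).
Qed.

Lemma gKV k : gen_gV k * gen_g k = 1.
Proof.
rewrite /gen_g /gen_gV; case: insubP => [i _ _|_]; last exact: mulr1.
exact: (@quot_rel1 C _ rel (fgV i) (fg i) (BWM_Vg r s i)).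
Qed.

Lemma g_comm i j : (i.+1 < j)%N -> gen_g i * gen_g j = gen_g j * gen_g i.
Proof.
move=> lt_ij; rewrite /gen_g; case: insubP => [i' _ ei|_]; last by rewrite mul1r mulr1.
case: (@insubP _ _ 'I_f.-1 j) => [j' _ ej|_]; last by rewrite mul1r mulr1.
have lt_ij' : (i'.+1 < j')%N by rewrite ei ej.
exact: (@quot_rel2 C _ rel (fg i') (fg j') (fg j') (fg i') (BWM_comm r s lt_ij')).
Qed.

Lemma g_braid k : (k.+1 < f.-1)%N ->
  gen_g k * gen_g k.+1 * gen_g k = gen_g k.+1 * gen_g k * gen_g k.+1.
Proof.
move=> lt_k; pose i := Ordinal (ltnW lt_k); pose j := Ordinal lt_k; rewrite (gen_gE i) (gen_gE j).
exact: (@quot_rel3 C _ rel (fg i) (fg j) (fg i) (fg j) (fg i) (fg j)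
  (@BWM_braid _ r s _ i j erefl)).
Qed.

Lemma eg k : (k < f.-1)%N -> gen_e k * gen_g k = r^-1 *: gen_e k.
Proof.
move=> lt_k; pose i := Ordinal lt_k; rewrite (gen_gE i) (gen_eE i).
exact: (@quot_rel2Z C _ rel (fe i) (fg i) (fe i) r^-1 (BWM_eg r s i)).
Qed.

Lemma ege k : (k.+1 < f.-1)%N ->
  gen_e k.+1 * gen_g k * gen_e k.+1 = r *: gen_e k.+1.
Proof.
move=> lt_k; pose i := Ordinal (ltnW lt_k); pose j := Ordinal lt_k; rewrite (gen_gE i) (gen_eE j).
exact: (@quot_rel3Z C _ rel (fe j) (fg i) (fe j) (fe j) r (@BWM_ege  _ r s _ i j erefl)).
Qed.

Lemma egVe k : (k.+1 < f.-1)%N ->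
  gen_e k.+1 * gen_gV k * gen_e k.+1 = r^-1 *: gen_e k.+1.
Proof.
move=> lt_k; pose i := Ordinal (ltnW lt_k); pose j := Ordinal lt_k; rewrite (gen_gVE i) (gen_eE j).
exact: (@quot_rel3Z C _ rel (fe j) (fgV i) (fe j) (fe j) r^-1 (@BWM_egVe _ r s _ i j erefl)).
Qed.

Definition bwm_scalar (c : C) : B := c *: (1 : B).

Fact bwm_scalar_zmod : zmod_morphism bwm_scalar.
Proof. by move=> c d; rewrite /bwm_scalar scalerBl. Qed.

Fact bwm_scalar_monoid : monoid_morphism bwm_scalar.
Proof.
by split=> [|c d]; rewrite /bwm_scalar ?scale1r // -bwm_scale_mull mul1r scalerA.
Qed.

HB.instance Definition _ := GRing.isZmodMorphism.Build C B bwm_scalar bwm_scalar_zmod.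
HB.instance Definition _ := GRing.isMonoidMorphism.Build C B bwm_scalar bwm_scalar_monoid.

Lemma bwm_scalarE c u : bwm_scalar c * u = c *: u.
Proof. by rewrite /bwm_scalar -bwm_scale_mull mul1r. Qed.

Lemma bwm_scalarC c u : bwm_scalar c * u = u * bwm_scalar c.
Proof. by rewrite bwm_scalarE /bwm_scalar -bwm_scale_mulr mulr1. Qed.

End BWMAlgebra.

Lemma malg_word_ind (C : fieldType) (X : choiceType) (P : {malg C[{fmonom X}]} -> Prop) :
  (forall c, P (c *: 1)) -> (forall i, P (mkmalgU (fmu i) 1)) ->
  (forall a b, P a -> P b -> P (a + b)) -> (forall a b, P a -> P b -> P (a * b)) ->
  forall a, P a.
Proof.
move=> Pc Pg PD PM a; rewrite [a]monalgE.
have P0 : P 0 by have := Pc 0; rewrite scale0r.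
elim/big_ind: _ => // k _; have -> : << a@_k *g k >> = a@_k *: 1 * << 1 *g k >>.
  by rewrite -scalerAl mul1r; apply/malgP=> i; rewrite mcoeffZ !mcoeffU mulrnAr mulr1.
apply: (PM) => //; case: k => w; elim: w => [|i w IHw].
  by have := Pc 1; rewrite scale1r -fmoneE.
suff -> : << FMonom (i :: w) >> = mkmalgU (fmu i) 1 * << FMonom w >> :> {malg C[{fmonom X}]}.
  exact: PM.
rewrite malgM_def fgmulUU mulr1; congr (mkmalgU _ _).
by apply/eqP; rewrite fmP fmM fmuE.
Qed.

Section BWMTrace.
Variables (C : fieldType) (r s : C) (f : nat).
Hypotheses (r0 : r != 0) (z0 : s - s^-1 != 0).
Local Notation B := (BWM r s f).
Local Notation K := (bwm_scalar r s f).
Local Notation G := (gen_g r s f).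
Local Notation GV := (gen_gV r s f).
Local Notation E := (gen_e r s f).
Implicit Types u v : B.

Lemma gsub_bwm u : gsub K G GV f.-1 u.
Proof.
rewrite -[u]quot_class_repr; elim/malg_word_ind: (repr u) => [c|[i []]|a b|a b].
- have -> : quot_class (@bwm_relator C r s f) (c *: 1) = K c by apply: quot_class_scale.
  exact: Gsub_K.
- by have := Gsub_gV K G GV (ltn_ord i); rewrite gen_gVE.
- by have := Gsub_g K G GV (ltn_ord i); rewrite gen_gE.
- by rewrite quot_class_add; apply: Gsub_D.
by rewrite quot_class_mul; apply: Gsub_M.
Qed.

Lemma gsub_lower k u : k.+2 = f -> gsub K G GV k u -> bwm_lower u.
Proof.
move=> ef; elim=> [i lt_ik|i lt_ik|c|v w _ IHv _ IHw|v w _ IHv _ IHw].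
- have lt_if : (i < f.-1)%N by lia.
  by rewrite (gen_gE _ _ (Ordinal lt_if)); apply: Lower_g; rewrite /=; lia.
- have lt_if : (i < f.-1)%N by lia.
  by rewrite (gen_gVE _ _ (Ordinal lt_if)); apply: Lower_gV; rewrite /=; lia.
- exact/Lower_Z/Lower_1.
- exact: Lower_D.
exact: Lower_M.
Qed.

Lemma is_bwm_trace_markov tr : (1 < f)%N ->
  is_bwm_trace tr -> bwm_markov K f.-1 G GV E (r / bwm_x r s) (bwm_x r s)^-1 tr.
Proof.
move=> f_gt1 [trL tr1 trC tre trg trV trM]; split=> //.
- by move=> u v; have := trL 1 u v; rewrite scale1r mul1r.
- move=> c u; rewrite bwm_scalarE; have := trL c u 0; rewrite addr0.
  have := trL 0 1 0; rewrite scale0r add0r mul0r add0r.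
  by have := trL (-1) 0 0; rewrite scaler0 addr0 mulN1r addNr => -> _ ->; rewrite addr0.
move=> t k u v ek /gsub_lower uL /gsub_lower vL.
have lt_k : (k < f.-1)%N by rewrite -ek.
have ek' : k.+2 = f by lia.
case: t; rewrite /ge_gen.
  have := trM (Ordinal lt_k) _ u v ek' (or_intror erefl) (uL ek') (vL ek').
  by rewrite tre (gen_eE _ _ (Ordinal lt_k)).
have := trM (Ordinal lt_k) _ u v ek' (or_introl erefl) (uL ek') (vL ek').
by rewrite trg (gen_gE _ _ (Ordinal lt_k)).
Qed.

Lemma bwm_trace_unique tr tr' : (1 < f)%N ->
  is_bwm_trace tr -> is_bwm_trace tr' -> tr =1 tr' :> (B -> C).
Proof.
move=> f_gt1 /(is_bwm_trace_markov f_gt1) trM /(is_bwm_trace_markov f_gt1) trM' u.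
apply: (bwm_markov_unique r0 z0) trM trM' (gsub_bwm u).
- by move=> k; rewrite bwm_scalarE.
- exact: bwm_scalarC.
- exact: gVK.
- exact: gKV.
- exact: g_comm.
- exact: g_braid.
- by move=> k lt_k; rewrite bwm_scalarE; apply: eg.
- by move=> k lt_k; rewrite bwm_scalarE; apply: ege.
by move=> k lt_k; rewrite bwm_scalarE; apply: egVe.
Qed.

(** As soon as one trace exists, [xget] returns a trace, and uniqueness identifies it with the given
    one. *)
Lemma bwm_traceE (tr : B -> C) : (1 < f)%N -> is_bwm_trace tr -> @bwm_trace C r s f =1 tr.
Proof.
move=> f_gt1 tr_tr; apply: (bwm_trace_unique f_gt1 _ tr_tr).
exact: (@xgetPex _ (fun=> 0) [set tr : B -> C | is_bwm_trace tr]%classic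
  (ex_intro _ tr tr_tr)).
Qed.

End BWMTrace.

(** * Matrix representations of the Birman-Wenzl-Murakami algebra *)

Section WordEval.
Variables (C : fieldType) (X : choiceType) (M : nat) (h : X -> 'M[C]_M).

Definition word_eval (a : {malg C[{fmonom X}]}) : 'M[C]_M :=
  \sum_(k <- msupp a) a@_k *: \prod_(i <- (k : seq X)) h i.

Lemma word_evalEw (d : {fset {fmonom X}}) a : (msupp a `<=` d)%fset ->
  word_eval a = \sum_(k <- d) a@_k *: \prod_(i <- (k : seq X)) h i.
Proof.
move=> le_d; rewrite [LHS](big_fset_incl _ le_d) // => k _ /mcoeff_outdom ->.
by rewrite scale0r.
Qed.

Fact word_eval_linear : linear word_eval.
Proof.
move=> c a b; pose d := (msupp (c *: a + b) `|` (msupp a `|` msupp b))%fset.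
rewrite !(@word_evalEw d) ?fsubsetUl //.
- rewrite scaler_sumr -big_split; apply: eq_bigr => k _ /=.
  by rewrite mcoeffD mcoeffZ scalerDl scalerA.
- by rewrite /d fsetUA fsubsetUr.
by rewrite /d fsetUCA fsubsetUl.
Qed.

HB.instance Definition _ :=
  GRing.isLinear.Build C {malg C[{fmonom X}]} 'M[C]_M *:%R word_eval word_eval_linear.

Lemma word_evalU (c : C) k : word_eval << c *g k >> = c *: \prod_(i <- (k : seq X)) h i.
Proof. by rewrite (word_evalEw msuppU_le) big_seq_fset1 mcoeffUU. Qed.

Lemma word_eval1 : word_eval 1 = 1.
Proof. by rewrite word_evalU scale1r fm1 big_nil. Qed.

Lemma word_evalZ c a : word_eval (c *: a) = c *: word_eval a.
Proof. exact: linearZ. Qed.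

Lemma word_evalM a b : word_eval (a * b) = word_eval a * word_eval b.
Proof.
rewrite malgME linear_sum [word_eval a in RHS]/word_eval mulr_suml; apply: eq_bigr => k _.
rewrite linear_sum [word_eval b in RHS]/word_eval mulr_sumr; apply: eq_bigr => l _ /=.
by rewrite word_evalU fmM big_cat /= -!mulmxE -scalemxAl -scalemxAr scalerA.
Qed.

End WordEval.

Section IdealKernel.
Variables (C : fieldType) (A : lalgType C) (M : nat) (ev : A -> 'M[C]_M).
Hypotheses (evB : forall a b, ev (a - b) = ev a - ev b) (ev1 : ev 1 = 1).
Hypotheses (evM : forall a b, ev (a * b) = ev a * ev b).
Hypotheses (evZ : forall c a, ev (c *: a) = c *: ev a).

Lemma ideal_kernel (S : A -> Prop) a :
  (forall b, S b -> ev b = 0) -> two_sided_ideal S a -> ev a = 0.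
Proof.
move=> S0; have ev0 : ev 0 = 0 by rewrite -(subrr 0) evB subrr.
elim=> {a} [a /S0||a b _ IHa _ IHb|a b _ IHb|a b _ IHb] //.
- by rewrite -[b]opprK -[- b]sub0r !evB ev0 IHa IHb !subr0.
- by rewrite evM IHb mulr0.
by rewrite evM IHb mul0r.
Qed.

Lemma ev_rel1 a b : ev a * ev b = 1 -> ev (a * b - 1) = 0.
Proof. by rewrite evB evM ev1 => ->; rewrite subrr. Qed.

Lemma ev_rel2 a b c d : ev a * ev b = ev c * ev d -> ev (a * b - c * d) = 0.
Proof. by rewrite evB !evM => ->; rewrite subrr. Qed.

Lemma ev_rel2Z a b c k : ev a * ev b = k *: ev c -> ev (a * b - k *: c) = 0.
Proof. by rewrite evB evM evZ => ->; rewrite subrr. Qed.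

Lemma ev_rel3 a b c d e h : ev a * ev b * ev c = ev d * ev e * ev h ->
  ev (a * b * c - d * e * h) = 0.
Proof. by rewrite evB !evM => ->; rewrite subrr. Qed.

Lemma ev_rel3Z a b c d k : ev a * ev b * ev c = k *: ev d -> ev (a * b * c - k *: d) = 0.
Proof. by rewrite evB !evM evZ => ->; rewrite subrr. Qed.

Lemma ev_skein k a b : ev (1 - k *: (a - b)) = 1 - k *: (ev a - ev b).
Proof. by rewrite evB evZ evB ev1. Qed.

End IdealKernel.

Definition subalg_pred (C : fieldType) (M : nat) (P : 'M[C]_M -> Prop) :=
  [/\ P 1, forall a b, P a -> P b -> P (a + b), forall c a, P a -> P (c *: a)
    & forall a b, P a -> P b -> P (a * b)].

(** * The Kauffman invariant from a Markov trace on a matrix representation *)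

Section KauffmanRep.
Variables (C : fieldType) (r s : C) (f M : nat).
Variables (g gV : 'I_f.-1 -> 'M[C]_M) (P Q : 'M[C]_M -> Prop) (psi : 'M[C]_M -> C).
Local Notation z := (s - s^-1).
Local Notation x := (bwm_x r s).
Local Notation e i := (1 - z^-1 *: (g i - gV i)).
Hypotheses (r0 : r != 0) (z0 : z != 0) (f_gt1 : (1 < f)%N).
Hypotheses (gVK : forall i, g i * gV i = 1) (gKV : forall i, gV i * g i = 1).
Hypothesis g_comm : forall i j : 'I_f.-1, (i.+1 < j)%N -> g i * g j = g j * g i.
Hypothesis g_braid : forall i j : 'I_f.-1, j = i.+1 :> nat ->
  g i * g j * g i = g j * g i * g j.
Hypothesis eg : forall i, e i * g i = r^-1 *: e i.
Hypothesis ege : forall i j : 'I_f.-1, j = i.+1 :> nat -> e j * g i * e j = r *: e j.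
Hypothesis egVe : forall i j : 'I_f.-1, j = i.+1 :> nat -> e j * gV i * e j = r^-1 *: e j.
Hypotheses (psi_lin : scalar psi) (psi1 : psi 1 = 1).
Hypothesis psiC : forall a b, Q a -> Q b -> psi (a * b) = psi (b * a).
Hypotheses (psi_e : forall i, psi (e i) = x^-1) (psi_g : forall i, psi (g i) = r / x).
Hypothesis psi_gV : forall i, psi (gV i) = r^-1 / x.
Hypotheses (subP : subalg_pred P) (subQ : subalg_pred Q).
Hypothesis Pg : forall i : 'I_f.-1, (i.+2 < f)%N -> P (g i) /\ P (gV i).
Hypothesis Qg : forall i : 'I_f.-1, Q (g i) /\ Q (gV i).
Hypothesis psi_markov : forall (i : 'I_f.-1) a b, i.+2 = f -> P a -> P b ->
  psi (a * g i * b) = psi (g i) * psi (a * b) /\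
  psi (a * e i * b) = psi (e i) * psi (a * b).

Definition gen_mx (i : 'I_f.-1 * bool) : 'M[C]_M := if i.2 then gV i.1 else g i.1.

Definition free_eval (a : bwm_free C f) : 'M[C]_M := word_eval gen_mx a.

Lemma free_evalB a b : free_eval (a - b) = free_eval a - free_eval b.
Proof. exact: (raddfB (word_eval gen_mx)). Qed.

Lemma free_evalZ c a : free_eval (c *: a) = c *: free_eval a.
Proof. exact: word_evalZ. Qed.

Lemma free_evalM a b : free_eval (a * b) = free_eval a * free_eval b.
Proof. exact: word_evalM. Qed.

Lemma free_eval1 : free_eval 1 = 1.
Proof. exact: word_eval1. Qed.

Lemma free_eval_g i : free_eval (free_g C i) = g i.
Proof. by rewrite /free_eval word_evalU fmU big_seq1 scale1r. Qed.

Lemma free_eval_gV i : free_eval (free_gV C i) = gV i.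
Proof. by rewrite /free_eval word_evalU fmU big_seq1 scale1r. Qed.

Lemma free_eval_e i : free_eval (free_e s i) = e i.
Proof.
rewrite -free_eval_g -free_eval_gV.
exact: (ev_skein free_evalB free_eval1 free_evalZ _ (free_g C i) (free_gV C i)).
Qed.

Lemma free_eval_relator a : @bwm_relator C r s f a -> free_eval a = 0.
Proof.
have [evB ev1 evM evZ] := And4 free_evalB free_eval1 free_evalM free_evalZ.
pose fg := @free_g C f; pose fV := @free_gV C f; pose fe := @free_e C s f.
case=> [i|i|i j lt_ij|i j eij|i|i j eij|i j eij].
- by apply: (ev_rel1 evB ev1 evM (a := fg i) (b := fV i)); rewrite free_eval_g free_eval_gV.
- by apply: (ev_rel1 evB ev1 evM (a := fV i) (b := fg i)); rewrite free_eval_g free_eval_gV.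
- apply: (ev_rel2 evB evM (a := fg i) (b := fg j) (c := fg j) (d := fg i)).
  by rewrite !free_eval_g g_comm.
- apply: (ev_rel3 evB evM (a := fg i) (b := fg j) (c := fg i) (d := fg j) (e := fg i)
    (h := fg j)).
  by rewrite !free_eval_g g_braid.
- apply: (ev_rel2Z evB evM evZ (a := fe i) (b := fg i) (c := fe i)).
  by rewrite free_eval_e free_eval_g eg.
- apply: (ev_rel3Z evB evM evZ (a := fe j) (b := fg i) (c := fe j) (d := fe j)).
  by rewrite free_eval_e free_eval_g ege.
apply: (ev_rel3Z evB evM evZ (a := fe j) (b := fV i) (c := fe j) (d := fe j)).
by rewrite free_eval_e free_eval_gV egVe.
Qed.

Definition bwm_mx (u : BWM r s f) : 'M[C]_M := free_eval (repr u).

(** Evaluation does not depend on the representative chosen by [repr]: two representatives differ by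
    an element of the ideal, and evaluation kills the relators. *)
Lemma bwm_mx_cls a : bwm_mx (quot_class (@bwm_relator C r s f) a) = free_eval a.
Proof.
apply/eqP; rewrite -subr_eq0 -free_evalB; apply/eqP.
apply: (ideal_kernel free_evalB free_evalM free_eval_relator).
exact/quot_classP/quot_class_repr.
Qed.

Lemma bwm_mx_g i : bwm_mx (bwm_g r s i) = g i.
Proof. exact: etrans (bwm_mx_cls _) (free_eval_g i). Qed.

Lemma bwm_mx_gV i : bwm_mx (bwm_gV r s i) = gV i.
Proof. exact: etrans (bwm_mx_cls _) (free_eval_gV i). Qed.

Lemma bwm_mx_e i : bwm_mx (bwm_e r s i) = e i.
Proof. exact: etrans (bwm_mx_cls _) (free_eval_e i). Qed.

Lemma bwm_mx1 : bwm_mx 1 = 1.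
Proof. exact: etrans (bwm_mx_cls _) free_eval1. Qed.

Lemma bwm_mxZ c u : bwm_mx (c *: u) = c *: bwm_mx u.
Proof.
have := free_evalZ c (repr u); rewrite -!bwm_mx_cls.
by rewrite quot_class_scale quot_class_repr.
Qed.

Lemma bwm_mxD u v : bwm_mx (u + v) = bwm_mx u + bwm_mx v.
Proof.
have := free_evalB (repr u) (repr ((-1) *: v)); rewrite -!bwm_mx_cls.
rewrite quot_class_sub !quot_class_repr bwm_mxZ !scaleN1r !opprK.
exact.
Qed.

Lemma bwm_mxM u v : bwm_mx (u * v) = bwm_mx u * bwm_mx v.
Proof.
have := free_evalM (repr u) (repr v); rewrite -!bwm_mx_cls.
by rewrite quot_class_mul !quot_class_repr.
Qed.

Lemma bwm_mx_lower u : bwm_lower u -> P (bwm_mx u).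
Proof.
have [P1 PD PZ PM] := subP.
elim=> [i lt_i|i lt_i||a b _ Pa _ Pb|c a _ Pa|a b _ Pa _ Pb].
- by rewrite bwm_mx_g; case: (Pg lt_i).
- by rewrite bwm_mx_gV; case: (Pg lt_i).
- by rewrite bwm_mx1.
- by rewrite bwm_mxD; apply: PD.
- by rewrite bwm_mxZ; apply: PZ.
by rewrite bwm_mxM; apply: PM.
Qed.

Lemma bwm_mx_subalg u : Q (bwm_mx u).
Proof.
have [Q1 QD QZ QM] := subQ.
rewrite /bwm_mx; elim/malg_word_ind: (repr u) => [c|[i []]|a b Qa Qb|a b Qa Qb].
- by rewrite /free_eval word_evalZ word_eval1; apply: QZ.
- by rewrite -[mkmalgU _ _]/(free_gV C i) free_eval_gV; case: (Qg i).
- by rewrite -[mkmalgU _ _]/(free_g C i) free_eval_g; case: (Qg i).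
- by rewrite /free_eval raddfD; apply: QD.
by rewrite /free_eval word_evalM; apply: QM.
Qed.

(** Here P contains the image of the algebra on f - 1 strings, where the Markov property is
    available. Q contains the whole image; it enters because a weighted trace is cyclic only on
    operators commuting with the weight. *)
Lemma is_bwm_trace_rep : is_bwm_trace (psi \o bwm_mx).
Proof.
split=> /=.
- by move=> c u v /=; rewrite bwm_mxD bwm_mxZ psi_lin.
- by rewrite bwm_mx1.
- move=> u v; apply: etrans (congr1 psi (bwm_mxM u v)) _.
  exact: etrans (psiC (bwm_mx_subalg u) (bwm_mx_subalg v))
    (congr1 psi (esym (bwm_mxM v u))).
- by move=> i; rewrite bwm_mx_e.
- by move=> i; rewrite bwm_mx_g.
- by move=> i; rewrite bwm_mx_gV.
move=> i chi a b ei H /bwm_mx_lower Pa /bwm_mx_lower Pb.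
have [H1 H2] := psi_markov ei Pa Pb.
have E3 := etrans (bwm_mxM (a * chi) b) (congr1 (fun y => y * _) (bwm_mxM a chi)).
apply: etrans (congr1 psi E3) _.
apply: etrans (congr1 (fun y => _ * psi y) (esym (bwm_mxM a b))).
by case: H => ->; [rewrite bwm_mx_g|rewrite bwm_mx_e].
Qed.

Lemma bwm_mx_braid b : bwm_mx (braid_eval (bwm_g r s (f := f)) (bwm_gV r s (f := f)) b) =
  braid_eval g gV b.
Proof.
rewrite /braid_eval; elim: b => [|[i k] b IHb]; first by rewrite !big_nil bwm_mx1.
have X u k' : bwm_mx (u ^+ k') = bwm_mx u ^+ k'.
  by elim: k' => [|k' IH]; rewrite ?bwm_mx1 // !exprS bwm_mxM IH.
rewrite !big_cons bwm_mxM IHb; congr (_ * _).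
by case: k => k /=; rewrite X ?bwm_mx_g ?bwm_mx_gV.
Qed.

Lemma kauffman_rep b :
  kauffman r s b = x ^+ f.-1 * r ^ (- exponent_sum b) * psi (braid_eval g gV b).
Proof.
rewrite /kauffman; congr (_ * _).
by rewrite (bwm_traceE r0 z0 f_gt1 is_bwm_trace_rep) /= bwm_mx_braid.
Qed.

End KauffmanRep.

(** * Operators on tensor powers *)

Lemma tens_ind (C : comPzRingType) (m n : nat) (P : 'M[C]_(m * n) -> Prop) :
  P 0 -> (forall c X Y, P X -> P Y -> P (c *: X + Y)) ->
  (forall A B, P (A *t B)) -> forall X, P X.
Proof.
move=> P0 PL PT X; rewrite [X]matrix_sum_delta.
elim/big_ind: _ => // [Y Z PY PZ|k _]; first by rewrite -[Y]scale1r; apply: PL.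
elim/big_ind: _ => // [Y Z PY PZ|l _]; first by rewrite -[Y]scale1r; apply: PL.
rewrite -[_ *: _]addr0; apply: PL => //.
case: (mxtens_indexP k) => a b; case: (mxtens_indexP l) => c d.
suff -> : delta_mx (mxtens_index (a, b)) (mxtens_index (c, d)) =
    delta_mx a c *t delta_mx b d :> 'M[C]_(m * n) by [].
apply/matrixP=> k' l'; case: (mxtens_indexP k') => a' b'; case: (mxtens_indexP l') => c' d'.
rewrite tensmxE !mxE !(can_eq (@mxtens_indexK _ _)) !xpair_eqE -natrM mulnb.
by congr (_%:R); case: (a' == a); case: (b' == b); case: (c' == c); case: (d' == d).
Qed.

Section Sites.
Variables (C : fieldType) (f m : nat).
Local Notation M := #|tidx f m|.
Implicit Types (Y Z : 'I_f -> 'M[C]_m) (A B : 'M[C]_m) (s t u : 'I_f).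

Definition prod_op Y : 'M[C]_M :=
  \matrix_(k, l) \prod_(j < f) Y j ((enum_val k : tidx f m) j) ((enum_val l : tidx f m) j).

Lemma prod_opM Y Z : prod_op Y * prod_op Z = prod_op (fun j => Y j * Z j).
Proof.
apply/matrixP=> k l; rewrite !mxE.
under [RHS]eq_bigr => j _ do rewrite mxE.
rewrite (bigA_distr_bigA (fun j a => Y j ((enum_val k : tidx f m) j) a *
  Z j a ((enum_val l : tidx f m) j))) /=.
rewrite (reindex (@enum_val _ (mem {ffun 'I_f -> 'I_m}))) /=; last first.
  by exists enum_rank => x _; rewrite ?enum_rankK ?enum_valK.
by apply: eq_bigr => x _; rewrite !mxE -big_split.
Qed.

Lemma eq_prod_op Y Z : Y =1 Z -> prod_op Y = prod_op Z.
Proof. by move=> eYZ; apply/matrixP=> k l; rewrite !mxE; apply: eq_bigr => j _; rewrite eYZ. Qed.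

Lemma prod_op1 Y : (forall j, Y j = 1) -> prod_op Y = 1.
Proof.
move=> Y1; apply/matrixP=> k l; rewrite !mxE.
have [->|ne_kl] := eqVneq k l; first by rewrite big1 // => j _; rewrite Y1 mxE eqxx.
have [j ne_j] : exists j, (enum_val k : tidx f m) j != (enum_val l : tidx f m) j.
  apply/existsP; rewrite -negb_forall; apply: contraNN ne_kl => /forallP eq_kl.
  by apply/eqP/enum_val_inj/ffunP=> j; apply/eqP.
by rewrite (bigD1 j) //= Y1 mxE (negbTE ne_j) mul0r.
Qed.

Lemma mxtrace_prod_op Y : \tr (prod_op Y) = \prod_j \tr (Y j).
Proof.
rewrite /mxtrace bigA_distr_bigA /=.
rewrite [RHS](reindex (@enum_val _ (mem {ffun 'I_f -> 'I_m}))) /=; last first.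
  by exists enum_rank => x _; rewrite ?enum_rankK ?enum_valK.
by apply: eq_bigr => k _; rewrite mxE.
Qed.

Lemma tens_powerE A : tens_power f A = prod_op (fun=> A).
Proof. by []. Qed.

Definition site s A : 'M[C]_M := prod_op (fun j => if j == s then A else 1).

Lemma siteM s A B : site s A * site s B = site s (A * B).
Proof. by rewrite prod_opM; apply: eq_prod_op => j; case: ifP => _; rewrite ?mulr1. Qed.

Lemma siteC s t A B : s != t -> site s A * site t B = site t B * site s A.
Proof.
move=> ne_st; rewrite !prod_opM; apply: eq_prod_op => j.
case: eqVneq => [->|]; first by rewrite (negbTE ne_st) mulr1 mul1r.
by case: ifP; rewrite ?mulr1 ?mul1r.
Qed.

Lemma site1 s : site s 1 = 1.
Proof. by apply: prod_op1 => j; case: ifP. Qed.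

Lemma siteE s A k l : site s A k l =
  A ((enum_val k : tidx f m) s) ((enum_val l : tidx f m) s) *+
    [forall j, (j != s) ==> ((enum_val k : tidx f m) j == (enum_val l : tidx f m) j)].
Proof.
rewrite mxE (bigD1 s) //= eqxx; case: forallP => [eq_kl|/forallP].
  rewrite big1 ?mulr1 ?mulr1n // => j ne_js; rewrite (negbTE ne_js) mxE.
  by have:= eq_kl j; rewrite ne_js /= => ->.
rewrite negb_forall => /existsP[j]; rewrite negb_imply => /andP[ne_js ne_j].
by rewrite mulr0n (bigD1 j) //= (negbTE ne_js) mxE (negbTE ne_j) mul0r mulr0.
Qed.

Fact site_linear s : linear (site s).
Proof.
by move=> c A B; apply/matrixP=> k l; rewrite !(siteE, mxE) mulrnDl mulrnAr.
Qed.

HB.instance Definition _ s :=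
  GRing.isLinear.Build C 'M[C]_m 'M[C]_M *:%R (site s) (site_linear s).

Lemma local_opE (X : 'M[C]_(m * m)) (i : 'I_f.-1) k l :
  local_op X i k l =
  X (mxtens_index ((enum_val k : tidx f m) (string i), (enum_val k : tidx f m) (string_next i)))
    (mxtens_index ((enum_val l : tidx f m) (string i), (enum_val l : tidx f m) (string_next i)))
  *+ [forall j, (j != string i) && (j != string_next i) ==>
       ((enum_val k : tidx f m) j == (enum_val l : tidx f m) j)].
Proof. by rewrite mxE. Qed.

Lemma local_op_lin (i : 'I_f.-1) (c : C) (X Y : 'M[C]_(m * m)) :
  local_op (c *: X + Y) i = c *: local_op X i + local_op Y i.
Proof.
apply/matrixP=> k l; rewrite local_opE [RHS]mxE [in RHS]mxE !local_opE.
by rewrite mxE [in LHS]mxE mulrnDl mulrnAr.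
Qed.

Lemma local_op0 (i : 'I_f.-1) : local_op (0 : 'M[C]_(m * m)) i = 0.
Proof. by apply/matrixP=> k l; rewrite local_opE !mxE mul0rn. Qed.

Lemma local_opD (i : 'I_f.-1) (X Y : 'M[C]_(m * m)) :
  local_op (X + Y) i = local_op X i + local_op Y i.
Proof. by rewrite -[X]scale1r local_op_lin !scale1r. Qed.

Lemma local_opZ (i : 'I_f.-1) c (X : 'M[C]_(m * m)) :
  local_op (c *: X) i = c *: local_op X i.
Proof. by rewrite -[c *: X]addr0 local_op_lin local_op0 addr0. Qed.

Lemma local_opB (i : 'I_f.-1) (X Y : 'M[C]_(m * m)) :
  local_op (X - Y) i = local_op X i - local_op Y i.
Proof. by rewrite -scaleN1r local_opD local_opZ scaleN1r. Qed.

Lemma string_neq (i : 'I_f.-1) : string i != string_next i.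
Proof. by rewrite -val_eqE /= neq_ltn ltnSn. Qed.

Lemma local_op_tens (i : 'I_f.-1) A B :
  local_op (A *t B) i = site (string i) A * site (string_next i) B.
Proof.
rewrite prod_opM; apply/matrixP=> k l; rewrite local_opE tensmxE mxE.
move: (string i) (string_next i) (string_neq i) => s t ne.
have ne' : t != s by rewrite eq_sym.
rewrite (bigD1 s) //= (bigD1 t) //= !eqxx (negbTE ne) (negbTE ne') mulr1 mul1r mulrA.
case: forallP => [eq_kl|/forallP].
  rewrite big1 ?mulr1 ?mulr1n // => j /andP[ne_js ne_jt].
  rewrite (negbTE ne_js) (negbTE ne_jt) mulr1 mxE.
  by have:= eq_kl j; rewrite ne_js ne_jt /= => ->.
rewrite negb_forall => /existsP[j]; rewrite negb_imply => /andP[/andP[ne_js ne_jt] ne_j].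
rewrite mulr0n (bigD1 j) ?ne_js //= (negbTE ne_js) (negbTE ne_jt) mulr1 mxE (negbTE ne_j).
by rewrite mul0r mulr0.
Qed.

Lemma local_op1 (i : 'I_f.-1) : local_op (1 : 'M[C]_(m * m)) i = 1.
Proof.
suff -> : (1 : 'M[C]_(m * m)) = 1 *t 1 by rewrite local_op_tens !site1 mulr1.
apply/matrixP=> k l; case: (mxtens_indexP k) => a b; case: (mxtens_indexP l) => c d.
rewrite tensmxE !mxE (can_eq (@mxtens_indexK _ _)) xpair_eqE -natrM mulnb.
by case: (a == c); case: (b == d).
Qed.

Lemma local_op_ind (i : 'I_f.-1) (P : 'M[C]_M -> Prop) :
  P 0 -> (forall c (X X' : 'M[C]_M), P X -> P X' -> P (c *: X + X')) ->
  (forall A B, P (site (string i) A * site (string_next i) B)) ->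
  forall X, P (local_op X i).
Proof.
move=> P0 PL PT X; elim/tens_ind: X => [|c X Y PX PY|A B].
- by rewrite local_op0.
- by rewrite local_op_lin; apply: PL.
by rewrite local_op_tens.
Qed.

Lemma local_op_commute (i : 'I_f.-1) (N : 'M[C]_M) :
  (forall A, site (string i) A * N = N * site (string i) A) ->
  (forall A, site (string_next i) A * N = N * site (string_next i) A) ->
  forall X, local_op X i * N = N * local_op X i.
Proof.
move=> Hs Ht X; elim/local_op_ind: (local_op X i) => [|c X' Y eX eY|A B].
- by rewrite mul0r mulr0.
- by rewrite -!mulmxE mulmxDl mulmxDr -scalemxAl -scalemxAr !mulmxE eX eY.
by rewrite -mulrA Ht mulrA Hs mulrA.
Qed.

Lemma local_opM (i : 'I_f.-1) (X Y : 'M[C]_(m * m)) :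
  local_op (X * Y) i = local_op X i * local_op Y i.
Proof.
elim/tens_ind: X => [|c X X' eX eX'|A B].
- by rewrite mul0r local_op0 mul0r.
- rewrite -!mulmxE mulmxDl -scalemxAl local_op_lin local_op_lin.
  by rewrite mulmxDl -scalemxAl !mulmxE eX eX'.
elim/tens_ind: Y => [|c Y Y' eY eY'|A' B'].
- by rewrite mulr0 local_op0 mulr0.
- rewrite -!mulmxE mulmxDr -scalemxAr local_op_lin local_op_lin.
  by rewrite mulmxDr -scalemxAr !mulmxE eY eY'.
rewrite -mulmxE tensmx_mul !local_op_tens -!siteM -!mulrA; congr (_ * _).
by rewrite !mulrA siteC // string_neq.
Qed.

Lemma tens_power_local (i : 'I_f.-1) A X :
  tens_power f A * local_op X i = local_op ((A *t A) * X) i * 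
   prod_op (fun j => if (j == string i) || (j == string_next i) then 1 else A).
Proof.
rewrite local_opM local_op_tens; set R := prod_op _.
have -> : tens_power f A = site (string i) A * site (string_next i) A * R.
  rewrite tens_powerE !prod_opM; apply: eq_prod_op => j.
  move: (string i) (string_next i) (string_neq i) => s t ne.
  have [->|_] := eqVneq j s; first by rewrite (negbTE ne) !mulr1.
  by case: (j == t); rewrite ?mulr1 ?mul1r.
rewrite -!mulrA; do 2!congr (_ * _); apply/esym.
apply: local_op_commute => B; rewrite !prod_opM; apply: eq_prod_op => j.
  by have [_|_] := eqVneq j (string i); rewrite ?mulr1 ?mul1r.
by have [_|_] := eqVneq j (string_next i); rewrite ?orbT ?mulr1 ?mul1r.
Qed.

Lemma tens_power_intertwine (i : 'I_f.-1) A (X X' : 'M[C]_(m * m)) : X * (A *t A) = (A *t A) * X' ->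
  local_op X i * tens_power f A = tens_power f A * local_op X' i.
Proof.
move=> eXY; rewrite tens_power_local -eXY local_opM -mulrA; congr (_ * _).
by rewrite -[tens_power f A]mulr1 -(local_op1 i) tens_power_local mulr1.
Qed.

Lemma tens_power_comm (i : 'I_f.-1) A X : (A *t A) * X = X * (A *t A) ->
  tens_power f A * local_op X i = local_op X i * tens_power f A.
Proof. by move=> eAX; apply/esym/tens_power_intertwine. Qed.

(** The trace over the second tensor factor of X (1 (x) N). *)
Definition ptrace (N : 'M[C]_m) (X : 'M[C]_(m * m)) : 'M[C]_m :=
  \matrix_(a, b) \sum_k \sum_l X (mxtens_index (a, k)) (mxtens_index (b, l)) * N l k.

Lemma ptrace_lin N c (X X' : 'M[C]_(m * m)) :
  ptrace N (c *: X + X') = c *: ptrace N X + ptrace N X'.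
Proof.
apply/matrixP=> a b; rewrite !mxE mulr_sumr -big_split; apply: eq_bigr => k _.
rewrite mulr_sumr -big_split; apply: eq_bigr => l _ /=.
by rewrite !mxE mulrDl mulrA.
Qed.

Lemma ptrace0 (N : 'M[C]_m) : ptrace N 0 = 0.
Proof.
apply/matrixP=> a b; rewrite !mxE big1 // => k _.
by rewrite big1 // => l _; rewrite mxE mul0r.
Qed.

Lemma ptrace_tens (N : 'M[C]_m) A B : ptrace N (A *t B) = \tr (N * B) *: A.
Proof.
apply/matrixP=> a b; rewrite !mxE /mxtrace exchange_big mulr_suml; apply: eq_bigr => k _.
rewrite mxE mulr_suml; apply: eq_bigr => l _; rewrite tensmxE; ring.
Qed.

Lemma tens1 : (1 : 'M[C]_(m * m)) = 1 *t 1.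
Proof.
apply/matrixP=> k l; case: (mxtens_indexP k) => a b; case: (mxtens_indexP l) => c d.
rewrite tensmxE !mxE (can_eq (@mxtens_indexK _ _)) xpair_eqE -natrM mulnb.
by case: (a == c); case: (b == d).
Qed.

(** The functional A |-> tr (N site_t A) vanishes on commutators, so it is a multiple of the trace.
    The multiple is read off at a matrix unit, which avoids a division by m. *)
Lemma site_trace (o : 'I_m) t (N : 'M[C]_M) A : (forall B, site t B * N = N * site t B) ->
  \tr (N * site t A) = \tr A * \tr (N * site t (delta_mx o o)).
Proof.
move=> tN.
have E a b : \tr (N * site t (delta_mx a b)) = (a == b)%:R * \tr (N * site t (delta_mx o o)).
  rewrite -(mul_delta_mx o a b) mulmxE -siteM mulrA -mulmxE mxtrace_mulC mulmxE mulrA.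
  rewrite tN -mulrA siteM [X in site t X]mul_delta_mx_cond eq_sym.
  by case: (a == b); rewrite ?mul1r // mulr0n linear0 mulr0 linear0 mul0r.
rewrite [A in site t A]matrix_sum_delta linear_sum mulr_sumr linear_sum /=.
rewrite [\tr A]/mxtrace mulr_suml; apply: eq_bigr => a _.
rewrite linear_sum mulr_sumr linear_sum /= (bigD1 a) //= big1 => [|b ne_ba]; last first.
  by rewrite linearZ /= -mulmxE -scalemxAr linearZ /= mulmxE E eq_sym (negbTE ne_ba) mul0r mulr0.
by rewrite addr0 linearZ /= -mulmxE -scalemxAr linearZ /= mulmxE E eqxx mul1r.
Qed.

Lemma tens_power_site t (N : 'M[C]_m) :
  tens_power f N = prod_op (fun j => if j == t then 1 else N) * site t N.
Proof.
by rewrite prod_opM; apply: eq_prod_op => j; case: ifP => _; rewrite ?mulr1 ?mul1r.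
Qed.

(** Since a and b act trivially on string i + 1, the trace over that factor can be carried out and
    turns X into its partial trace. The unit [delta_mx o o], of trace one, then occupies the emptied
    site. *)
Lemma trace_local_op (o : 'I_m) (i : 'I_f.-1) (N : 'M[C]_m) X (a b : 'M[C]_M) :
  (forall A, site (string_next i) A * a = a * site (string_next i) A) ->
  (forall A, site (string_next i) A * b = b * site (string_next i) A) ->
  \tr (tens_power f N * (a * local_op X i * b)) =
  \tr (prod_op (fun j => if j == string_next i then 1 else N) * a *
    site (string i) (ptrace N X) * b * site (string_next i) (delta_mx o o)).
Proof.
have ne := string_neq i; have ne' : string_next i != string i by rewrite eq_sym.
rewrite (tens_power_site (string_next i)); set R := prod_op _.
have tR A : site (string_next i) A * R = R * site (string_next i) A.
  rewrite !prod_opM; apply: eq_prod_op => j.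
  by case: (j == string_next i); rewrite ?mulr1 ?mul1r.
move=> ta tb; elim/tens_ind: X => [|c X Y eX eY|A B].
- by rewrite local_op0 ptrace0 linear0 ?(mulr0, mul0r).
- rewrite local_op_lin ptrace_lin linearP /= -!mulmxE.
  rewrite !(mulmxDr, mulmxDl) -!(scalemxAr, scalemxAl) !linearD !linearZ /=.
  by rewrite !mulmxE eX eY.
rewrite local_op_tens ptrace_tens linearZ /= -!mulmxE -!(scalemxAr, scalemxAl) linearZ /= !mulmxE.
rewrite -site_trace.
  congr (\tr _); rewrite -!mulrA; congr (R * _).
  rewrite -tb !mulrA ta -!mulrA; congr (a * _).
  by rewrite !mulrA siteC // -!mulrA; congr (_ * _); rewrite !mulrA siteM tb.
by move=> A'; rewrite !mulrA tR -!mulrA (mulrA (site _ A')) ta -!mulrA;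
  do 2!congr (_ * _); rewrite mulrA siteC // -!mulrA tb.
Qed.

(** Both traces are instances of [trace_local_op], for X and for the identity, whose partial traces
    are the scalars xi and tr N. The factor tr N on the left keeps the statement free of
    division. *)
Lemma markov_local_op (o : 'I_m) (i : 'I_f.-1) (N : 'M[C]_m) X xi (a b : 'M[C]_M) :
  (forall A, site (string_next i) A * a = a * site (string_next i) A) ->
  (forall A, site (string_next i) A * b = b * site (string_next i) A) ->
  ptrace N X = xi%:M ->
  \tr N * \tr (tens_power f N * (a * local_op X i * b)) = xi * \tr (tens_power f N * (a * b)).
Proof.
move=> ta tb eX; have -> : a * b = a * local_op (1 : 'M[C]_(m * m)) i * b.
  by rewrite local_op1 mulr1.
rewrite !(trace_local_op o) // eX tens1 ptrace_tens mulr1 -scalemx1.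
rewrite !linearZ /= -!mulmxE -!(scalemxAr, scalemxAl) !linearZ /= mulrCA.
by [].
Qed.

End Sites.

Lemma mx_delta_ind (C : comPzRingType) (m n : nat) (P : 'M[C]_(m, n) -> Prop) :
  P 0 -> (forall c X Y, P X -> P Y -> P (c *: X + Y)) ->
  (forall a b, P (delta_mx a b)) -> forall X, P X.
Proof.
move=> P0 PL PD X; rewrite [X]matrix_sum_delta.
elim/big_ind: _ => // [Y Z PY PZ|a _]; first by rewrite -[Y]scale1r; apply: PL.
elim/big_ind: _ => // [Y Z PY PZ|b _]; first by rewrite -[Y]scale1r; apply: PL.
by rewrite -[_ *: _]addr0; apply: PL.
Qed.

(** * Relations on three neighbouring strings *)

Section ThreeStrings.
Variables (C : fieldType) (f m : nat) (i j : 'I_f.-1).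
Hypothesis eij : j = i.+1 :> nat.
Local Notation M := #|tidx f m|.
Implicit Types (A B : 'M[C]_m) (X Y : 'M[C]_(m * m)).
Local Notation s := (string i).
Local Notation t := (string_next i).
Local Notation u := (string_next j).

Lemma string_succ : string j = t.
Proof. by apply: val_inj; rewrite /= eij. Qed.

Lemma string_tu : t != u.
Proof. by rewrite -string_succ string_neq. Qed.

Lemma string_su : s != u.
Proof. by rewrite -val_eqE /= eij; apply/eqP; lia. Qed.

Lemma siteC_su A B : site s A * site u B = site u B * site s A :> 'M[C]_M.
Proof. exact/siteC/string_su. Qed.

Lemma siteC_tu A B : site t A * site u B = site u B * site t A :> 'M[C]_M.
Proof. exact/siteC/string_tu. Qed.

Lemma siteC_st A B : site s A * site t B = site t B * site s A :> 'M[C]_M.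
Proof. exact/siteC/string_neq. Qed.

Lemma local_op_site3 X A : local_op X i * site u A = site u A * local_op X i.
Proof. by apply: local_op_commute => B; [apply: siteC_su|apply: siteC_tu]. Qed.

Lemma local_op_site1 X A : local_op X j * site s A = site s A * local_op X j.
Proof.
apply: local_op_commute => B; last by rewrite siteC_su.
by rewrite string_succ siteC_st.
Qed.

Lemma local_op_tens1 A B : local_op (A *t B) i = site s A * site t B :> 'M[C]_M.
Proof. exact: local_op_tens. Qed.

Lemma local_op_tens2 A B : local_op (A *t B) j = site t A * site u B :> 'M[C]_M.
Proof. by rewrite local_op_tens string_succ. Qed.

(** For X = A (x) B the factor A slides out along the first string and B is caught between the two
    copies of e. The relations e g e and e g^-1 e of the BWM algebra are the cases X = g and X =
    g^-1. *)
Lemma local_op_sandwich e N X : (forall B, e * (B *t 1) * e = \tr (N * B) *: e) ->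
  local_op e j * local_op X i * local_op e j = site s (ptrace N X) * local_op e j.
Proof.
move=> eBe; elim/tens_ind: X => [|c X Y eX eY|A B].
- by rewrite local_op0 ptrace0 linear0 mulr0 !mul0r.
- rewrite local_op_lin ptrace_lin linearP /= -!mulmxE.
  by rewrite !(mulmxDr, mulmxDl) -!(scalemxAr, scalemxAl) !mulmxE eX eY.
rewrite local_op_tens1 ptrace_tens mulrA local_op_site1 -!mulrA.
have -> : site t B = local_op (B *t 1) j :> 'M[C]_M by rewrite local_op_tens2 site1 mulr1.
rewrite [X in _ * X]mulrA -!local_opM eBe local_opZ.
by rewrite linearZ /= -!mulmxE -scalemxAl -scalemxAr.
Qed.

Variables (o : 'I_m) (g : 'M[C]_(m * m)) (T : 'M[C]_m).
Hypothesis gT : (T *t T) * g = g * (T *t T).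
Hypothesis g_top : g * (delta_mx o o *t 1) = \sum_b (T * delta_mx b o) *t delta_mx o b.

(** The cyclic shift u_o (x) u_b (x) u_c |-> u_b (x) u_c (x) u_o, extended by zero to the other
    basis vectors in the first factor. *)
Let Q : 'M[C]_M := \sum_b \sum_c site s (delta_mx b o) * site t (delta_mx c b) *
  site u (delta_mx o c).

Lemma delta_mxM (a b c d : 'I_m) :
  (delta_mx a b : 'M[C]_m) * delta_mx c d = delta_mx a d *+ (b == c).
Proof. exact: mul_delta_mx_cond. Qed.

Lemma cycle_op_st A : site s A * Q = Q * site t A.
Proof.
elim/mx_delta_ind: A => [|c A B eA eB|d e]; first by rewrite !linear0 mul0r mulr0.
  rewrite !linearP /= -!mulmxE.
  by rewrite mulmxDr mulmxDl -scalemxAr -scalemxAl !mulmxE eA eB.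
rewrite mulr_sumr (bigD1 e) //= [X in _ + X]big1 => [|b ne_be]; last first.
  rewrite mulr_sumr big1 // => c _; rewrite !mulrA siteM delta_mxM eq_sym (negbTE ne_be).
  by rewrite linear0 !mul0r.
rewrite mulr_suml [RHS](bigD1 d) //= [X in _ = _ + X]big1 => [|b ne_bd]; last first.
  rewrite mulr_suml big1 // => c _; rewrite -mulrA -siteC_tu mulrA -(mulrA (site s _)) siteM.
  by rewrite delta_mxM (negbTE ne_bd) linear0 mulr0 mul0r.
rewrite !addr0 mulr_sumr mulr_suml; apply: eq_bigr => c _.
rewrite !mulrA siteM delta_mxM eqxx -[RHS]mulrA -siteC_tu [RHS]mulrA.
rewrite -[in RHS](mulrA (site s _)) siteM.
by rewrite delta_mxM eqxx.
Qed.

Lemma cycle_op_tu A : site t A * Q = Q * site u A.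
Proof.
elim/mx_delta_ind: A => [|c A B eA eB|d e]; first by rewrite !linear0 mul0r mulr0.
  rewrite !linearP /= -!mulmxE.
  by rewrite mulmxDr mulmxDl -scalemxAr -scalemxAl !mulmxE eA eB.
rewrite mulr_sumr mulr_suml; apply: eq_bigr => b _.
rewrite mulr_sumr (bigD1 e) //= [X in _ + X]big1 => [|c ne_ce]; last first.
  rewrite !mulrA -siteC_st -(mulrA (site s _)) siteM delta_mxM eq_sym (negbTE ne_ce).
  by rewrite linear0 mulr0 mul0r.
rewrite mulr_suml [RHS](bigD1 d) //= [X in _ = _ + X]big1 => [|c ne_cd]; last first.
  by rewrite -mulrA siteM delta_mxM (negbTE ne_cd) linear0 mulr0.
rewrite !addr0 !mulrA -siteC_st -(mulrA (site s _)) siteM delta_mxM eqxx.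
by rewrite -[RHS]mulrA siteM delta_mxM eqxx.
Qed.

Lemma cycle_op_local X : local_op X i * Q = Q * local_op X j.
Proof.
elim/tens_ind: X => [|c X Y eX eY|A B]; first by rewrite !local_op0 mul0r mulr0.
  rewrite !local_op_lin -!mulmxE.
  by rewrite mulmxDr mulmxDl -scalemxAr -scalemxAl !mulmxE eX eY.
by rewrite local_op_tens1 local_op_tens2 -mulrA cycle_op_tu !mulrA cycle_op_st.
Qed.

Lemma local_op_top2 : local_op g j * (local_op g i * site s (delta_mx o o)) =
  local_op (T *t T) i * Q.
Proof.
have g1 : local_op g i * site s (delta_mx o o) =
    \sum_b site s (T * delta_mx b o) * site t (delta_mx o b) :> 'M[C]_M.
  have -> : site s (delta_mx o o) = local_op (delta_mx o o *t 1) i :> 'M[C]_M.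
    by rewrite local_op_tens1 site1 mulr1.
  rewrite -local_opM g_top (big_morph _ (local_opD i) (local_op0 _ _ i)).
  by apply: eq_bigr => b _; rewrite local_op_tens1.
have g2 : local_op g j * site t (delta_mx o o) =
    \sum_c site t (T * delta_mx c o) * site u (delta_mx o c) :> 'M[C]_M.
  have -> : site t (delta_mx o o) = local_op (delta_mx o o *t 1) j :> 'M[C]_M.
    by rewrite local_op_tens2 site1 mulr1.
  rewrite -local_opM g_top (big_morph _ (local_opD j) (local_op0 _ _ j)).
  by apply: eq_bigr => b _; rewrite local_op_tens2.
rewrite g1 !mulr_sumr; apply: eq_bigr => b _.
have -> : site t (delta_mx o b) = site t (delta_mx o o) * site t (delta_mx o b) :> 'M[C]_M.
  by rewrite siteM delta_mxM eqxx.
rewrite mulrA local_op_site1 -[LHS]mulrA; rewrite [in LHS](mulrA (local_op g j)) g2.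
rewrite mulr_suml !mulr_sumr; apply: eq_bigr => c _.
rewrite -(mulrA (site t _)) -siteC_tu (mulrA (site t _)) siteM -(mulrA T) delta_mxM eqxx.
rewrite -!siteM local_op_tens1 -!mulrA; congr (_ * _).
by rewrite (mulrA (site s _)) siteC_st -!mulrA.
Qed.

(* Both sides commute with the action of the f_k on V (x) V (x) V, given by F and L, so it is
   enough to compare them on u_o (x) V (x) V, where [g_top] makes them cyclic permutations. *)
Lemma local_op_braid (I : Type) (F L : I -> 'M[C]_m) :
  (forall k, g * (F k *t 1 + L k *t F k) = (F k *t 1 + L k *t F k) * g) ->
  (forall k, g * (L k *t L k) = (L k *t L k) * g) ->
  (forall k b, exists c, L k * delta_mx b o = c *: delta_mx b o) ->
  (forall a, a != o -> exists k (b : 'I_m), (b < a)%N /\ delta_mx a o = F k * delta_mx b o) ->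
  local_op g i * local_op g j * local_op g i = local_op g j * local_op g i * local_op g j.
Proof.
move=> gF gL Ldiag Fgen; apply/eqP; rewrite -subr_eq0; apply/eqP; set Y := _ - _.
(* On u_o (x) V (x) V the two words become g_i (T (x) T)_i Q and (T (x) T)_i Q g_j = (T (x) T)_i g_i
   Q, and g commutes with T (x) T. *)
have top : Y * site s (delta_mx o o) = 0.
  have e1 : local_op g i * local_op g j * local_op g i * site s (delta_mx o o) =
      local_op g i * (local_op g j * (local_op g i * site s (delta_mx o o))).
    by rewrite !mulrA.
  have e2 : local_op g j * local_op g i * local_op g j * site s (delta_mx o o) =
      local_op g j * (local_op g i * site s (delta_mx o o)) * local_op g j.
    by rewrite -(mulrA _ (local_op g j)) local_op_site1 !mulrA.
  rewrite mulrBl e1 e2 local_op_top2 mulrA -local_opM -gT local_opM.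
  by rewrite -!mulrA cycle_op_local subrr.
(* The iterated co-multiplication of f_k on three strings. [F3_1] and [F3_2] are its two
   bracketings, suited to g_i and to g_j respectively. *)
pose F3 k := site s (F k) + site s (L k) * (site t (F k) + site t (L k) * site u (F k)).
have F3_1 k : F3 k = local_op (F k *t 1 + L k *t F k) i + local_op (L k *t L k) i * site u (F k).
  by rewrite /F3 local_opD !local_op_tens1 site1 mulr1 mulrDr addrA mulrA.
have F3_2 k : F3 k = site s (F k) + site s (L k) * local_op (F k *t 1 + L k *t F k) j.
  by rewrite /F3 local_opD !local_op_tens2 site1 mulr1.
have gF3_1 k : local_op g i * F3 k = F3 k * local_op g i.
  rewrite F3_1 mulrDr mulrDl -local_opM gF local_opM; congr (_ + _).
  by rewrite mulrA -local_opM gL local_opM -mulrA local_op_site3 mulrA.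
have gF3_2 k : local_op g j * F3 k = F3 k * local_op g j.
  rewrite F3_2 mulrDr mulrDl local_op_site1; congr (_ + _).
  by rewrite mulrA local_op_site1 -!mulrA -!local_opM gF.
have YF3 k : Y * F3 k = F3 k * Y.
  rewrite /Y mulrBl mulrBr; congr (_ - _).
    by rewrite -(mulrA _ _ (F3 k)) gF3_1 (mulrA _ (F3 k)) -(mulrA _ _ (F3 k)) gF3_2 !mulrA gF3_1.
  by rewrite -(mulrA _ _ (F3 k)) gF3_2 (mulrA _ (F3 k)) -(mulrA _ _ (F3 k)) gF3_1 !mulrA gF3_2.
have Y0 a : Y * site s (delta_mx a o) = 0.
  have [d] := ubnP (val a); elim: d a => // d IHd a; rewrite ltnS => le_ad.
  have [->//|ne_ao] := eqVneq a o.
  have [k [b [lt_ba ->]]] := Fgen a ne_ao.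
  have Yb : Y * site s (delta_mx b o) = 0 by apply: IHd; apply: leq_trans le_ad.
  pose W := site t (F k) + site t (L k) * site u (F k) : 'M[C]_M.
  have sW A : W * site s A = site s A * W.
    by rewrite mulrDl mulrDr -siteC_st -mulrA -siteC_su !mulrA -siteC_st.
  (* Moving from u_b to F_k u_b in the first factor costs only a term with L_k u_b there, which is a
     multiple of u_b and is covered by the induction. *)
  have -> : site s (F k * delta_mx b o) = F3 k * site s (delta_mx b o) -
      site s (L k * delta_mx b o) * W.
    by rewrite -!siteM /F3 -/W mulrDl -(mulrA _ W) sW mulrA addrK.
  have [c ->] := Ldiag k b.
  rewrite mulrBr mulrA YF3 -mulrA Yb mulr0 linearZ /= mulrA -!mulmxE -scalemxAr !mulmxE Yb.
  by rewrite scaler0 mul0r subrr.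
rewrite -[Y]mulr1 -(site1 _ _ s).
have -> : (1 : 'M[C]_m) = \sum_a delta_mx a o * delta_mx o a.
  under eq_bigr => a _ do rewrite delta_mxM eqxx mulr1n.
  apply/matrixP=> a b; rewrite !mxE summxE (bigD1 a) //= big1 => [|k ne_ka].
    by rewrite addr0 mxE eqxx eq_sym.
  by rewrite mxE eq_sym (negbTE ne_ka).
rewrite linear_sum mulr_sumr big1 // => a _.
by rewrite /= -siteM mulrA Y0 mul0r.
Qed.

End ThreeStrings.

(** * Weights of the vector representation *)

Section VectorWeights.
Variable n : nat.
Implicit Types (a b : nat) (i : 'I_n).

(* The weights eps_1, ..., eps_n, 0, - eps_n, ..., - eps_1 of the vector module are
   numbered by a = 0, ..., 2n; [wcoord k a] is the k-th coordinate of the a-th weight. *)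
Definition wcoord (k a : nat) : int := (a == k)%:Z - (a == 2 * n - k)%N%:Z.

(** The pairing of alpha_i with the a-th weight, i.e. the exponent of p in the action of k_i. As
    [wcoord n] vanishes identically, the last root alpha_n = eps_n is included. *)
Definition kexp (i a : nat) : int := wcoord i a - wcoord i.+1 a.

(* The simple root by which the weights a and a + 1 differ. *)
Definition step a : nat := if (a < n)%N then a else ((2 * n).-1 - a)%N.

Definition height a : int :=
  if (a < n)%N then (2 * (n - a)).-1%:Z else if a == n then 0 else - (2 * (a - n)).-1%:Z.

Lemma wcoord_diff k a : (k <= n)%N -> (a < 2 * n)%N ->
  wcoord k a - wcoord k a.+1 =
  (k == step a)%:Z - ((k == (step a).+1) && (k < n)%N)%:Z.
Proof.
rewrite /step /wcoord => le_k lt_a; case: ltnP => lt_an.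
  have -> : (a == 2 * n - k)%N = false by lia.
  have -> : (a.+1 == 2 * n - k)%N = (k == n) && (a.+1 == n) by lia.
  by case: (eqVneq k n) => [->|]; case: eqVneq; case: eqVneq; lia.
have -> : (a == k) = (k == n) && (a == n) by lia.
have -> : (a.+1 == k) = false by lia.
by case: (eqVneq k n) => [->|]; lia.
Qed.

(** The weights a and a + 1 differ by a simple root, so this is the symmetry (alpha_j, alpha_i) =
    (alpha_i, alpha_j). *)
Lemma kexp_diff (i j : 'I_n) a b : (a < 2 * n)%N -> (b < 2 * n)%N ->
  step a = i -> step b = j ->
  kexp j a - kexp j a.+1 = kexp i b - kexp i b.+1.
Proof.
move=> lt_a lt_b ea eb; have [lt_i lt_j] := (ltn_ord i, ltn_ord j).
have E (k c : nat) : kexp k c - kexp k c.+1 =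
    (wcoord k c - wcoord k c.+1) - (wcoord k.+1 c - wcoord k.+1 c.+1).
  by rewrite /kexp; lia.
rewrite (E j a) (E i b) (wcoord_diff (ltnW lt_j) lt_a) (wcoord_diff lt_j lt_a).
rewrite (wcoord_diff (ltnW lt_i) lt_b) (wcoord_diff lt_i lt_b) ea eb lt_i lt_j !eqSS.
case: (ltngtP i j) => [lt_ij|lt_ji|->]; lia.
Qed.

Hypothesis n_gt0 : (0 < n)%N.

Lemma step_lt a : (a < 2 * n)%N -> (step a < n)%N.
Proof. by rewrite /step; case: ifP; lia. Qed.

Lemma step_rev a : (a < 2 * n)%N -> step ((2 * n).-1 - a) = step a.
Proof. by rewrite /step; case: ifP; case: ifP; lia. Qed.

Lemma height_inj a b : (a <= 2 * n)%N -> (b <= 2 * n)%N -> height a = height b -> a = b.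
Proof. rewrite /height; do 2 (case: ltnP => ?); do ?case: eqVneq => ?; lia. Qed.

Lemma height_opp a b : (a <= 2 * n)%N -> (b <= 2 * n)%N ->
  height a + height b = 0 -> b = (2 * n - a)%N.
Proof. rewrite /height; do 2 (case: ltnP => ?); do ?case: eqVneq => ?; lia. Qed.

Lemma height_rev a : (a <= 2 * n)%N -> height a + height (2 * n - a) = 0.
Proof. rewrite /height; do 2 (case: ltnP => ?); do ?case: eqVneq => ?; lia. Qed.

(** The simple roots add up to eps_1, so this is the pairing of eps_1 with the a-th weight. It is
    the exponent in [tau], and it shows that whatever preserves all k_i-weights preserves that
    exponent. *)
Lemma sum_kexp a : (a <= 2 * n)%N -> \sum_(i < n) kexp i a = (a == 0)%:Z - (a == 2 * n)%N%:Z.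
Proof.
move=> le_a; rewrite -[LHS]opprK -sumrN.
under eq_bigr => i _ do rewrite /kexp opprB.
rewrite -(big_mkord xpredT (fun k => wcoord k.+1 a - wcoord k a)) telescope_sumr //.
rewrite /wcoord; lia.
Qed.

Lemma sum_two_rho_kexp a : (a <= 2 * n)%N ->
  \sum_(i < n) (two_rho_coef i)%:Z * kexp i a = height a.
Proof.
move=> le_a; have -> : height a = \sum_(l < n) (two_rho l)%:Z * wcoord l a.
  rewrite /height; case: ltnP => [lt_an|ge_an].
    rewrite (bigD1 (Ordinal lt_an)) //= big1 => [|l ne_l].
      by rewrite /two_rho /wcoord /=; lia.
    have ne_la : (l != a :> nat) by apply: contra ne_l => /eqP e; apply/eqP/val_inj.
    have := ltn_ord l; rewrite /wcoord; nia.
  case: eqVneq => [->|ne_an].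
    by rewrite big1 // => l _; have := ltn_ord l; rewrite /wcoord; lia.
  have lt_l : (2 * n - a < n)%N by lia.
  rewrite (bigD1 (Ordinal lt_l)) //= big1 => [|l ne_l].
    by rewrite /two_rho /wcoord /=; lia.
  have ne_la : (l != 2 * n - a :> nat)%N by apply: contra ne_l => /eqP e; apply/eqP/val_inj.
  have := ltn_ord l; rewrite /wcoord; nia.
under eq_bigr => i _ do rewrite /two_rho_coef (big_morph Posz PoszD (erefl _)) mulr_suml.
rewrite (exchange_big_dep xpredT) //=; apply: eq_bigr => l _.
rewrite -mulr_sumr; congr (_ * _).
rewrite -(big_geq_mkord l n xpredT (fun k => wcoord k a - wcoord k.+1 a)).
rewrite -[LHS]opprK -sumrN.
under eq_bigr => i _ do rewrite opprB.
rewrite telescope_sumr; last exact/ltnW/ltn_ord.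
rewrite /wcoord; lia.
Qed.

Lemma kexp_step a : (a < 2 * n)%N -> kexp (step a) a = (a != n)%:Z.
Proof. by rewrite /kexp /wcoord /step => lt_a; case: ifP => lt_an; lia. Qed.

Lemma kexp_stepS a : (a < 2 * n)%N -> kexp (step a) a.+1 = - (a.+1 != n)%:Z.
Proof. by rewrite /kexp /wcoord /step => lt_a; case: ifP => lt_an; lia. Qed.

Lemma kexp0 (i : nat) : (i < n)%N -> kexp i 0 = (i == 0)%:Z.
Proof. by rewrite /kexp /wcoord => lt_i; lia. Qed.

(** This is (2 rho, alpha_i) = (alpha_i, alpha_i), the property of 2 rho on which the quantum trace
    rests. *)
Lemma height_step a : (a < 2 * n)%N ->
  height a - height a.+1 = kexp (step a) a - kexp (step a) a.+1.
Proof.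
move=> lt_a; rewrite kexp_step // kexp_stepS // /height.
do 2 (case: ltnP => ?); do ?case: eqVneq => ?; lia.
Qed.

Lemma height_min a : (a <= 2 * n)%N -> - height 0 <= height a.
Proof. rewrite /height n_gt0; do 1 (case: ltnP => ?); do ?case: eqVneq => ?; lia. Qed.

Lemma height_gt a b : (a < b <= 2 * n)%N -> height b < height a.
Proof. move=> /andP[? ?]; rewrite /height; do 2 (case: ltnP => ?); do ?case: eqVneq => ?; lia. Qed.

Lemma step0 a : (a < 2 * n)%N -> (step a == 0)%N = (a == 0)%N || (a == (2 * n).-1)%N.
Proof. by rewrite /step => lt_a; case: ifP; lia. Qed.

End VectorWeights.

Section TensorSquare.
Variables (C : fieldType) (m : nat).
Implicit Types (X : 'M[C]_(m * m)) (A B Y : 'M[C]_m) (y : 'cV[C]_(m * m)).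

(* The tensor a (x) b is represented by the matrix unit delta_mx a b. *)
Definition mat_of y : 'M[C]_m := \matrix_(a, b) y (mxtens_index (a, b)) 0.

Definition vec_of Y : 'cV[C]_(m * m) :=
  \col_k Y (mxtens_unindex k).1 (mxtens_unindex k).2.

Definition op X Y : 'M[C]_m := mat_of (X *m vec_of Y).

Lemma mat_ofK : cancel mat_of vec_of.
Proof.
move=> y; apply/matrixP=> k l; rewrite [l]ord1 !mxE.
by case: (mxtens_indexP k) => a b; rewrite mxtens_indexK.
Qed.

Lemma vec_ofK : cancel vec_of mat_of.
Proof. by move=> Y; apply/matrixP=> a b; rewrite !mxE mxtens_indexK. Qed.

Lemma mat_of_mul X y : mat_of (X *m y) = op X (mat_of y).
Proof. by rewrite /op mat_ofK. Qed.

Fact mat_of_linear : linear mat_of.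
Proof. by move=> c y z; apply/matrixP=> a b; rewrite !mxE. Qed.

HB.instance Definition _ :=
  GRing.isLinear.Build C 'cV[C]_(m * m) 'M[C]_m *:%R mat_of mat_of_linear.

Fact op_linear X : linear (op X).
Proof.
move=> c Y Z; rewrite /op.
have -> : vec_of (c *: Y + Z) = c *: vec_of Y + vec_of Z by apply/matrixP=> k l; rewrite !mxE.
by rewrite mulmxDr -scalemxAr linearP.
Qed.

HB.instance Definition _ X :=
  GRing.isLinear.Build C 'M[C]_m 'M[C]_m *:%R (op X) (op_linear X).

Lemma opM X X' Y : op (X *m X') Y = op X (op X' Y).
Proof. by rewrite /op mat_ofK mulmxA. Qed.

Lemma opDl X X' Y : op (X + X') Y = op X Y + op X' Y.
Proof. by rewrite /op mulmxDl linearD. Qed.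

Lemma opZl c X Y : op (c *: X) Y = c *: op X Y.
Proof. by rewrite /op -scalemxAl linearZ. Qed.

Lemma opBl X X' Y : op (X - X') Y = op X Y - op X' Y.
Proof. by rewrite -scaleN1r opDl opZl scaleN1r. Qed.

Lemma op1 Y : op 1 Y = Y.
Proof. by rewrite /op mul1mx vec_ofK. Qed.

Lemma mulmx_vec_of X Y k l : (X *m vec_of Y) k l =
  \sum_a \sum_b X k (mxtens_index (a, b)) * Y a b.
Proof.
rewrite mxE pair_bigA /= (reindex (@mxtens_index m m)) /=; last first.
  by exists (@mxtens_unindex m m) => k' _; rewrite (mxtens_indexK, mxtens_unindexK).
by apply: eq_bigr => [[a b]] _; rewrite mxE mxtens_indexK.
Qed.

Lemma op_tens A B Y : op (A *t B) Y = A *m Y *m B^T.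
Proof.
apply/matrixP=> a b; rewrite mxE mulmx_vec_of mxE exchange_big; apply: eq_bigr => d _.
rewrite mxE mulr_suml; apply: eq_bigr => c _; rewrite tensmxE mxE; ring.
Qed.

Lemma op_delta X (a b c d : 'I_m) :
  op X (delta_mx c d) a b = X (mxtens_index (a, b)) (mxtens_index (c, d)).
Proof.
rewrite mxE mulmx_vec_of (bigD1 c) //= (bigD1 d) //= mxE !eqxx mulr1 !big1 ?addr0 //.
  by move=> c' ne; rewrite big1 // => d' _; rewrite mxE (negbTE ne) mulr0.
by move=> d' ne; rewrite mxE (negbTE ne) andbF mulr0.
Qed.

Lemma op_inj X X' : (forall a b, op X (delta_mx a b) = op X' (delta_mx a b)) -> X = X'.
Proof.
move=> e; apply/matrixP=> k l; case: (mxtens_indexP k) => a b; case: (mxtens_indexP l) => c d.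
by rewrite -!op_delta e.
Qed.

End TensorSquare.

(** * From one operator on V (x) V to the Kauffman invariant *)

Section LocalKauffman.
Variables (C : fieldType) (r s : C) (f m : nat) (o : 'I_m).
Variables (g gV : 'M[C]_(m * m)) (N : 'M[C]_m).
Local Notation z := (s - s^-1).
Local Notation x := (bwm_x r s).
Let e : 'M[C]_(m * m) := 1 - z^-1 *: (g - gV).
Hypotheses (r0 : r != 0) (z0 : z != 0) (x0 : x != 0) (f_gt1 : (1 < f)%N).
Hypotheses (g_gV : g * gV = 1) (gV_g : gV * g = 1).
Hypothesis g_braid : forall i j : 'I_f.-1, j = i.+1 :> nat ->
  local_op g i * local_op g j * local_op g i = local_op g j * local_op g i * local_op g j.
Hypotheses (eg : e * g = r^-1 *: e) (trN : \tr N = x).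
Hypothesis eBe : forall B, e * (B *t 1) * e = \tr (N * B) *: e.
Hypotheses (ptr_g : ptrace N g = r%:M) (ptr_gV : ptrace N gV = r^-1%:M).
Hypothesis gN : (N *t N) * g = g * (N *t N).

Let ptr_e : ptrace N e = 1%:M.
Proof.
have -> : e = (- z^-1) *: g + (z^-1 *: gV + 1 *t 1).
  by rewrite /e scalerBr tens1 scaleNr addrA [RHS]addrC opprB [X in _ + X]addrC.
rewrite ptrace_lin (ptrace_lin N z^-1 gV) ptr_g ptr_gV ptrace_tens mulr1 trN.
apply/matrixP=> a b; rewrite !mxE; case: (a == b); rewrite ?mulr0n ?mulr0 ?addr0 //.
rewrite !mulr1n /bwm_x !mulr1; move: r (r^-1) z z0 => r1 r2 z1 z10; field.
exact: z10.
Qed.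

Let local_e (i : 'I_f.-1) :
  local_op e i = 1 - z^-1 *: (local_op g i - local_op gV i).
Proof. by rewrite /e local_opB local_opZ local_opB local_op1. Qed.

Let gVN : (N *t N) * gV = gV * (N *t N).
Proof.
rewrite -[(N *t N) * gV]mul1r -gV_g -[gV * g * _]mulrA [g * _]mulrA -gN.
by rewrite -[N *t N * g * gV]mulrA g_gV mulr1.
Qed.

Let trNf : \tr (tens_power f N) = x ^+ f.
Proof. by rewrite tens_powerE mxtrace_prod_op prodr_const card_ord trN. Qed.

Let psi (X : 'M[C]_#|tidx f m|) : C := \tr (tens_power f N * X) / x ^+ f.

Let psi1 : psi 1 = 1.
Proof. by rewrite /psi mulr1 trNf divff // expf_neq0. Qed.

Let psi_local X xi i : ptrace N X = xi%:M -> psi (local_op X i) = xi / x.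
Proof.
move=> eX; have := @markov_local_op C f m o i N X xi 1 1.
rewrite !mulr1 mul1r trN trNf => /(_ _ _ eX) E.
rewrite /psi; apply: (mulfI x0); rewrite mulrA E ?mulfK ?expf_neq0 //.
- by rewrite mulrCA divff // mulr1.
- by move=> A; rewrite mulr1 mul1r.
by move=> A; rewrite mulr1 mul1r.
Qed.

Lemma local_kauffman (b : braid_word f) :
  kauffman r s b = x ^+ f.-1 * r ^ (- exponent_sum b) *
    (\tr (tens_power f N * braid_eval (local_op g) (local_op gV) b) / x ^+ f).
Proof.
(* P: operators acting trivially on the last string, which the premise [i.+2 = f] singles out. Q:
   operators commuting with the weight of the quantum trace. *)
pose P (a : 'M[C]_#|tidx f m|) := forall (i : 'I_f.-1) A, i.+2 = f ->
  site (string_next i) A * a = a * site (string_next i) A.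
pose Q (a : 'M[C]_#|tidx f m|) := tens_power f N * a = a * tens_power f N.
apply: (@kauffman_rep C r s f _ (local_op g) (local_op gV) P Q psi).
- exact: r0.
- exact: z0.
- exact: f_gt1.
- by move=> i; rewrite -local_opM g_gV local_op1.
- by move=> i; rewrite -local_opM gV_g local_op1.
- move=> i j lt_ij; apply: local_op_commute => A; apply/esym.
    by apply: local_op_commute => B; apply: siteC; rewrite -val_eqE /=; apply/eqP; lia.
  by apply: local_op_commute => B; apply: siteC; rewrite -val_eqE /=; apply/eqP; lia.
- exact: g_braid.
- by move=> i; rewrite -local_e -local_opM eg local_opZ.
- move=> i j eij; rewrite -local_e (local_op_sandwich eij _ eBe) ptr_g.
  by rewrite -scalemx1 linearZ /= site1 -mulmxE -scalemxAl mul1mx.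
- move=> i j eij; rewrite -local_e (local_op_sandwich eij _ eBe) ptr_gV.
  by rewrite -scalemx1 linearZ /= site1 -mulmxE -scalemxAl mul1mx.
- move=> c a a'; rewrite /psi -!mulmxE mulmxDr -scalemxAr linearD linearZ /=.
  by rewrite mulrDl mulrA.
- exact: psi1.
- move=> a a' Qa Qa'; rewrite /psi; congr (_ / _).
  by rewrite mulrA Qa -mulrA -!mulmxE mxtrace_mulC !mulmxE -mulrA.
- by move=> i; rewrite -local_e (psi_local _ ptr_e) div1r.
- by move=> i; apply: psi_local.
- by move=> i; apply: psi_local.
- split=> [i A _|a a' Pa Pa' i A ei|c a Pa i A ei|a a' Pa Pa' i A ei].
  + by rewrite mulr1 mul1r.
  + by rewrite mulrDl mulrDr (Pa i) // (Pa' i).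
  + by rewrite -!mulmxE -scalemxAl -scalemxAr !mulmxE (Pa i).
  + by rewrite mulrA (Pa i) // -mulrA (Pa' i) // mulrA.
- split=> [|a a' Qa Qa'|c a Qa|a a' Qa Qa']; rewrite /Q.
  + by rewrite mulr1 mul1r.
  + by rewrite mulrDl mulrDr Qa Qa'.
  + by rewrite -!mulmxE -scalemxAl -scalemxAr !mulmxE Qa.
  + by rewrite mulrA Qa -mulrA Qa' mulrA.
- move=> i lt_i; split=> k A ek; apply/esym/local_op_commute => B.
  + by apply: siteC; rewrite -val_eqE /=; apply/eqP; lia.
  + by apply: siteC; rewrite -val_eqE /=; apply/eqP; lia.
  + by apply: siteC; rewrite -val_eqE /=; apply/eqP; lia.
  + by apply: siteC; rewrite -val_eqE /=; apply/eqP; lia.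
- by move=> i; split; apply: tens_power_comm.
move=> i a a' ei Pa Pa'.
have M X xi : ptrace N X = xi%:M ->
    psi (a * local_op X i * a') = psi (local_op X i) * psi (a * a').
  move=> eX; rewrite (psi_local _ eX) /psi.
  have := @markov_local_op C f m o i N X xi a a'.
  rewrite trN => /(_ _ _ eX) E; apply: (mulfI x0).
  rewrite [LHS]mulrA E; first by rewrite [RHS]mulrA [x * (xi / x)]mulrCA divff // mulr1 -[LHS]mulrA.
    by move=> A; rewrite Pa.
  by move=> A; rewrite Pa'.
by rewrite -local_e (M _ _ ptr_g) (M _ _ ptr_e).
Qed.

End LocalKauffman.

(** * The vector representation in a weight basis *)

Section NotRoot.
Variables (C : fieldType) (A : qtype) (q : C).
Hypotheses (q0 : q != 0) (q_not_root : forall k, (0 < k)%N -> q ^+ k != 1).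
Local Notation p := (qparam A q).

Lemma qparam_neq0 : p != 0.
Proof. by rewrite /qparam; case: ifP => _; rewrite ?oppr_eq0. Qed.

Lemma qparam_not_root k : (0 < k)%N -> p ^+ k != 1.
Proof.
have p2 : p ^+ 2 = q ^+ 2 by rewrite /qparam; case: ifP; rewrite ?sqrrN.
move=> k_gt0; have k2 : (0 < 2 * k)%N by lia.
have := q_not_root k2; rewrite exprM -p2 exprAC.
by apply: contra_neq => ->; rewrite expr1n.
Qed.

Lemma qparam_expz_inj (a b : int) : p ^ a = p ^ b -> a = b.
Proof.
have p0 := qparam_neq0; move=> e; apply/eqP; rewrite -subr_eq0; apply/eqP.
have {e} : p ^ (a - b) = 1 by rewrite expfzDr // e -expfzDr // subrr expr0z.
case: (a - b) => [[|k]|k] // e; have := @qparam_not_root k.+1 (ltn0Sn k).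
  by rewrite -[p ^+ k.+1]/(p ^ k.+1%:Z) e eqxx.
by rewrite -invr_eq1 -[_^-1]/(p ^ Negz k) e eqxx.
Qed.

Lemma qparam_sub_inv : p - p^-1 != 0.
Proof.
apply: contra_neq (@qparam_not_root 2 isT) => /eqP; rewrite subr_eq0 => /eqP e.
by rewrite expr2 {1}e mulVf ?qparam_neq0.
Qed.

Lemma qparam_add_inv : p + p^-1 != 0.
Proof.
apply: contra_neq (@qparam_not_root 4 isT) => /eqP; rewrite addr_eq0 => /eqP e.
have p2 : p ^+ 2 = -1 by rewrite expr2 {1}e mulNr mulVf ?qparam_neq0.
by rewrite -[4%N]/(2 * 2)%N exprM p2 sqrrN expr1n.
Qed.

End NotRoot.

Section VectorBasis.
Variables (C : fieldType) (n : nat) (A : qtype) (q : C).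
Hypotheses (n_gt0 : (0 < n)%N) (q0 : q != 0).
Hypothesis q_not_root : forall k, (0 < k)%N -> q ^+ k != 1.
Local Notation p := (qparam A q).
Local Notation m := (2 * n).+1.
Implicit Types (i : 'I_n) (Y : 'M[C]_m).

Definition osp_sign : C := (-1) ^+ is_osp A.
Local Notation sg := osp_sign.

(* The sign of the parity of the basis vector of weight a: the zero weight vector is even. *)
Definition wsign (a : nat) : C := if a == n then 1 else sg.

Definition gsign i (a : nat) : C := if gen_odd A i then wsign a else 1.

Variable eta : nat -> C.
Hypothesis eta_neq0 : forall a, (a < 2 * n)%N -> eta a != 0.

(* In the basis u_0, ..., u_2n: e_i u_(a+1) = eta_a u_a and f_i u_a = u_(a+1) if the weights
   a and a + 1 differ by the i-th simple root. *)
Definition bE i : 'M[C]_m :=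
  \matrix_(a, b) (eta a *+ ((b == a.+1 :> nat) && (step n a == i))).
Definition bF i : 'M[C]_m :=
  \matrix_(b, a) ((b == a.+1 :> nat) && (step n a == i))%:R.
Definition bK i : 'M[C]_m := diag_mx (\row_a p ^ kexp n i a).
Definition bKV i : 'M[C]_m := diag_mx (\row_a p ^ (- kexp n i a)).
Definition bJ : 'M[C]_m := diag_mx (\row_a wsign a).
Definition bJi i : 'M[C]_m := diag_mx (\row_a gsign i a).
(** The first factor of k_i^-1 (x) f_i, together with the sign produced by f_i passing the first
    vector. *)
Definition bL i : 'M[C]_m := diag_mx (\row_a (p ^ (- kexp n i a) * gsign i a)).
Definition bH : 'M[C]_m := diag_mx (\row_a p ^ height n a).

Definition vE i : 'M[C]_(m * m) := bE i *t bK i + bJi i *t bE i.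
Definition vF i : 'M[C]_(m * m) := bF i *t 1 + bL i *t bF i.

Lemma osp_sign2 : sg * sg = 1.
Proof. by rewrite /osp_sign; case: (is_osp A); rewrite ?mulrNN mulr1. Qed.

Lemma osp_sign_neq0 : sg != 0.
Proof. by apply/eqP=> e; have := osp_sign2; rewrite e mul0r => /eqP; rewrite eq_sym oner_eq0. Qed.

Lemma wsign2 a : wsign a * wsign a = 1.
Proof. by rewrite /wsign; case: ifP; rewrite ?mulr1 ?osp_sign2. Qed.

Lemma gsign2 i a : gsign i a * gsign i a = 1.
Proof. by rewrite /gsign; case: ifP; rewrite ?mulr1 ?wsign2. Qed.

Lemma wsign_step i a : (a < 2 * n)%N -> step n a = i ->
  wsign a * gsign i a = wsign a.+1 * gsign i a.+1.
Proof.
rewrite /gsign /gen_odd => lt_a ei; case: ifP => [_|]; first by rewrite !wsign2.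
rewrite !mulr1 /wsign; case osp: (is_osp A) => /=; last first.
  by move=> _; rewrite /osp_sign osp /= expr0; do 2!case: ifP.
move=> /negbT; rewrite -ei /step; case: ltnP => [lt_an|le_na] /eqP ne_i.
  by rewrite (ltn_eqF lt_an); case: eqVneq => // en; case: ne_i.
by case: eqVneq => [en|_]; [case: ne_i|case: eqVneq => // en; case: ne_i]; lia.
Qed.

(** Entries indexed by nat and zero out of range, so that recursions reaching a + 1 or b + 1 have no
    boundary case. *)
Definition ent Y (a b : nat) : C :=
  if (a <= 2 * n)%N && (b <= 2 * n)%N then Y (inord a) (inord b) else 0.

Lemma ent_ord Y (a b : 'I_m) : ent Y a b = Y a b.
Proof. by rewrite /ent !leq_ord !inord_val. Qed.

Lemma ent_outl Y a b : (2 * n < a)%N -> ent Y a b = 0.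
Proof. by rewrite /ent [(a <= _)%N]leqNgt => ->. Qed.

Lemma ent_outr Y a b : (2 * n < b)%N -> ent Y a b = 0.
Proof. by rewrite /ent [(b <= _)%N]leqNgt => ->; rewrite andbF. Qed.

Lemma sum_next (phi : 'I_m -> C) (P : bool) (a : 'I_m) :
  \sum_(b < m) phi b *+ ((b == a.+1 :> nat) && P) =
  (if (a < 2 * n)%N then phi (inord a.+1) else 0) *+ P.
Proof.
case: P; last by rewrite mulr0n big1 // => b _; rewrite andbF.
case: ifP => lt_a.
  rewrite (bigD1 (inord a.+1)) //= inordK // eqxx big1 ?addr0 // => b ne_b.
  rewrite andbT; case: eqP => // eb; case/eqP: ne_b.
  by apply: val_inj; rewrite /= inordK.
rewrite mul0rn big1 // => b _; case: eqP => // eb.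
by have := ltn_ord b; rewrite eb ltnS lt_a.
Qed.

Lemma bE_mul i Y (a b : 'I_m) :
  (bE i *m Y) a b = eta a * ent Y a.+1 b *+ (step n a == i).
Proof.
rewrite mxE; under eq_bigr => c _ do rewrite mxE mulrnAl.
rewrite sum_next /ent; rewrite leq_ord andbT inord_val.
by case: ifP => // _; rewrite mulr0.
Qed.

Lemma mul_bE i Y (a b : 'I_m) :
  (Y *m (bE i)^T) a b = eta b * ent Y a b.+1 *+ (step n b == i).
Proof.
rewrite mxE; under eq_bigr => c _ do rewrite 2!mxE mulrnAr.
rewrite sum_next /ent; rewrite leq_ord /= inord_val.
by case: ifP => // _; rewrite ?mulr0 // mulrC.
Qed.

Lemma bF_delta i (a a' b : 'I_m) : a' = a.+1 :> nat ->
  bF i *m delta_mx a b = delta_mx a' b *+ (step n a == i).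
Proof.
move=> ea; apply/matrixP=> c d; rewrite mulmxnE mxE (bigD1 a) //= big1 => [|k ne_k].
  rewrite !mxE eqxx addr0 -natrM -mulrnA; congr (_%:R).
  rewrite -[c == a']val_eqE /= ea.
  by case: (c == a.+1 :> nat); case: (d == b); case: (step n a == i).
by rewrite [delta_mx _ _ _ _]mxE (negbTE ne_k) mulr0.
Qed.

Lemma bE_delta i (a a' b : 'I_m) : a' = a.+1 :> nat ->
  bE i *m delta_mx a' b = (eta a *+ (step n a == i)) *: delta_mx a b.
Proof.
move=> ea; apply/matrixP=> c d; rewrite !mxE (bigD1 a') //= big1 => [|k ne_k].
  rewrite !mxE eqxx addr0 ea eqSS eq_sym -[c == a]val_eqE /=.
  case: eqVneq => [/val_inj->|_]; last by rewrite mulr0n mul0r mulr0.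
  by [].
by rewrite [delta_mx _ _ _ _]mxE (negbTE ne_k) mulr0.
Qed.

Lemma bE_delta0 i (b : 'I_m) : bE i *m delta_mx 0 b = 0.
Proof.
apply/matrixP=> c d; rewrite !mxE big1 // => k _; rewrite !mxE.
by case: (eqVneq k 0) => [->|_] /=; rewrite ?mulr0 // mulr0n mul0r.
Qed.

Lemma op_vE i Y : op (vE i) Y = bE i *m Y *m bK i + bJi i *m Y *m (bE i)^T.
Proof. by rewrite opDl !op_tens tr_diag_mx. Qed.

Lemma op_vF i Y : op (vF i) Y = bF i *m Y + bL i *m Y *m (bF i)^T.
Proof. by rewrite opDl !op_tens trmx1 mulmx1. Qed.

Definition has_height (h : int) Y := bH *m Y *m bH = p ^ h *: Y.

Definition hw_vec Y := forall i, op (vE i) Y = 0.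

Lemma has_heightP h Y : has_height h Y ->
  forall a b, ent Y a b != 0 -> height n a + height n b = h.
Proof.
move=> Yh a b; rewrite /ent; case: ifP => [/andP[le_a le_b] Y0|]; last by rewrite eqxx.
have := congr1 (fun Z : 'M_m => Z (inord a) (inord b)) Yh.
rewrite /bH mul_mx_diag mul_diag_mx !mxE !inordK // mulrAC -expfzDr ?qparam_neq0 //.
by move/(mulIf Y0)/(qparam_expz_inj q0 q_not_root).
Qed.

Lemma hw_eq Y i a b : hw_vec Y -> (a <= 2 * n)%N -> (b <= 2 * n)%N ->
  (eta a * ent Y a.+1 b * p ^ kexp n i b) *+ (step n a == i) +
  (gsign i a * (eta b * ent Y a b.+1)) *+ (step n b == i) = 0.
Proof.
move=> /(_ i); rewrite op_vE => e le_a le_b.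
have := congr1 (fun Z : 'M_m => Z (inord a) (inord b)) e.
rewrite [RHS]mxE [LHS]mxE mul_mx_diag [X in X + _]mxE bE_mul -mulmxA mul_diag_mx [X in _ + X]mxE.
by rewrite mul_bE !mxE !inordK // mulrnAl mulrnAr.
Qed.

Lemma hw_rowS Y a b : hw_vec Y -> (a <= 2 * n)%N -> ent Y a.+1 b = 0 -> ent Y a b.+1 = 0.
Proof.
move=> Yhw le_a Y0; case: (leqP (2 * n) b) => [le_b|lt_b]; first exact: ent_outr.
have := @hw_eq Y (Ordinal (step_lt n_gt0 lt_b)) a b Yhw le_a (ltnW lt_b).
rewrite eqxx Y0 mulr0 mul0r mul0rn add0r mulr1n => /eqP; rewrite !mulf_eq0.
rewrite (negbTE (eta_neq0 lt_b)) /=; case/orP => [/eqP g0|/eqP //].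
have := gsign2 (Ordinal (step_lt n_gt0 lt_b)) a.
by rewrite g0 mul0r => /eqP; rewrite eq_sym oner_eq0.
Qed.

(** Reading e_i Y = 0 with i = [step n b] at the entry (a, b) carries vanishing from (a + 1, b) to
    (a, b + 1) ([hw_rowS]). Hence column 0, the coefficients of the u_a (x) u_0, determines a
    highest weight vector. *)
Lemma hw_zero Y : hw_vec Y -> (forall a, ent Y a 0 = 0) -> Y = 0.
Proof.
move=> Yhw Y0; suff E d a b : (2 * n < a + d)%N -> ent Y a b = 0.
  apply/matrixP=> a b; rewrite mxE -ent_ord; apply: (E m); lia.
elim: d a b => [|d IHd] a b; first by rewrite addn0; apply: ent_outl.
rewrite addnS -addSn => lt_a; case: b => [|b]; first exact: Y0.
case: (leqP a (2 * n)) => [le_a|]; last exact: ent_outl.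
exact/hw_rowS/IHd.
Qed.

(** The height leaves only the entry (a0, 0) of column 0, so highest weight vectors of this height
    form at most a line. *)
Lemma hw_eq0 Y a0 : (a0 <= 2 * n)%N -> hw_vec Y ->
  has_height (height n a0 + height n 0) Y -> ent Y a0 0 = 0 -> Y = 0.
Proof.
move=> le_a0 Yhw /has_heightP Yh Y0; apply: hw_zero => // a; apply/eqP.
case: (leqP a (2 * n)) => [le_a|/ent_outl->//]; apply/negPn/negP => Ya.
have /addIr/(height_inj n_gt0 le_a le_a0) ea := Yh _ _ Ya.
by rewrite ea Y0 eqxx in Ya.
Qed.

Lemma hw_support Y a0 a b : (a0 <= 2 * n)%N -> hw_vec Y ->
  has_height (height n a0 + height n 0) Y -> (a0 < a)%N || (a == a0) && (0 < b)%N ->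
  ent Y a b = 0.
Proof.
move=> le_a0 Yhw /has_heightP Yh.
suff E d c : (2 * n < c + d)%N -> (a0 < c)%N -> forall b, ent Y c b = 0.
  case/orP=> [lt_a|/andP[/eqP-> b0]]; first by apply: (E m) => //; lia.
  by case: b b0 => // b _; apply: hw_rowS => //; apply: (E m); lia.
elim: d c => [|d IHd] c; first by rewrite addn0 => *; apply: ent_outl.
rewrite addnS -addSn => lt_c lt_a0c [|b'].
  apply/eqP/negPn/negP => Yc; case: (leqP c (2 * n)) => le_c.
    have /addIr/(height_inj n_gt0 le_c le_a0) ec := Yh _ _ Yc.
    by rewrite ec ltnn in lt_a0c.
  by rewrite ent_outl ?eqxx in Yc.
case: (leqP c (2 * n)) => [le_c|]; last exact: ent_outl.
by apply: hw_rowS => //; apply: IHd => //; apply: ltnW.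
Qed.

(** Let e_i, with i the root of the step from a0 - 1 to a0, act at the entry (a0 - 1, 0). The second
    term is present only if the step from 0 to 1 uses the same root, that is for a0 = 1 or a0 = 2n.
    With a0 = 0 these exceptions are the highest weights mu, 0 and 2 eps_1. *)
Lemma hw_col0 Y a0 : (1 < a0 < 2 * n)%N -> hw_vec Y ->
  has_height (height n a0 + height n 0) Y -> Y = 0.
Proof.
move=> /andP[a0_gt1 lt_a0] Yhw Yh; apply: (hw_eq0 (ltnW lt_a0) Yhw Yh).
case: a0 => // a in a0_gt1 lt_a0 Yh *.
have lt_a : (a < 2 * n)%N by lia.
have := @hw_eq Y (Ordinal (step_lt n_gt0 lt_a)) a 0 Yhw (ltnW lt_a) (leq0n _).
rewrite eqxx mulr1n /= [(step n 0 == _)]eq_sym.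
have -> : step n 0 = 0 by rewrite /step n_gt0.
rewrite (step0 n_gt0 lt_a); have -> : (a == 0)%N || (a == (2 * n).-1)%N = false by lia.
rewrite mulr0n addr0 => /eqP; rewrite !mulf_eq0 expfz_eq0 (negbTE (qparam_neq0 A q0)) andbF.
by rewrite (negbTE (eta_neq0 lt_a)) orbF /= => /eqP.
Qed.

Lemma bF_mul i Y (a b : 'I_m) :
  (bF i *m Y) a b = ent Y a.-1 b *+ ((0 < a)%N && (step n a.-1 == i)).
Proof.
rewrite mxE; case: (posnP a) => [a0|a_gt0].
  by rewrite mulr0n big1 // => c _; rewrite mxE a0 mul0r.
have lt_a : (a.-1 < m)%N by apply: leq_ltn_trans (leq_pred _) (ltn_ord a).
rewrite (bigD1 (Ordinal lt_a)) //= big1 => [|c ne_c].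
  rewrite mxE /= prednK // eqxx addr0 -(ent_ord _ (Ordinal lt_a)) /=.
  by case: (_ == _); rewrite ?mul1r ?mul0r.
rewrite mxE; case: eqVneq => [ea|_]; last by rewrite mul0r.
by case/eqP: ne_c; apply: val_inj; rewrite /= ea.
Qed.

Lemma mul_bF i Y (a b : 'I_m) :
  (Y *m (bF i)^T) a b = ent Y a b.-1 *+ ((0 < b)%N && (step n b.-1 == i)).
Proof.
have -> : Y *m (bF i)^T = (bF i *m Y^T)^T by rewrite trmx_mul trmxK.
by rewrite mxE bF_mul /ent andbC; case: ifP => // _; rewrite mxE.
Qed.

Lemma ent_vF Y i a b : (a <= 2 * n)%N -> (b <= 2 * n)%N ->
  ent (op (vF i) Y) a b =
  ent Y a.-1 b *+ ((0 < a)%N && (step n a.-1 == i)) +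
  (p ^ (- kexp n i a) * gsign i a * ent Y a b.-1) *+ ((0 < b)%N && (step n b.-1 == i)).
Proof.
move=> le_a le_b; rewrite /ent le_a le_b op_vF mxE bF_mul -mulmxA mul_diag_mx [X in _ + X]mxE.
by rewrite mul_bF mxE !inordK // mulrnAr /ent le_a le_b.
Qed.

Lemma gsign_diff (i j : 'I_n) b : (b < 2 * n)%N -> step n b = j ->
  gsign i b.+1 = (-1) ^+ (gen_odd A i && gen_odd A j) * gsign i b.
Proof.
rewrite /gsign /gen_odd => lt_b ej; case osp: (is_osp A) => /=; last by rewrite mul1r.
case: eqVneq => [ei|_] /=; last by rewrite mul1r.
have -> : (j.+1 == n) = (b == n.-1) || (b == n) by rewrite -ej /step; case: ltnP; lia.
rewrite /wsign /osp_sign osp expr1.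
have [->|ne1] := eqVneq b n.-1.
  by rewrite prednK // eqxx ltn_eqF ?prednK // mulrNN mulr1.
have -> : (b.+1 == n) = false by lia.
by case: (b == n); rewrite ?mulr1 ?mul1r.
Qed.

Hypothesis bEF : forall i j,
  bE i *m bF j - (-1) ^+ (gen_odd A i && gen_odd A j) *: (bF j *m bE i) =
  if i == j then (p - p^-1)^-1 *: (bK i - bKV i) else 0.

(** Equal to p^-(alpha_i, alpha_j), because the weights i and i + 1 differ by alpha_i. *)
Let cf (i j : 'I_n) : C := p ^ (kexp n j i.+1 - kexp n j i).

Lemma step_id (i : 'I_n) : step n i = i.
Proof. by rewrite /step ltn_ord. Qed.

Lemma bKF i j : bK i *m bF j = cf i j *: (bF j *m bK i).
Proof.
rewrite /bK mul_diag_mx mul_mx_diag; apply/matrixP=> a b; rewrite !mxE.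
case: eqVneq => [ea|_] /=; last by rewrite mul0r !mulr0.
case: eqVneq => [eb|_] /=; last by rewrite mul0r !mulr0.
have lt_b : (b < 2 * n)%N by have := ltn_ord a; rewrite ea.
have lt_i : (i < 2 * n)%N by have := ltn_ord i; lia.
rewrite mulr1 mul1r ea /cf -expfzDr ?qparam_neq0 //; congr (p ^ _).
by have := kexp_diff lt_b lt_i eb (step_id i); lia.
Qed.

Lemma bEL i j : bE i *m bL j =
  ((-1) ^+ (gen_odd A i && gen_odd A j) * (cf i j)^-1) *: (bL j *m bE i).
Proof.
rewrite /bL mul_diag_mx mul_mx_diag; apply/matrixP=> a b; rewrite !mxE.
case: eqVneq => [eb|_] /=; last by rewrite mulr0n mul0r !mulr0.
case: eqVneq => [ea|_] /=; last by rewrite mulr0n mul0r !mulr0.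
have lt_a : (a < 2 * n)%N by have := ltn_ord b; rewrite eb.
have lt_i : (i < 2 * n)%N by have := ltn_ord i; lia.
have lt_j : (j < 2 * n)%N by have := ltn_ord j; lia.
have E : p ^ (- kexp n j a.+1) = (cf i j)^-1 * p ^ (- kexp n j a).
  rewrite /cf invr_expz -expfzDr ?qparam_neq0 //; congr (p ^ _).
  have := kexp_diff lt_a lt_i ea (step_id i).
  have := kexp_diff lt_i lt_i (step_id i) (step_id i).
  have := kexp_diff lt_j lt_a (step_id j) ea.
  by have := kexp_diff lt_j lt_i (step_id j) (step_id i); lia.
by rewrite mulr1n eb (gsign_diff j lt_a ea) [gen_odd A j && _]andbC E; ring.
Qed.

Lemma bJF i j : bJi i *m bF j =
  (-1) ^+ (gen_odd A i && gen_odd A j) *: (bF j *m bJi i).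
Proof.
rewrite /bJi mul_diag_mx mul_mx_diag; apply/matrixP=> a b; rewrite !mxE.
case: eqVneq => [ea|_] /=; last by rewrite mul0r !mulr0.
case: eqVneq => [eb|_] /=; last by rewrite mul0r !mulr0.
have lt_b : (b < 2 * n)%N by have := ltn_ord a; rewrite ea.
by rewrite ea (gsign_diff i lt_b eb); ring.
Qed.

Lemma bLJ i : bL i *m bJi i = bKV i.
Proof.
rewrite /bL mul_diag_mx; apply/matrixP=> a b; rewrite !mxE.
by case: eqP => [->|_]; rewrite ?mulr0n ?mulr0 // !mulr1n -mulrA gsign2 mulr1.
Qed.

Lemma bKVK i : bKV i *m bK i = 1%:M.
Proof.
rewrite /bKV mul_diag_mx; apply/matrixP=> a b; rewrite !mxE.
case: eqP => [->|_]; rewrite ?mulr0n ?mulr0 // !mulr1n.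
by rewrite -expfzDr ?qparam_neq0 // addNr.
Qed.

Lemma bKKV i : bK i *m bKV i = 1%:M.
Proof. by rewrite diag_mxC bKVK. Qed.

(** The superbracket of e_i and f_j is zero or a multiple of k_i - k_i^-1, and the latter kills
    vectors of weight zero. *)
Lemma vF_hw Y j : hw_vec Y -> (forall i, bK i *m Y *m bK i = Y) -> hw_vec (op (vF j) Y).
Proof.
move=> Yhw YK i; set s : C := (-1) ^+ (gen_odd A i && gen_odd A j); set c := cf i j.
have c0 : c != 0 by rewrite expfz_neq0 ?qparam_neq0.
have LJ : bL j *m bJi i = bJi i *m bL j by rewrite diag_mxC.
have KL : bL j *m bK i = bK i *m bL j by rewrite diag_mxC.
(* Subtracting s f_j e_i Y = 0 makes the mixed terms cancel ([e1], [e2]), which leaves the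
   superbracket D acting on each factor separately. *)
have := congr1 (fun Z => s *: op (vF j) Z) (Yhw i); rewrite linear0 scaler0 => eq0.
rewrite -[LHS]subr0 -[X in _ - X]eq0 !op_vE !op_vF {eq0}.
pose D := bE i *m bF j - s *: (bF j *m bE i).
have -> : bE i *m (bF j *m Y + bL j *m Y *m (bF j)^T) *m bK i +
     bJi i *m (bF j *m Y + bL j *m Y *m (bF j)^T) *m (bE i)^T -
     s *: (bF j *m (bE i *m Y *m bK i + bJi i *m Y *m (bE i)^T) +
      bL j *m (bE i *m Y *m bK i + bJi i *m Y *m (bE i)^T) *m (bF j)^T) =
   D *m Y *m bK i + bL j *m bJi i *m Y *m D^T.
  have e1 : bE i *m (bL j *m Y *m (bF j)^T) *m bK i =
      s *: (bL j *m (bE i *m Y *m bK i) *m (bF j)^T).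
    rewrite !mulmxA bEL -/s -/c -!mulmxA.
    have -> : (bF j)^T *m bK i = c *: (bK i *m (bF j)^T).
      have -> : (bF j)^T *m bK i = (bK i *m bF j)^T by rewrite trmx_mul tr_diag_mx.
      by rewrite bKF linearZ /= trmx_mul tr_diag_mx.
    by rewrite -!scalemxAl -!scalemxAr scalerA divfK // !mulmxA.
  have e2 : bJi i *m (bF j *m Y) *m (bE i)^T = s *: (bF j *m (bJi i *m Y *m (bE i)^T)).
    by rewrite mulmxA bJF -/s -!scalemxAl !mulmxA.
  have e3 : bJi i *m (bL j *m Y *m (bF j)^T) *m (bE i)^T =
      bL j *m bJi i *m Y *m (bE i *m bF j)^T by rewrite trmx_mul LJ !mulmxA.
  have e4 : bL j *m (bJi i *m Y *m (bE i)^T) *m (bF j)^T =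
      bL j *m bJi i *m Y *m (bF j *m bE i)^T by rewrite trmx_mul !mulmxA.
  have d1 : D *m Y *m bK i = bE i *m (bF j *m Y) *m bK i - s *: (bF j *m (bE i *m Y *m bK i)).
    by rewrite /D !mulmxBl -!scalemxAl !mulmxA.
  have d2 : bL j *m bJi i *m Y *m D^T =
      bJi i *m (bL j *m Y *m (bF j)^T) *m (bE i)^T -
      s *: (bL j *m (bJi i *m Y *m (bE i)^T) *m (bF j)^T).
    by rewrite e3 e4 /D linearB linearZ /= mulmxBr -scalemxAr.
  rewrite d1 d2 !mulmxDr !mulmxDl e1 e2 !scalerDr.
  by rewrite [X in _ + X - _]addrC addrACA [X in _ + _ - (_ + X)]addrC
    [X in _ - X]addrACA [X in _ + X - _]addrC opprD addrACA subrr addr0 opprD addrACA.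
rewrite /D bEF; case: eqP => [eij|_]; last by rewrite !mul0mx trmx0 mulmx0 addr0.
have -> : ((p - p^-1)^-1 *: (bK i - bKV i))^T = (p - p^-1)^-1 *: (bK i - bKV i).
  by rewrite linearZ linearB /= !tr_diag_mx.
rewrite eij bLJ.
rewrite -!scalemxAl -scalemxAr -scalerDr mulmxBl mulmxBl mulmxBr YK.
have -> : bKV j *m Y *m bKV j = Y.
  by rewrite -{1}(YK j) !mulmxA bKVK mul1mx -mulmxA bKKV mulmx1.
by rewrite addrA subrK subrr scaler0.
Qed.

(** * Operators commuting with the k_i preserve weights and heights *)

Section CommDiag.
Implicit Types (X : 'M[C]_(m * m)) (d : 'rV[C]_m).
Local Notation idx a b := (mxtens_index (a, b)).

Lemma scalemx_ent (k : C) Y (a b : 'I_m) : (k *: Y) a b = k * Y a b.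
Proof. by rewrite mxE. Qed.

Lemma diag_conj_ent d Y (a b : 'I_m) :
  (diag_mx d *m Y *m diag_mx d) a b = d 0 a * d 0 b * Y a b.
Proof. by rewrite mul_mx_diag mul_diag_mx !mxE; ring. Qed.

Lemma diag_delta d (a b : 'I_m) :
  diag_mx d *m delta_mx a b *m diag_mx d = (d 0 a * d 0 b) *: delta_mx a b.
Proof.
apply/matrixP=> c e; rewrite mul_mx_diag mul_diag_mx !mxE.
by case: eqVneq => [->|_]; case: eqVneq => [->|_]; rewrite /= ?(mulr0, mul0r) //; ring.
Qed.

Lemma comm_diagP X d : X *m (diag_mx d *t diag_mx d) = (diag_mx d *t diag_mx d) *m X <->
  forall a b c e, X (idx a b) (idx c e) * (d 0 c * d 0 e) = X (idx a b) (idx c e) * (d 0 a * d 0 b).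
Proof.
have EL a b c e : op (X *m (diag_mx d *t diag_mx d)) (delta_mx c e) a b =
    X (idx a b) (idx c e) * (d 0 c * d 0 e).
  by rewrite opM op_tens tr_diag_mx diag_delta linearZ /= scalemx_ent op_delta mulrC.
have ER a b c e : op ((diag_mx d *t diag_mx d) *m X) (delta_mx c e) a b =
    X (idx a b) (idx c e) * (d 0 a * d 0 b).
  by rewrite opM op_tens tr_diag_mx diag_conj_ent op_delta mulrC.
split=> [eX a b c e|eX]; first by rewrite -EL -ER eX.
by apply: op_inj => c e; apply/matrixP=> a b; rewrite EL ER.
Qed.

Lemma comm_kexp X : (forall i, X *m (bK i *t bK i) = (bK i *t bK i) *m X) ->
  forall a b c e, X (idx a b) (idx c e) != 0 ->
  forall i, kexp n i a + kexp n i b = kexp n i c + kexp n i e.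
Proof.
move=> XK a b c e X0 i; have /comm_diagP/(_ a b c e) := XK i.
rewrite !mxE -!expfzDr ?qparam_neq0 //.
by move/(mulfI X0)/(qparam_expz_inj q0 q_not_root).
Qed.

Lemma comm_height X : (forall i, X *m (bK i *t bK i) = (bK i *t bK i) *m X) ->
  forall a b c e, X (idx a b) (idx c e) != 0 -> height n a + height n b = height n c + height n e.
Proof.
move=> XK a b c e /(comm_kexp XK) eqK.
rewrite -!(sum_two_rho_kexp n_gt0) ?leq_ord // -!big_split; apply: eq_bigr => i _.
by rewrite /= -!mulrDr eqK.
Qed.

Lemma comm_bH X : (forall i, X *m (bK i *t bK i) = (bK i *t bK i) *m X) ->
  X *m (bH *t bH) = (bH *t bH) *m X.
Proof.
move=> XK; apply/comm_diagP=> a b c e; rewrite !mxE -!expfzDr ?qparam_neq0 //.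
by have [->|/(comm_height XK)->] := eqVneq (X (idx a b) (idx c e)) 0; rewrite ?mul0r.
Qed.

End CommDiag.

(** The power of p is the Cartan part p^(eps_1, weight a) of the R-matrix on u_0 (x) u_a; [wsign] is
    the sign of the graded flip past u_0, and sg comes from the rescaling of the R-matrix. *)
Definition tau (a : nat) : C := sg * p ^ ((a == 0)%:Z - (a == 2 * n)%N%:Z) * wsign a.
Definition bT : 'M[C]_m := diag_mx (\row_a tau a).
(** The diagonal entries of k_2rho times the parity operator, so that the quantum supertrace becomes
    an ordinary trace weighted by [bM]. *)
Definition mval (a : nat) : C := wsign a * p ^ height n a.
Definition bM : 'M[C]_m := diag_mx (\row_a mval a).
Local Notation r := (sg * p ^+ (2 * n)).
Local Notation x := (bwm_x r p).
Local Notation z := (p - p^-1).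

Lemma comm_bJ_entry X : X *m (bJ *t bJ) = (bJ *t bJ) *m X -> forall a b c e : 'I_m,
  X (mxtens_index (a, b)) (mxtens_index (c, e)) != 0 ->
  wsign a * wsign b = wsign c * wsign e.
Proof. by move=> /comm_diagP XJ a b c e X0; have := XJ a b c e; rewrite !mxE => /(mulfI X0). Qed.

Lemma comm_bT X : (forall i, X *m (bK i *t bK i) = (bK i *t bK i) *m X) ->
  X *m (bJ *t bJ) = (bJ *t bJ) *m X -> X *m (bT *t bT) = (bT *t bT) *m X.
Proof.
move=> XK XJ; apply/comm_diagP=> a b c e; rewrite !mxE.
have [->|X0] := eqVneq (X (mxtens_index (a, b)) (mxtens_index (c, e))) 0; first by rewrite !mul0r.
have tt u v : tau u * tau v = p ^ (((u == 0)%:Z - (u == 2 * n)%N%:Z) +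
    ((v == 0)%:Z - (v == 2 * n)%N%:Z)) * (wsign u * wsign v).
  rewrite expfzDr ?qparam_neq0 // /tau -[RHS]mul1r -osp_sign2; ring.
rewrite !tt (comm_bJ_entry XJ X0); congr (_ * (p ^ _ * _)).
rewrite -!(sum_kexp n_gt0) ?leq_ord // -!big_split.
by apply: eq_bigr => i _; rewrite /= (comm_kexp XK X0).
Qed.

Lemma comm_bM X : (forall i, X *m (bK i *t bK i) = (bK i *t bK i) *m X) ->
  X *m (bJ *t bJ) = (bJ *t bJ) *m X -> X *m (bM *t bM) = (bM *t bM) *m X.
Proof.
move=> XK XJ; apply/comm_diagP=> a b c e; rewrite !mxE.
have [->|X0] := eqVneq (X (mxtens_index (a, b)) (mxtens_index (c, e))) 0; first by rewrite !mul0r.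
congr (_ * _); rewrite /mval mulrACA [RHS]mulrACA (comm_bJ_entry XJ X0).
by rewrite -!expfzDr ?qparam_neq0 // (comm_height XK X0).
Qed.

(** The recursion that e_i forces on g (u_0 (x) u_a) = tau_a u_a (x) u_0: it lowers u_0 (x) u_(a+1)
    with the sign of passing u_0, and u_(a+1) (x) u_0 with the eigenvalue of k_i on u_0. *)
Lemma gsign_tau i a : (a < 2 * n)%N -> step n a = i ->
  gsign i 0 * tau a = tau a.+1 * p ^ kexp n i 0.
Proof.
move=> lt_a ei; rewrite /tau.
have -> : (a == 0)%:Z - (a == 2 * n)%N%:Z =
    ((a.+1 == 0)%:Z - (a.+1 == 2 * n)%N%:Z) + kexp n i 0.
  by rewrite kexp0 // -ei (step0 n_gt0 lt_a); lia.
rewrite expfzDr ?qparam_neq0 //; set u := p ^ _; set v := p ^ _.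
suff -> : wsign a.+1 = gsign i 0 * wsign a by ring.
have w0 : wsign 0 = sg by rewrite /wsign ltn_eqF.
have := wsign_step lt_a ei; rewrite /gsign; case: ifP => [odd_i _|_]; last by rewrite !mulr1 mul1r.
have : (a == n.-1) || (a == n).
  by move: odd_i; rewrite /gen_odd -ei /step; case: ltnP => ? /andP[_]; lia.
rewrite w0 /wsign; case/orP => /eqP->.
  by rewrite prednK // eqxx ltn_eqF ?prednK // osp_sign2.
by rewrite eqxx gtn_eqF // mulr1.
Qed.

Lemma osp_signV : sg^-1 = sg.
Proof. by apply: (mulfI osp_sign_neq0); rewrite osp_sign2 mulfV ?osp_sign_neq0. Qed.

Lemma sum_mval : \sum_(a < m) mval a = x.
Proof.
(* A discrete primitive, from z p^h = p^(h+1) - p^(h-1). Its exponent drops by 2 at each step except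
   across the zero weight, where U is constant and the summand z remains. *)
pose U (a : nat) : C := sg * p ^ ((2 * n)%:Z - (2 * a)%:Z + (if (n < a)%N then 2 else 0)).
have z0 : z != 0 := qparam_sub_inv A q0 q_not_root.
have p0 := qparam_neq0 A q0.
have step_U a : z * mval a = - (U a.+1 - U a) + (if a == n then z else 0).
  have E (h : int) : z * p ^ h = p ^ (h + 1) - p ^ (h - 1).
    by rewrite !expfzDr // expr1z exprN1; ring.
  rewrite /mval /U mulrCA E /height /wsign ltnS.
  case: (ltngtP a n) => [lt_a|gt_a|->].
  - rewrite addr0 opprB -mulrBr; congr (_ * (p ^ _ - p ^ _)); lia.
  - rewrite addr0 opprB -mulrBr; congr (_ * (p ^ _ - p ^ _)); lia.
  rewrite mul1r add0r sub0r expr1z exprN1.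
  have -> : (2 * n)%:Z - (2 * n.+1)%:Z + 2 = 0 by lia.
  have -> : (2 * n)%:Z - (2 * n)%:Z + 0 = 0 by lia.
  by rewrite subrr oppr0 add0r.
apply: (mulfI z0); rewrite mulr_sumr.
under eq_bigr => a _ do rewrite step_U.
rewrite big_split /= sumrN -(big_mkord xpredT (fun a => U a.+1 - U a)) telescope_sumr //.
have lt_n : (n < m)%N by lia.
rewrite (bigD1 (Ordinal lt_n)) //= eqxx [X in _ + (_ + X)]big1 => [|a ne_a]; last first.
  by case: eqP => // ea; case/eqP: ne_a; apply: val_inj.
have U0 : U 0 = sg * p ^ (2 * n)%:Z by rewrite /U ltn0; congr (_ * p ^ _); lia.
have Um : U m = sg * p ^ (- (2 * n)%:Z) by rewrite /U; congr (_ * p ^ _); case: ltnP => ?; lia.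
rewrite U0 Um addr0 /bwm_x.
have -> : (sg * p ^+ (2 * n))^-1 = sg * p ^ (- (2 * n)%:Z).
  by rewrite invfM osp_signV exprnN.
by rewrite mulrDr mulr1 mulrCA divff // mulr1 opprB.
Qed.

(** Put t = -q = sg p. Then sg z x = t^2n - t^-2n + t - t^-1 = (t^2n + t) (1 - t^-(2n+1)), and a
    zero of either factor would make q a root of unity. *)
Lemma bwm_x_neq0 : x != 0.
Proof.
apply/eqP => x0; pose t := - q.
have t0 : t != 0 by rewrite oppr_eq0.
have z0 : z != 0 := qparam_sub_inv A q0 q_not_root.
have pt : p = sg * t.
  by rewrite /t /qparam /osp_sign; case: (is_osp A); rewrite ?expr1 ?expr0 ?mulN1r ?mul1r ?opprK.
have p2n : p ^+ (2 * n) = t ^+ (2 * n) by rewrite pt exprMn exprM [sg ^+ 2]osp_sign2 expr1n mul1r.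
have : (t ^+ (2 * n) + t) * (1 - t^-1 ^+ (2 * n).+1) = 0.
  have := congr1 (fun y => sg * z * y) x0; rewrite mulr0 /bwm_x mulrDr mulr1 -mulrA.
  rewrite [z * _]mulrC divfK // invfM osp_signV p2n pt invfM osp_signV => e.
  rewrite -[RHS]e exprS exprVn; set T := t ^+ _.
  have TV : T * T^-1 = 1 by rewrite divff // expf_neq0.
  have tV : t * t^-1 = 1 by rewrite divff.
  move: T^-1 t^-1 TV tV osp_sign2 => T' t' TV tV sg2.
  transitivity (T - T * T' * t' + t - t * t' * T'); first by ring.
  transitivity ((sg * sg) * (T - T' + t - t')); last by ring.
  rewrite sg2 TV tV; ring.
move/eqP; rewrite mulf_eq0 addr_eq0 subr_eq0 => /orP[] /eqP e.
  have : q ^+ (2 * (2 * n).-1) != 1 by apply: q_not_root; lia.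
  have tt : t ^+ (2 * n).-1 = -1.
    by apply: (mulIf t0); rewrite -exprSr prednK ?e ?mulN1r //; lia.
  by rewrite exprM -[q ^+ 2]sqrrN -exprM mulnC exprM tt sqrrN expr1n eqxx.
have : q ^+ (2 * (2 * n).+1) != 1 by apply: q_not_root; lia.
by rewrite exprM -[q ^+ 2]sqrrN -exprM mulnC exprM -[(- q) ^+ _]invrK -exprVn -e invr1 expr1n eqxx.
Qed.

Lemma trace_bM : \tr bM = x.
Proof. by rewrite mxtrace_diag -sum_mval; apply: eq_bigr => a _; rewrite mxE. Qed.

Variable c0 : 'M[C]_m.
Hypotheses (c0_hw : hw_vec c0) (c0_K : forall i, bK i *m c0 *m bK i = c0).

Lemma c0_K_ent i (a b : 'I_m) : c0 a b != 0 -> kexp n i a + kexp n i b = 0.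
Proof.
move=> c0ab; have := congr1 (fun Z : 'M_m => Z a b) (c0_K i); rewrite diag_conj_ent !mxE.
rewrite -expfzDr ?qparam_neq0 // -[RHS]mul1r => /(mulIf c0ab).
by rewrite -(expr0z p) => /(qparam_expz_inj q0 q_not_root).
Qed.

Lemma c0_height (a b : 'I_m) : c0 a b != 0 -> height n a + height n b = 0.
Proof.
move=> c0ab; rewrite -!(sum_two_rho_kexp n_gt0) ?leq_ord // -big_split big1 // => i _.
by rewrite /= -mulrDr c0_K_ent ?mulr0.
Qed.

Lemma c0_h0 : has_height 0 c0.
Proof.
apply/matrixP=> a b; rewrite diag_conj_ent expr0z scale1r !mxE.
have [->|c0ab] := eqVneq (c0 a b) 0; first by rewrite mulr0.
by rewrite -expfzDr ?qparam_neq0 // c0_height // expr0z mul1r.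
Qed.

(** By [vF_hw] the vector f_i c0 is annihilated by all e_j. Its column 0 would have to come from an
    entry (a, 0) of c0 with a < 2n, whereas height 0 allows only a = 2n. *)
Lemma c0_vF i : op (vF i) c0 = 0.
Proof.
apply: hw_zero (vF_hw i c0_hw c0_K) _ => a.
case: (leqP a (2 * n)) => [le_a|]; last exact: ent_outl.
rewrite ent_vF //= mulr0n addr0; case: a le_a => [|a] lt_a; first by rewrite mulr0n.
rewrite /= (_ : ent c0 a 0 = 0) ?mul0rn //; apply/eqP/negPn/negP => ca.
have := has_heightP c0_h0 ca; have := height_min n_gt0 lt_a.
have : height n a.+1 < height n a by apply: height_gt => //; rewrite ltnSn.
lia.
Qed.

Variables (g gV : 'M[C]_(m * m)) (c2 cm : 'M[C]_m) (cap : 'rV[C]_(m * m)).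
Hypotheses (g_gV : g *m gV = 1%:M) (gV_g : gV *m g = 1%:M).
Hypothesis gE : forall i, g *m vE i = vE i *m g.
Hypothesis gF : forall i, g *m vF i = vF i *m g.
Hypothesis gK : forall i, g *m (bK i *t bK i) = (bK i *t bK i) *m g.
Hypothesis gJ : g *m (bJ *t bJ) = (bJ *t bJ) *m g.
Hypotheses (c2_neq0 : c2 != 0) (c2_hw : hw_vec c2).
Hypotheses (c2_h : has_height (height n 0 + height n 0) c2) (g_c2 : op g c2 = p *: c2).
Hypotheses (cm_neq0 : cm != 0) (cm_hw : hw_vec cm).
Hypotheses (cm_h : has_height (height n 1 + height n 0) cm) (g_cm : op g cm = - p^-1 *: cm).
Hypotheses (c0_neq0 : c0 != 0) (g_c0 : op g c0 = r^-1 *: c0).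

Definition cupcap : 'M[C]_(m * m) := 1%:M - z^-1 *: (g - gV).
Hypothesis cupcapE : cupcap = vec_of c0 *m cap.

Definition capf Y : C := (cap *m vec_of Y) 0 0.

Lemma gV_comm X : g *m X = X *m g -> gV *m X = X *m gV.
Proof.
move=> gX; rewrite -[gV *m X]mulmx1 -g_gV mulmxA -(mulmxA gV) -gX.
by rewrite !mulmxA gV_g mul1mx.
Qed.

Lemma cupcap_comm X : g *m X = X *m g -> cupcap *m X = X *m cupcap.
Proof.
move=> gX; rewrite mulmxBl mulmxBr mul1mx mulmx1 -scalemxAl -scalemxAr.
by rewrite mulmxBl mulmxBr gX (gV_comm gX).
Qed.

Fact capf_linear : scalar capf.
Proof.
move=> k Y Z; rewrite /capf.
have -> : vec_of (k *: Y + Z) = k *: vec_of Y + vec_of Z by apply/matrixP=> a b; rewrite !mxE.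
by rewrite mulmxDr -scalemxAr !mxE.
Qed.

HB.instance Definition _ := GRing.isLinear.Build C 'M[C]_m C *%R capf capf_linear.

Lemma op_cupcap Y : op cupcap Y = capf Y *: c0.
Proof.
rewrite /op cupcapE -mulmxA [cap *m _]mx11_scalar mul_mx_scalar linearZ /=.
by rewrite vec_ofK.
Qed.

(** Compare e X with X e for e = c0 cap: an eigenvalue on the vector c0 passes to the functional
    cap, because c0 is nonzero. *)
Lemma capf_op X k Y : g *m X = X *m g -> op X c0 = k *: c0 -> capf (op X Y) = k * capf Y.
Proof.
move=> gX X0; have := opM cupcap X Y; rewrite (cupcap_comm gX) opM !op_cupcap.
rewrite linearZ /= X0 scalerA => /eqP; rewrite -subr_eq0 -scalerBl scaler_eq0.
by rewrite (negbTE c0_neq0) orbF subr_eq0 mulrC => /eqP.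
Qed.

Lemma r_neq0 : r != 0.
Proof. by rewrite mulf_neq0 ?osp_sign_neq0 // expf_neq0 // qparam_neq0. Qed.

Lemma op_gV_c0 : op gV c0 = r *: c0.
Proof.
have := opM gV g c0; rewrite gV_g op1 g_c0 linearZ /= => e.
by rewrite [in RHS]e scalerA divff ?r_neq0 // scale1r.
Qed.

Lemma capf_c0 : capf c0 = x.
Proof.
have := op_cupcap c0; rewrite opBl opZl opBl op1 g_c0 op_gV_c0 -scalerBl scalerA -{1}[c0]scale1r.
rewrite -scalerBl => /eqP; rewrite -subr_eq0 -scalerBl scaler_eq0 (negbTE c0_neq0) orbF.
rewrite subr_eq0 => /eqP <-; rewrite /bwm_x; move: r r^-1 z => r1 r2 z1; ring.
Qed.

Lemma op_bH Y : op (bH *t bH) Y = bH *m Y *m bH.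
Proof. by rewrite op_tens tr_diag_mx. Qed.

Lemma op_bK i Y : op (bK i *t bK i) Y = bK i *m Y *m bK i.
Proof. by rewrite op_tens tr_diag_mx. Qed.

Lemma gH : g *m (bH *t bH) = (bH *t bH) *m g.
Proof. exact: comm_bH. Qed.

Lemma has_height_g h Y : has_height h Y -> has_height h (op g Y).
Proof. by rewrite /has_height -!op_bH -opM -gH opM => ->; rewrite linearZ. Qed.

Definition cupc (a : nat) : C := ent c0 a (2 * n - a).
Definition lval i (a : nat) : C := p ^ (- kexp n i a) * gsign i a.
Definition capc (a : nat) : C := capf (delta_mx (inord a) (inord (2 * n - a))).

Lemma c0_cupc : c0 = \sum_(a < m) cupc a *: delta_mx a (inord (2 * n - a)).
Proof.
apply/matrixP=> a b; rewrite summxE (bigD1 a) //= big1 ?addr0 => [|c ne_c]; last first.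
  by rewrite !mxE eq_sym (negbTE ne_c) mulr0.
rewrite !mxE eqxx /=; have le_a : (2 * n - a <= 2 * n)%N by lia.
case: eqVneq => [eb|ne_b].
  by rewrite mulr1 /cupc -ent_ord eb inordK.
rewrite mulr0; apply/eqP/negPn/negP => /c0_height/(height_opp n_gt0 (leq_ord a) (leq_ord b)) eb.
by case/eqP: ne_b; apply: val_inj; rewrite /= inordK // eb.
Qed.

Lemma capf_delta (a b : 'I_m) : b <> (2 * n - a)%N :> nat -> capf (delta_mx a b) = 0.
Proof.
move=> ne_b; have e : op (bH *t bH) c0 = 1 *: c0 by rewrite op_bH c0_h0 expr0z.
have := capf_op (delta_mx a b) gH e; rewrite op_bH diag_delta linearZ /= !mxE.
rewrite -expfzDr ?qparam_neq0 // => /eqP; rewrite -subr_eq0 -mulrBl mulf_eq0 subr_eq0.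
case/orP=> [/eqP|/eqP //]; rewrite -(expr0z p) => /(qparam_expz_inj q0 q_not_root).
by move/(height_opp n_gt0 (leq_ord a) (leq_ord b)).
Qed.

Lemma cupcS i a : (a < 2 * n)%N -> step n a = i -> cupc a = - (lval i a.+1 * cupc a.+1).
Proof.
move=> lt_a ei; have := congr1 (fun Z => ent Z a.+1 (2 * n - a)) (c0_vF i).
rewrite ent_vF ?leq_subr //=; have -> : (2 * n - a).-1 = ((2 * n).-1 - a)%N by lia.
rewrite step_rev // ei eqxx subn_gt0 lt_a /= !mulr1n.
have -> : ent (0 : 'M_m) a.+1 (2 * n - a) = 0 by rewrite /ent; case: ifP; rewrite ?mxE.
have -> : ((2 * n).-1 - a)%N = (2 * n - a.+1)%N by lia.
by move/eqP; rewrite addr_eq0 => /eqP.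
Qed.

Lemma capcS i a : (a < 2 * n)%N -> step n a = i -> capc a.+1 = - (lval i a * capc a).
Proof.
move=> lt_a ei; have e0 : op (vF i) c0 = 0 *: c0 by rewrite c0_vF scale0r.
have := capf_op (delta_mx (inord a) (inord (2 * n - a.+1))) (gF i) e0.
rewrite mul0r op_vF (@bF_delta i _ (inord a.+1)); last by rewrite !inordK //; lia.
rewrite inordK; last by lia.
rewrite ei eqxx mulr1n.
have -> : bL i *m delta_mx (inord a) (inord (2 * n - a.+1)) *m (bF i)^T =
    lval i a *: delta_mx (inord a) (inord (2 * n - a)).
  have -> : bL i *m delta_mx (inord a) (inord (2 * n - a.+1)) =
      lval i a *: delta_mx (inord a) (inord (2 * n - a.+1)) :> 'M_m.
    apply/matrixP=> b d; rewrite mul_diag_mx !mxE.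
    by case: eqVneq => [->|_]; rewrite ?mulr0 // inordK //; lia.
  rewrite -scalemxAl -[X in X *m _]trmxK -trmx_mul trmx_delta; congr (_ *: _).
  rewrite (@bF_delta i _ (inord (2 * n - a))); last by rewrite !inordK //; lia.
  rewrite inordK; last by lia.
  have -> : (2 * n - a.+1 = (2 * n).-1 - a)%N by lia.
  by rewrite step_rev // ei eqxx mulr1n trmx_delta.
rewrite linearD linearZ /= => /eqP; rewrite addr_eq0 => /eqP e.
by rewrite /capc e.
Qed.

Lemma lval_neq0 i a : lval i a != 0.
Proof.
rewrite mulf_neq0 ?expfz_neq0 ?qparam_neq0 //.
by apply/eqP=> g0; have := gsign2 i a; rewrite g0 mul0r => /eqP; rewrite eq_sym oner_eq0.
Qed.

Lemma mval_neq0 a : mval a != 0.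
Proof.
rewrite mulf_neq0 ?expfz_neq0 ?qparam_neq0 //.
by apply/eqP=> g0; have := wsign2 a; rewrite g0 mul0r => /eqP; rewrite eq_sym oner_eq0.
Qed.

Lemma mval_step i a : (a < 2 * n)%N -> step n a = i ->
  mval a * lval i a = mval a.+1 * lval i a.+1.
Proof.
move=> lt_a ei; have E b : mval b * lval i b = wsign b * gsign i b * p ^ (height n b - kexp n i b).
  by rewrite expfzDr ?qparam_neq0 // /mval /lval; ring.
rewrite !E (wsign_step lt_a ei); congr (_ * p ^ _).
by have := height_step n_gt0 lt_a; rewrite ei; lia.
Qed.

(** The relations f_i c0 = 0 and cap f_i = 0 give recursions for the two coefficients, so their
    product is proportional to [mval] by [mval_step]. Summing over a gives x on both sides, and x is
    nonzero, so the constant is 1. *)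
Lemma capc_cupc a : (a <= 2 * n)%N -> capc a * cupc a = mval a.
Proof.
suff E b : (b <= 2 * n)%N -> capc b * cupc b * mval 0 = capc 0 * cupc 0 * mval b.
  have BC0 : capc 0 * cupc 0 = mval 0.
    have xE : x = \sum_(b < m) cupc b * capc b.
      rewrite -capf_c0 {1}c0_cupc linear_sum; apply: eq_bigr => b _.
      by rewrite linearZ /= /capc inord_val.
    apply: (mulIf bwm_x_neq0); rewrite -{1}sum_mval xE !mulr_sumr; apply: eq_bigr => b _.
    rewrite -E ?leq_ord //; ring.
  by move=> le_a; apply: (mulIf (mval_neq0 0)); rewrite E // BC0 mulrC.
elim: b => // b IHb lt_b; have lt_s := step_lt n_gt0 lt_b.
pose i := Ordinal lt_s; have ei : step n b = i by [].
apply: (mulIf (lval_neq0 i b.+1)); rewrite -[RHS]mulrA -(mval_step lt_b ei) [RHS]mulrA.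
rewrite -(IHb (ltnW lt_b)).
rewrite (capcS lt_b ei) (cupcS lt_b ei).
move: (capc b) (cupc b.+1) (mval 0) (lval i b) (lval i b.+1) => ? ? ? ? ?; ring.
Qed.

Lemma capf_mul_c0 Y : capf (Y *m c0) = \tr (bM *m Y).
Proof.
have Yd (a b : 'I_m) : Y *m delta_mx a b = \sum_k Y k a *: delta_mx k b.
  apply/matrixP=> c d; rewrite mxE (bigD1 a) //= big1 => [|k ne_k]; last first.
    by rewrite mxE (negbTE ne_k) mulr0.
  rewrite summxE (bigD1 c) //= big1 => [|k ne_k]; last first.
    by rewrite !mxE eq_sym (negbTE ne_k) mulr0.
  by rewrite !mxE !eqxx.
rewrite c0_cupc mulmx_sumr linear_sum /mxtrace; apply: eq_bigr => a _ /=.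
rewrite -scalemxAr linearZ /= Yd linear_sum (bigD1 a) //= big1 ?addr0 => [|k ne_k].
  rewrite linearZ /= /bM mul_diag_mx !mxE -capc_cupc ?leq_ord // /capc inord_val; ring.
rewrite linearZ /= capf_delta ?mulr0 // inordK; last by rewrite ltnS leq_subr.
by have := leq_ord a; have := leq_ord k; move: ne_k; rewrite -val_eqE /=; lia.
Qed.

Lemma cupcap_sandwich Y : cupcap *m (Y *t 1) *m cupcap = \tr (bM *m Y) *: cupcap.
Proof.
apply: op_inj => a b; rewrite !opM opZl !op_cupcap linearZ /= linearZ /=.
by rewrite op_tens trmx1 mulmx1 capf_mul_c0 scalerA mulrC.
Qed.

Lemma cupcap_g : cupcap *m g = r^-1 *: cupcap.
Proof.
rewrite cupcap_comm //; apply: op_inj => a b.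
by rewrite opM opZl op_cupcap linearZ /= g_c0 !scalerA mulrC.
Qed.

Lemma bJi_delta i (a b : 'I_m) : bJi i *m delta_mx a b = gsign i a *: delta_mx a b.
Proof.
apply/matrixP=> c d; rewrite mul_diag_mx !mxE.
by case: eqVneq => [->|_]; rewrite ?mulr0.
Qed.

Lemma delta_bE i (a a' b : 'I_m) : a' = a.+1 :> nat ->
  delta_mx b a' *m (bE i)^T = (eta a *+ (step n a == i)) *: delta_mx b a.
Proof.
move=> ea; rewrite -[LHS]trmxK trmx_mul trmxK trmx_delta (bE_delta i b ea).
by rewrite linearZ /= trmx_delta.
Qed.

Lemma delta_bE0 i (b : 'I_m) : delta_mx b 0 *m (bE i)^T = 0.
Proof. by rewrite -[LHS]trmxK trmx_mul trmxK trmx_delta bE_delta0 trmx0. Qed.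

Lemma op_vE_top i (a a' : 'I_m) : a' = a.+1 :> nat ->
  op (vE i) (delta_mx 0 a') = (gsign i 0 * (eta a *+ (step n a == i))) *: delta_mx 0 a.
Proof.
move=> ea; rewrite op_vE bE_delta0 mul0mx add0r bJi_delta -scalemxAl (delta_bE i 0 ea).
by rewrite scalerA.
Qed.

Lemma op_vE_top0 i : op (vE i) (delta_mx 0 0) = 0.
Proof. by rewrite op_vE bE_delta0 mul0mx add0r -mulmxA delta_bE0 mulmx0. Qed.

Lemma op_vE_bot i (a a' : 'I_m) : a' = a.+1 :> nat ->
  op (vE i) (delta_mx a' 0) = ((eta a *+ (step n a == i)) * p ^ kexp n i 0) *: delta_mx a 0.
Proof.
move=> ea; rewrite op_vE (bE_delta i 0 ea) -(mulmxA (bJi i)).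
rewrite delta_bE0 mulmx0 addr0 -scalemxAl -scalerA; congr (_ *: _).
apply/matrixP=> b d; rewrite mul_mx_diag !mxE.
by case: (eqVneq d 0) => [->|_]; rewrite ?andbF ?mul0r ?mulr0 // mulrC.
Qed.

(* The defect of the formula g (u_0 (x) u_a) = tau_a u_a (x) u_0. *)
Definition top_defect (a : 'I_m) := op g (delta_mx 0 a) - tau a *: delta_mx a 0.

Lemma top_defect_height (a : 'I_m) : has_height (height n a + height n 0) (top_defect a).
Proof.
have D (b d : 'I_m) : has_height (height n b + height n d) (delta_mx b d).
  by rewrite /has_height /bH diag_delta !mxE expfzDr ?qparam_neq0.
rewrite /has_height /top_defect mulmxBr mulmxBl scalerBr -scalemxAr -scalemxAl.
have e := has_height_g (D 0 a); rewrite addrC in e.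
by rewrite (D a 0) e !scalerA [tau a * _]mulrC.
Qed.

Lemma top_defect_hw (a : 'I_m) : (forall b : 'I_m, a = b.+1 :> nat -> top_defect b = 0) ->
  hw_vec (top_defect a).
Proof.
move=> IH i; rewrite linearB linearZ /= -opM -gE opM.
have [a0|a_gt0] := posnP a.
  have -> : a = 0 by apply: val_inj.
  by rewrite op_vE_top0 linear0 scaler0 subrr.
have lt_b : (a.-1 < m)%N by apply: leq_ltn_trans (leq_pred _) (ltn_ord a).
pose b := Ordinal lt_b; have eb : a = b.+1 :> nat by rewrite /= prednK.
rewrite (op_vE_top i eb) (op_vE_bot i eb) linearZ /=.
have /eqP := IH b eb; rewrite subr_eq0 => /eqP->; rewrite !scalerA -scalerBl.
have [ei|_] := eqVneq (step n b) i; last by rewrite !mulr0n !(mulr0, mul0r) subrr scale0r.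
have lt_b2 : (b < 2 * n)%N by have := ltn_ord a; rewrite eb.
have := gsign_tau lt_b2 ei; rewrite -eb mulr1n => e.
rewrite mulrAC e; apply/eqP; rewrite scaler_eq0; apply/orP; left; apply/eqP; ring.
Qed.

Lemma op_g_00 : op g (delta_mx 0 0) = p *: delta_mx 0 0.
Proof.
have c2E : c2 = c2 0 0 *: delta_mx 0 0.
  apply/matrixP=> a b; rewrite !mxE; case: eqVneq => [ea|ne_a] /=.
    case: eqVneq => [->|ne_b]; first by rewrite ea mulr1.
    rewrite mulr0 -ent_ord; apply: (hw_support (leq0n _) c2_hw c2_h).
    by rewrite ea eqxx /= lt0n; apply: contra ne_b => /eqP e; apply/eqP/val_inj.
  rewrite mulr0 -ent_ord; apply: (hw_support (leq0n _) c2_hw c2_h).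
  by rewrite lt0n orbC; apply/orP; right; apply: contra ne_a => /eqP e; apply/eqP/val_inj.
have c20 : c2 0 0 != 0.
  by apply: contra c2_neq0 => /eqP e; rewrite c2E e scale0r.
have := g_c2; rewrite c2E linearZ /= scalerA mulrC -scalerA => e.
by apply: (scalerI c20).
Qed.

(** In the span of u_0 (x) u_1 and u_1 (x) u_0, g has the eigenvectors cm, for -1/p, and f_1 (u_0
    (x) u_0), for p. Solving for g (u_0 (x) u_1) requires p + 1/p to be nonzero. *)
Lemma op_g_01 : top_defect (inord 1) = 0.
Proof.
have lt1 : (1 < m)%N by lia.
pose o1 : 'I_m := Ordinal lt1; have -> : inord 1 = o1 by apply: val_inj; rewrite /= inordK.
have lt0 : (0 < 2 * n)%N by lia.
pose i0 := Ordinal n_gt0; have s0 : step n 0 = i0 by rewrite /step n_gt0.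
have k0 : kexp n i0 0 = 1 by rewrite kexp0.
set w := gsign i0 0.
have w2 : w * w = 1 := gsign2 i0 0.
have p0 := qparam_neq0 A q0.
pose v : 'M[C]_m := delta_mx o1 0 - (p * w) *: delta_mx 0 o1.
have cmE : cm = cm o1 0 *: v.
  have le1 : (1 <= 2 * n)%N by lia.
  have E10 := hw_eq i0 cm_hw (leq0n _) (leq0n _).
  rewrite s0 eqxx !mulr1n k0 expr1z -/w in E10.
  have e01 : cm 0 o1 = - (p * w) * cm o1 0.
    apply: (mulfI (eta_neq0 lt0)); apply: (mulfI (_ : w != 0)).
      by apply/eqP=> w0; move: w2; rewrite w0 mul0r => /eqP; rewrite eq_sym oner_eq0.
    have [e1 e2] : cm 0 o1 = ent cm 0 1 /\ cm o1 0 = ent cm 1 0 by rewrite -!ent_ord.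
    rewrite e1 e2; move/eqP: E10; rewrite addrC addr_eq0 => /eqP->.
    rewrite -[LHS]mul1r -w2; ring.
  apply/matrixP=> a b; rewrite /v !mxE.
  have [ea|ne_a1] /= := eqVneq a o1.
    rewrite ea; have -> : (o1 == 0) = false by [].
    rewrite /= mulr0 subr0; case: eqVneq => [->|ne_b]; first by rewrite mulr1.
    rewrite mulr0 -ent_ord; apply: (hw_support le1 cm_hw cm_h).
    by rewrite /= lt0n; apply: contra ne_b => /eqP e; apply/eqP/val_inj.
  rewrite sub0r; have [ea|ne_a0] /= := eqVneq a 0.
    rewrite ea; have [->|ne_b] := eqVneq b o1; first by rewrite e01 /= mulr1 mulrN mulNr mulrC.
    rewrite mulr0 oppr0 mulr0 -ent_ord; apply/eqP/negPn/negP => cab.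
    have := has_heightP cm_h cab; rewrite addrC => /addIr.
    move/(height_inj n_gt0 (leq_ord b) le1) => eb; case/eqP: ne_b.
    by apply: val_inj.
  rewrite mulr0 oppr0 mulr0 -ent_ord; apply: (hw_support le1 cm_hw cm_h).
  apply/orP; left; move: ne_a1 ne_a0; rewrite -!val_eqE /=; lia.
have c10 : cm o1 0 != 0.
  by apply: contra cm_neq0 => /eqP e; rewrite cmE e scale0r.
have e1 : op g (delta_mx o1 0) - (p * w) *: op g (delta_mx 0 o1) =
    - p^-1 *: v.
  rewrite -linearZ -linearB -/v; apply: (scalerI c10).
  by rewrite -linearZ /= -cmE g_cm [in LHS]cmE !scalerA mulrC.
have vF00 : op (vF i0) (delta_mx 0 0) = delta_mx o1 0 + (p^-1 * w) *: delta_mx 0 o1.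
  rewrite op_vF (@bF_delta i0 0 o1) // s0 eqxx mulr1n; congr (_ + _).
  have -> : bL i0 *m delta_mx 0 0 = (p^-1 * w) *: delta_mx 0 0 :> 'M_m.
    apply/matrixP=> a b; rewrite mul_diag_mx !mxE.
    case: eqVneq => [->|_]; rewrite ?mulr0 //= k0.
    by rewrite exprN1 -/w.
  rewrite -scalemxAl -[X in X *m _]trmxK -trmx_mul trmx_delta (@bF_delta i0 0 o1) //.
  by rewrite s0 eqxx mulr1n trmx_delta.
have e2 : op g (delta_mx o1 0) + (p^-1 * w) *: op g (delta_mx 0 o1) =
    p *: (delta_mx o1 0 + (p^-1 * w) *: delta_mx 0 o1).
  have := congr1 (fun X => op X (delta_mx 0 0)) (gF i0); rewrite !opM op_g_00 vF00 => e.
  by move: e; rewrite linearD linearZ linearZ /= vF00.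
have tau1 : tau o1 = w.
  have := gsign_tau lt0 s0; rewrite k0 expr1z -/w /tau /=.
  have -> : (1%N == 2 * n)%N = false by lia.
  have -> : (0%N == 2 * n)%N = false by lia.
  rewrite expr1z expr0z mulr1 => e; apply: (mulIf p0); rewrite -e.
  have w0 : wsign 0 = sg by rewrite /wsign ltn_eqF.
  by rewrite w0 mulrAC osp_sign2 mul1r mulrC.
have w0 : w != 0 by apply/eqP=> w0; move: w2; rewrite w0 mul0r => /eqP; rewrite eq_sym oner_eq0.
have k1 : p^-1 * w + p * w != 0.
  by rewrite -mulrDl mulf_neq0 // addrC qparam_add_inv.
apply: (scalerI k1); rewrite scaler0 /top_defect tau1 scalerBr scalerDl.
have -> : (p^-1 * w) *: op g (delta_mx 0 o1) + (p * w) *: op g (delta_mx 0 o1) =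
   (op g (delta_mx o1 0) + (p^-1 * w) *: op g (delta_mx 0 o1)) -
   (op g (delta_mx o1 0) - (p * w) *: op g (delta_mx 0 o1)).
  by rewrite opprB [X in _ = X + _]addrC addrACA subrr addr0.
rewrite e2 e1 /v; apply/matrixP=> a b; rewrite !mxE.
move: (_%:R) (_%:R) => u2 u1.
have pV : p^-1 * p = 1 by rewrite mulVf.
transitivity (p * u1 + p^-1 * u1 + (p * p^-1 - p^-1 * p) * w * u2 - (p^-1 + p) * (w * w) * u1).
  ring.
rewrite w2 pV mulfV // ; ring.
Qed.

Lemma wsign0 : wsign 0 = sg.
Proof. by rewrite /wsign ltn_eqF. Qed.

Lemma wsign_last : wsign (2 * n) = sg.
Proof. by rewrite /wsign; case: eqP => //; lia. Qed.

Lemma lvalE i a : (a < 2 * n)%N -> step n a = i ->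
  lval i a = p ^ (- (a != n)%:Z) * (if a == n.-1 then sg else 1).
Proof.
move=> lt_a ei; rewrite /lval -ei (kexp_step n_gt0 lt_a); congr (_ * _).
rewrite /gsign /gen_odd -ei /wsign.
have [->|ne1] := eqVneq a n.-1.
  have -> : (n.-1 == n) = false by lia.
  rewrite /step ltn_predL n_gt0 prednK // eqxx andbT /osp_sign.
  by case: (is_osp A).
case: ifP => // /andP[_]; rewrite /step; case: ltnP => [lt_an|le_na] /eqP e; first lia.
by have -> : a == n by lia.
Qed.

Lemma capcE a : (a <= 2 * n)%N ->
  capc a = (-1) ^+ a * p ^ (- (a - (n < a)%N)%N%:Z) * (if (n <= a)%N then sg else 1) * capc 0.
Proof.
elim: a => [_|a IHa lt_a].
  by rewrite expr0 /= subn0 oppr0 expr0z leqNgt n_gt0 !mul1r.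
have lt_s := step_lt n_gt0 lt_a.
pose i := Ordinal lt_s; have ei : step n a = i by [].
rewrite (capcS lt_a ei) (lvalE lt_a ei) (IHa (ltnW lt_a)).
have -> : - (a.+1 - (n < a.+1)%N)%N%:Z = - (a != n)%:Z - (a - (n < a)%N)%N%:Z by lia.
rewrite expfzDr ?qparam_neq0 // exprS.
have -> : (if (n <= a.+1)%N then sg else 1) =
    (if a == n.-1 then sg else 1) * (if (n <= a)%N then sg else 1).
  case: eqVneq => [->|ne_a].
    by rewrite prednK // leqnn leqNgt ltn_predL n_gt0 mulr1.
  by rewrite mul1r; have -> : (n <= a.+1)%N = (n <= a)%N by lia.
by move: (p ^ _) (p ^ _) (capc 0) (if _ then _ else _) (if _ then _ else _) => ? ? ? ? ?; ring.
Qed.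

(** The value cap must take for the formula at u_2n: cap g = r^-1 cap on u_0 (x) u_2n against tau_2n
    times cap on u_2n (x) u_0. *)
Lemma capc_last : tau (2 * n) * capc (2 * n) = r^-1 * capc 0.
Proof.
rewrite capcE // /tau wsign_last eqxx /= exprM sqrrN expr1n expr1n.
have -> : (2 * n == 0)%N = false by lia.
have -> : (n < 2 * n)%N by lia.
have -> : (n <= 2 * n)%N by lia.
rewrite sub0r exprN1 invfM osp_signV exprnN.
have -> : p ^ (- (2 * n - 1)%N%:Z) = p * p ^ (- (2 * n)%:Z).
  rewrite -[p in p * _]expr1z -expfzDr ?qparam_neq0 //; congr (_ ^ _); lia.
have pV : p^-1 * p = 1 by rewrite mulVf ?qparam_neq0.
move: (p ^ _) (capc 0) => u v.
transitivity ((sg * sg) * (p^-1 * p) * (sg * u * v)); first by ring.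
by rewrite osp_sign2 pV !mul1r.
Qed.

(** At weight zero the argument by absence of highest weight vectors fails, as c0 is one. The defect
    is thus k c0; cap kills the defect by [capc_last] but takes the value x on c0, so k = 0. *)
Lemma top_defect_last : (forall b : 'I_m, (b < 2 * n)%N -> top_defect b = 0) ->
  top_defect ord_max = 0.
Proof.
move=> IH; have Dhw : hw_vec (top_defect ord_max).
  by apply: top_defect_hw => b eb; apply: IH; move: eb => /=; lia.
have Dh := top_defect_height ord_max; set D := top_defect _ in Dhw Dh *.
have h0 : height n (ord_max : 'I_m) + height n 0 = 0.
  by have := height_rev n_gt0 (leqnn (2 * n)); rewrite subnn.
have k0 : ent c0 (2 * n) 0 != 0.
  apply: contra c0_neq0 => /eqP e; apply/eqP.
  apply: (@hw_eq0 _ (2 * n)) => //; have := c0_h0; rewrite -h0; exact.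
pose k := ent D (2 * n) 0 / ent c0 (2 * n) 0.
have entB Y Z c a b : ent (Y - c *: Z) a b = ent Y a b - c * ent Z a b.
  by rewrite /ent; case: ifP => _; rewrite ?mxE ?mulr0 ?subr0.
have D0 : D - k *: c0 = 0.
  apply: (@hw_eq0 _ (2 * n)) => //.
  - by move=> i; rewrite linearB linearZ /= Dhw c0_hw scaler0 subrr.
  - have := c0_h0; rewrite -h0 => c0h; rewrite /has_height mulmxBr mulmxBl.
    rewrite -scalemxAr -scalemxAl c0h scalerBr scalerA scalerA [in RHS]mulrC.
    by congr (_ - _); exact: Dh.
  by rewrite entB /k divfK // subrr.
have DE : D = k *: c0 by apply/eqP; rewrite -subr_eq0 D0.
suff k0' : k = 0 by rewrite DE k0' scale0r.
have cD : capf D = k * capf c0 by rewrite DE linearZ.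
apply: (mulIf bwm_x_neq0); rewrite mul0r -capf_c0 -cD /D /top_defect.
rewrite linearB linearZ /= (capf_op _ (erefl _) g_c0).
have := capc_last; rewrite /capc subn0 subnn.
have -> : inord 0 = 0 :> 'I_m by apply: val_inj; rewrite /= inordK.
have -> : inord (2 * n) = ord_max :> 'I_m by apply: val_inj; rewrite /= inordK.
by move=> ->; rewrite subrr.
Qed.

Lemma op_g_top (a : 'I_m) : op g (delta_mx 0 a) = tau a *: delta_mx a 0.
Proof.
suff : top_defect a = 0 by move/eqP; rewrite subr_eq0 => /eqP.
have E (b : 'I_m) : (b < 2 * n)%N -> top_defect b = 0.
  have [d] := ubnP (b : nat); elim: d b => // d IHd b; rewrite ltnS => le_bd lt_b.
  case: (ltngtP b 1) => [b0|b_gt1|b1].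
  - have -> : b = 0 by apply: val_inj; move: b0; rewrite /=; lia.
    rewrite /top_defect op_g_00 /tau wsign0 /=.
    have -> : (0 == 2 * n)%N = false by lia.
    by rewrite subr0 expr1z mulrAC osp_sign2 mul1r subrr.
  - apply: (@hw_col0 _ b); rewrite ?b_gt1 //; last exact: top_defect_height.
    by apply: top_defect_hw => c ec; apply: IHd; lia.
  by rewrite -op_g_01; congr top_defect; apply: val_inj; rewrite /= inordK ?b1 //; lia.
case: (ltngtP a (2 * n)) (leq_ord a) => // [lt_a _|ea _]; first exact: E.
have -> : a = ord_max by apply: val_inj.
exact: top_defect_last.
Qed.

Lemma g_top : g *m ((delta_mx 0 0 : 'M[C]_m) *t (1 : 'M[C]_m)) =
  \sum_(b < m) (bT *m delta_mx b 0) *t (delta_mx 0 b : 'M[C]_m).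
Proof.
apply: op_inj => c d; rewrite opM op_tens trmx1 mulmx1.
have op0 : op (0 : 'M[C]_(m * m)) (delta_mx c d) = 0 by rewrite /op mul0mx linear0.
rewrite (big_morph (fun X : 'M[C]_(m * m) => op X (delta_mx c d)) (fun X X' => opDl X X' _) op0).
have [->|ne_c] := eqVneq c 0; last first.
  rewrite mul_delta_mx_0 1?eq_sym // linear0 big1 // => b _.
  by rewrite op_tens -!mulmxA (mulmxA (delta_mx b 0)) mul_delta_mx_0 1?eq_sym // mul0mx mulmx0.
rewrite mul_delta_mx op_g_top (bigD1 d) //= big1 ?addr0 => [|b ne_b].
  rewrite op_tens trmx_delta -!mulmxA !mul_delta_mx.
  apply/matrixP=> a b; rewrite /bT mul_diag_mx !mxE.
  by case: eqVneq => [->|_]; rewrite ?mulr0.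
by rewrite op_tens trmx_delta -!mulmxA [X in _ *m (_ *m X)]mul_delta_mx_0 ?mulmx0 // eq_sym.
Qed.

Lemma bTE_comm : (bT *t bT) *m g = g *m (bT *t bT).
Proof. by rewrite comm_bT. Qed.

Lemma ptrace_bM X (a b : 'I_m) :
  ptrace bM X a b = \sum_k X (mxtens_index (a, k)) (mxtens_index (b, k)) * mval k.
Proof.
rewrite mxE; apply: eq_bigr => k _; rewrite (bigD1 k) //= big1 ?addr0 => [|l ne_l].
  by rewrite !mxE eqxx.
by rewrite !mxE (negbTE ne_l) mulr0.
Qed.

Lemma ptrace_mull (N B : 'M[C]_m) X : ptrace N ((B *t 1) *m X) = B *m ptrace N X.
Proof.
elim/tens_ind: X => [|c X Y eX eY|D E]; first by rewrite mulmx0 ptrace0 mulmx0.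
  by rewrite mulmxDr -scalemxAr !ptrace_lin eX eY mulmxDr -scalemxAr.
by rewrite tensmx_mul mul1mx !ptrace_tens scalemxAr.
Qed.

Lemma ptrace_mulr (N B : 'M[C]_m) X : ptrace N (X *m (B *t 1)) = ptrace N X *m B.
Proof.
elim/tens_ind: X => [|c X Y eX eY|D E]; first by rewrite mul0mx ptrace0 mul0mx.
  by rewrite mulmxDl -scalemxAl !ptrace_lin eX eY mulmxDl -scalemxAl.
by rewrite tensmx_mul mulmx1 !ptrace_tens scalemxAl.
Qed.

Lemma ptrace_mid (N B D : 'M[C]_m) X :
  ptrace N ((1 *t B) *m X *m (1 *t D)) = ptrace (D *m N *m B) X.
Proof.
elim/tens_ind: X => [|c X Y eX eY|E F]; first by rewrite mulmx0 mul0mx !ptrace0.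
  by rewrite mulmxDr mulmxDl -scalemxAr -scalemxAl !ptrace_lin eX eY.
rewrite !tensmx_mul mul1mx mulmx1 !ptrace_tens; congr (_ *: _).
by rewrite -!mulmxE !mulmxA mxtrace_mulC !mulmxA.
Qed.

(** * Partial quantum traces of intertwiners are scalars *)

Section PtraceScalar.
Variable X : 'M[C]_(m * m).
Hypothesis XF : forall i, X *m vF i = vF i *m X.
Hypothesis XK : forall i, X *m (bK i *t bK i) = (bK i *t bK i) *m X.
Hypothesis XJ : X *m (bJ *t bJ) = (bJ *t bJ) *m X.

Lemma comm_bL i : X *m (bL i *t bL i) = (bL i *t bL i) *m X.
Proof.
apply/comm_diagP=> a b c e; rewrite !mxE.
have [->|X0] := eqVneq (X (mxtens_index (a, b)) (mxtens_index (c, e))) 0; first by rewrite !mul0r.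
congr (_ * _); rewrite mulrACA [RHS]mulrACA -!expfzDr ?qparam_neq0 // -!opprD (comm_kexp XK X0).
congr (_ * _); rewrite /gsign; case: ifP => // _.
by rewrite (comm_bJ_entry XJ X0).
Qed.

Lemma ptrace_bF i : ptrace bM X *m bF i = bF i *m ptrace bM X.
Proof.
pose LV : 'M[C]_m := diag_mx (\row_a (p ^ kexp n i a * gsign i a)).
have LVL : bL i *m LV = 1%:M.
  apply/matrixP=> a b; rewrite /bL mul_diag_mx !mxE.
  case: eqP => [->|_]; rewrite ?mulr0n ?mulr0 // !mulr1n mulrACA gsign2 mulr1.
  by rewrite -expfzDr ?qparam_neq0 // addNr.
(* The twisted cyclicity that equates the partial traces of X (L (x) F) and (L (x) F) X. It holds
   since the product of the diagonals of M and L agrees at a and a + 1 along the root i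
   ([mval_step]). *)
have FML : LV *m bF i *m bM *m bL i = bM *m bF i.
  have -> : LV *m bF i *m bM *m bL i = LV *m (bF i *m bM *m bL i) by rewrite !mulmxA.
  have -> : bF i *m bM *m bL i = bL i *m (bM *m bF i).
    apply/matrixP=> a b; rewrite /bL /bM !(mul_diag_mx, mul_mx_diag) !mxE.
    case: eqVneq => [ea|_] /=; last by rewrite !(mulr0, mul0r).
    case: eqVneq => [eb|_] /=; last by rewrite !(mulr0, mul0r).
    have lt_b : (b < 2 * n)%N by have := ltn_ord a; rewrite ea.
    by have := mval_step lt_b eb; rewrite /lval ea mulr1 mul1r => ->; rewrite mulrC.
  by rewrite mulmxA diag_mxC LVL mul1mx.
have := congr1 (ptrace bM) (XF i).
have pD (Z Z' : 'M[C]_(m * m)) : ptrace bM (Z + Z') = ptrace bM Z + ptrace bM Z'.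
  by rewrite -[Z]scale1r ptrace_lin !scale1r.
rewrite mulmxDr mulmxDl !pD.
rewrite ptrace_mulr ptrace_mull.
have -> : X *m (bL i *t bF i) = (bL i *t 1) *m ((1 *t bL i) *m X *m (1 *t (LV *m bF i))).
  have -> : bL i *t bF i = (bL i *t bL i) *m (1 *t (LV *m bF i)).
    by rewrite tensmx_mul mulmx1 mulmxA LVL mul1mx.
  by rewrite [LHS]mulmxA comm_bL !mulmxA tensmx_mul mulmx1 mul1mx.
have -> : (bL i *t bF i) *m X = (bL i *t 1) *m ((1 *t bF i) *m X *m (1 *t 1)).
  by rewrite -(tens1 C m) mulmx1 mulmxA tensmx_mul mulmx1 mul1mx.
by rewrite !ptrace_mull !ptrace_mid FML mul1mx => /addIr.
Qed.

Lemma ptrace_scalar : ptrace bM X = (ptrace bM X 0 0)%:M.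
Proof.
have diag_eq (a : 'I_m) : ptrace bM X a a = ptrace bM X 0 0.
  move: (ptrace bM X) ptrace_bF => P PF.
  case: a => a; elim: a => [|a IHa] lt_a; first by congr (P _ _); apply: val_inj.
  rewrite -(IHa (ltnW lt_a)); set b := Ordinal (ltnW lt_a); set a' := Ordinal lt_a.
  have lt_s := step_lt n_gt0 (lt_a : (a < 2 * n)%N); pose i := Ordinal lt_s.
  have := congr1 (fun Z : 'M_m => Z a' b) (PF i).
  rewrite [(P *m _) _ _]mxE [(_ *m P) _ _]mxE (bigD1 a') //= big1 => [|k ne_k]; last first.
    rewrite mxE /=; case: eqVneq => [ek|_]; last by rewrite mulr0.
    by case/eqP: ne_k; apply: val_inj.
  rewrite (bigD1 b) //= [X in _ = _ + X]big1 => [|k ne_k]; last first.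
    rewrite mxE /= eqSS; case: eqVneq => [ek|_]; last by rewrite mul0r.
    by case/eqP: ne_k; apply: val_inj.
  by rewrite !addr0 mxE /= !eqxx mulr1 mul1r.
apply/matrixP=> a b; rewrite [RHS]mxE; case: eqVneq => [->|ne_ab]; first by rewrite mulr1n diag_eq.
rewrite mulr0n ptrace_bM big1 // => k _; apply/eqP; rewrite mulf_eq0; apply/orP; left.
apply/negPn/negP => /(comm_height XK)/addIr/(height_inj n_gt0 (leq_ord a) (leq_ord b)) eab.
by case/eqP: ne_ab; apply: val_inj.
Qed.

End PtraceScalar.

Lemma ptrace_g : ptrace bM g = r%:M.
Proof.
rewrite (ptrace_scalar gF gK gJ) ptrace_bM (bigD1 0) //= big1 => [|k ne_k]; last first.
  by rewrite -op_delta op_g_top scalemx_ent mxE eq_sym (negbTE ne_k) mulr0 mul0r.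
rewrite -op_delta op_g_00 scalemx_ent mxE !eqxx mulr1 addr0 /mval wsign0 mulrCA; congr (_ * _)%:M.
have -> : height n 0 = (2 * n)%:Z - 1 by rewrite /height n_gt0 subn0; lia.
by rewrite expfzDr ?qparam_neq0 // exprN1 mulrCA mulfV ?qparam_neq0 // mulr1.
Qed.

Lemma ptrace_cupcap : ptrace bM cupcap = 1%:M.
Proof.
rewrite ptrace_scalar.
- rewrite ptrace_bM (bigD1 ord_max) //= big1 => [|k ne_k]; last first.
    rewrite -op_delta op_cupcap scalemx_ent capf_delta ?mul0r // subn0 => e.
    by case/eqP: ne_k; apply: val_inj.
  rewrite -op_delta op_cupcap scalemx_ent addr0.
  have := capc_cupc (leq0n _); rewrite /capc /cupc subn0 /ent /= leqnn /=.
  have -> : inord 0 = 0 :> 'I_m by apply: val_inj; rewrite /= inordK.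
  have -> : inord (2 * n) = ord_max :> 'I_m by apply: val_inj; rewrite /= inordK.
  move=> ->; congr (_%:M); rewrite /mval wsign0 wsign_last mulrACA osp_sign2 mul1r.
  have h0 := height_rev n_gt0 (leqnn (2 * n)); rewrite subnn in h0.
  by rewrite -expfzDr ?qparam_neq0 // addrC h0.
- by move=> i; rewrite cupcap_comm.
- by move=> i; rewrite cupcap_comm.
exact: cupcap_comm.
Qed.

(** Taken from g^-1 = g - z (1 - e), with partial traces r for g, x for 1 and 1 for e, since
    [op_g_top] describes g and not its inverse. *)
Lemma ptrace_gV : ptrace bM gV = (r^-1)%:M.
Proof.
have z0 : z != 0 := qparam_sub_inv A q0 q_not_root.
have gVE : gV = (-z) *: (1 *t 1) + (z *: cupcap + g).
  rewrite -(tens1 C m) /cupcap scalerBr scalerA divff // scale1r.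
  by rewrite addrA scaleNr [_ + (_ - _)]addrA addNr add0r opprB subrK.
have e1 := ptrace_lin bM (-z) (1 *t 1) (z *: cupcap + g).
have e2 := ptrace_lin bM z cupcap g.
rewrite gVE e1 e2 ptrace_g ptrace_cupcap ptrace_tens mulr1 trace_bM {e1 e2 gVE}.
apply/matrixP=> a b; rewrite !mxE; case: (a == b); rewrite ?mulr0n ?mulr0 ?addr0 //.
rewrite !mulr1n /bwm_x !mulr1; move: r (r^-1) z z0 => r1 r2 z1 z10; field.
exact: z10.
Qed.

Lemma vector_braid f (i j : 'I_f.-1) : j = i.+1 :> nat ->
  local_op g i * local_op g j * local_op g i = local_op g j * local_op g i * local_op g j.
Proof.
move=> eij; have top : g * ((delta_mx 0 0 : 'M[C]_m) *t (1 : 'M[C]_m)) =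
    \sum_(b < m) (bT * delta_mx b 0) *t (delta_mx 0 b : 'M[C]_m) := g_top.
apply: (local_op_braid eij bTE_comm top (F := bF) (L := bL)).
- exact: gF.
- by move=> i'; apply: (comm_bL gK gJ).
- move=> k b; exists (lval k b); apply/matrixP=> a d.
  rewrite -mulmxE /bL mul_diag_mx !mxE.
  by case: eqVneq => [->|_]; rewrite ?mulr0.
case=> [[|a]] lt_a ne_a; first by case/eqP: ne_a; apply: val_inj.
have lt_s := step_lt n_gt0 (lt_a : (a < 2 * n)%N).
exists (Ordinal lt_s), (Ordinal (ltnW lt_a)); split; first by rewrite /= ltnSn.
by rewrite -mulmxE (@bF_delta (Ordinal lt_s) (Ordinal (ltnW lt_a)) (Ordinal lt_a)) //= eqxx.
Qed.

Lemma vector_kauffman f (b : braid_word f) : (1 < f)%N ->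
  kauffman r p b = x ^+ f.-1 * r ^ (- exponent_sum b) *
    (\tr (tens_power f bM * braid_eval (local_op g) (local_op gV) b) / x ^+ f).
Proof.
move=> f_gt1; apply: (@local_kauffman C r p f m ord0 g gV bM).
- exact: r_neq0.
- exact: (qparam_sub_inv A q0 q_not_root).
- exact: bwm_x_neq0.
- exact: f_gt1.
- exact: g_gV.
- exact: gV_g.
- exact: vector_braid.
- exact: cupcap_g.
- exact: trace_bM.
- exact: cupcap_sandwich.
- exact: ptrace_g.
- exact: ptrace_gV.
exact/esym/comm_bM.
Qed.

End VectorBasis.

(** * Structure of vector modules *)

Section WeightVectors.
Variable n : nat.
Hypothesis n_gt0 : (0 < n)%N.
Implicit Types (i j : 'I_n) (x y : weight n).

Definition vweight (a : nat) : weight n := \row_k wcoord n k a.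

Lemma wform_rootE i y : wform (wroot i) y =
  y 0 i - (if insub i.+1 is Some j then y 0 j else 0).
Proof.
have E (k : nat) : \sum_(l < n) (l == k :> nat)%:Z * y 0 l =
    if insub k is Some j then y 0 j else 0.
  case: insubP => [j _ <-|nk].
    rewrite (bigD1 j) //= eqxx mul1r big1 ?addr0 // => l ne_l.
    by rewrite val_eqE (negbTE ne_l) mul0r.
  rewrite big1 // => l _; case: eqP => [el|_]; last by rewrite mul0r.
  by rewrite -el ltn_ord in nk.
rewrite -(E i.+1); have <- : \sum_(l < n) (l == i :> nat)%:Z * y 0 l = y 0 i.
  by rewrite E valK.
by rewrite /wform -sumrB; apply: eq_bigr => l _; rewrite !mxE mulrBl.
Qed.

Lemma wform_vweight i a : wform (wroot i) (vweight a) = kexp n i a.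
Proof.
rewrite wform_rootE mxE /kexp; case: insubP => [j _ ej|]; first by rewrite mxE ej.
rewrite -leqNgt => le_n; congr (_ - _).
by have := ltn_ord i; rewrite /wcoord; lia.
Qed.

Lemma wformD i x y : wform (wroot i) (x + y) = wform (wroot i) x + wform (wroot i) y.
Proof. by rewrite -big_split; apply: eq_bigr => k _; rewrite /= [(x + y) 0 k]mxE mulrDr. Qed.

Lemma wformN i x : wform (wroot i) (- x) = - wform (wroot i) x.
Proof. by rewrite -sumrN; apply: eq_bigr => k _; rewrite [(- x) 0 k]mxE mulrN. Qed.

Lemma wform_root0 i : wform (wroot i) 0 = 0.
Proof. by rewrite /wform big1 // => k _; rewrite [(0 : weight n) 0 k]mxE mulr0. Qed.

Lemma vweight0 : vweight 0 = weps n 0.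
Proof. by apply/rowP=> k; rewrite !mxE /wcoord; have := ltn_ord k; lia. Qed.

Lemma wroot_step i a : (a < 2 * n)%N -> step n a = i -> wroot i = vweight a - vweight a.+1.
Proof.
move=> lt_a ei; apply/rowP=> k; rewrite !mxE (wcoord_diff (ltnW (ltn_ord k)) lt_a) ei.
by rewrite ltn_ord andbT.
Qed.

Lemma wform_roots i j a : (a < 2 * n)%N -> step n a = j ->
  wform (wroot i) (wroot j) = kexp n i a - kexp n i a.+1.
Proof. by move=> lt_a ej; rewrite (wroot_step lt_a ej) wformD wformN !wform_vweight. Qed.

Lemma mu_weightE : mu_weight n = vweight 0 + vweight 1.
Proof.
rewrite /mu_weight; case: ifP => [n2|n1]; apply/rowP=> k; rewrite !mxE /wcoord;
  have := ltn_ord k; lia.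
Qed.

Lemma sum_kexp_from (i a : nat) : (i <= n)%N -> \sum_(i <= l < n) kexp n l a = wcoord n i a.
Proof.
move=> le_i; rewrite -[LHS]opprK -sumrN.
under eq_bigr => l _ do rewrite opprB.
rewrite telescope_sumr // /wcoord; lia.
Qed.

(** The premise says that the weights a and b differ by alpha_i. Coordinate i then drops by 1, which
    forces a = i or b = 2n - i, and comparing heights fixes the other index. *)
Lemma step_of_kexp i a b : (a <= 2 * n)%N -> (b <= 2 * n)%N ->
  (forall k : 'I_n, kexp n k a - kexp n k b = kexp n k i - kexp n k i.+1) ->
  b = a.+1 /\ step n a = i.
Proof.
move=> le_a le_b eK; have lt_i := ltn_ord i.
have eH : height n a - height n b = height n i - height n i.+1.
  rewrite -!sum_two_rho_kexp //; try lia; rewrite -!sumrB.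
  by apply: eq_bigr => k _; rewrite -!mulrBr eK.
have eW : wcoord n i a - wcoord n i b = 1.
  rewrite -!(sum_kexp_from _ (ltnW lt_i)) -sumrB.
  rewrite (eq_big_nat _ _ (F2 := fun l => kexp n l i - kexp n l i.+1)) => [|l /andP[_ lt_l]].
    by rewrite sumrB !(sum_kexp_from _ (ltnW lt_i)) /wcoord; lia.
  exact: (eK (Ordinal lt_l)).
have [ea|eb] : a = i \/ b = (2 * n - i)%N by move: eW; rewrite /wcoord; lia.
  rewrite ea /step lt_i; split=> //; apply: (height_inj n_gt0) => //; first lia.
  by move: eH; rewrite ea; lia.
have ea : a = (2 * n - i.+1)%N.
  apply: (height_opp n_gt0) => //; first lia.
  have le_i : (i <= 2 * n)%N by lia.
  by have := height_rev n_gt0 le_i; rewrite -eb; lia.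
by rewrite ea eb /step; split; [lia | case: ltnP; lia].
Qed.

End WeightVectors.

Lemma eigenvectors_bound (C : fieldType) (m : nat) (K : 'M[C]_m) (a : nat -> C)
    (w : nat -> 'cV[C]_m) :
  injective a -> (forall k, K *m w k = a k *: w k) -> exists k, w k = 0.
Proof.
move=> a_inj Kw; apply: contrapT => /forallNP w0.
have rts : all (root (char_poly K^T)) [seq a k | k <- iota 0 m.+1].
  apply/allP=> _ /mapP[k _ ->]; rewrite -eigenvalue_root_char; apply/eigenvalueP.
  exists (w k)^T; first by rewrite -trmx_mul Kw linearZ.
  by rewrite -[0]trmx0; apply/eqP => /trmx_inj; apply: w0.
have u_rts : uniq [seq a k | k <- iota 0 m.+1] by rewrite map_inj_uniq ?iota_uniq.
have := max_poly_roots (monic_neq0 (char_poly_monic K^T)) rts u_rts.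
by rewrite size_char_poly size_map size_iota ltnn.
Qed.

(* With [h] = (p^h - p^-h) / (p - p^-1), E^k u is an eigenvector of K for the eigenvalue
   p^(1 + k d), and F E^(k+1) u = b (k+1) E^k u. *)
Lemma raising_neq0 (C : fieldType) (m d : nat) (E F K KV : 'M[C]_m) (p s : C)
    (b : nat -> C) (u : 'cV[C]_m) :
  p != 0 -> (0 < d)%N -> s * s = 1 -> (forall k, (0 < k)%N -> p ^+ k != 1) ->
  b 0%N = 0 -> (forall k, b k.+1 != 0) ->
  (forall k, s * b k.+1 = b k - (p - p^-1)^-1 * (p ^+ (k * d).+1 - p ^- (k * d).+1)) ->
  KV *m K = 1%:M -> K *m E = p ^+ d *: (E *m K) ->
  E *m F - s *: (F *m E) = (p - p^-1)^-1 *: (K - KV) ->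
  u != 0 -> K *m u = p *: u -> E *m (F *m u) != 0.
Proof.
move=> p0 d0 s2 p_nr b0 bS bE KVK KE EF u0 Ku; apply/eqP=> EFu.
(* If E F u were zero, no E^k u could vanish, as F maps each E^(k+1) u to a nonzero multiple of E^k
   u; K would have infinitely many eigenvalues. *)
pose w k : 'cV_m := iter k (fun y => E *m y) u.
have Kw k : K *m w k = p ^+ (k * d).+1 *: w k.
  elim: k => [|k IHk]; first by rewrite mul0n expr1.
  rewrite /w iterS -/(w k) mulmxA KE -scalemxAl -mulmxA IHk -scalemxAr scalerA -exprD.
  by rewrite mulSn addnS.
have KVw k : KV *m w k = p ^- (k * d).+1 *: w k.
  have e0 : p ^+ (k * d).+1 != 0 by rewrite expf_neq0.
  apply: (scalerI e0); rewrite scalerA divff // scale1r scalemxAr -Kw mulmxA KVK.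
  by rewrite mul1mx.
have FE y : F *m (E *m y) =
    s *: (E *m (F *m y) - (p - p^-1)^-1 *: (K *m y - KV *m y)).
  have <- : E *m (F *m y) - s *: (F *m (E *m y)) = (p - p^-1)^-1 *: (K *m y - KV *m y).
    by rewrite !mulmxA [s *: _]scalemxAl -mulmxBl EF -scalemxAl mulmxBl.
  by rewrite opprB addrC subrK scalerA s2 scale1r.
have Fw k : E *m (F *m w k) = b k *: w k -> F *m w k.+1 = b k.+1 *: w k.
  move=> EFw; rewrite /w iterS -/(w k) FE EFw Kw KVw -scalerBl scalerA -scalerBl scalerA.
  by rewrite -bE mulrA s2 mul1r.
have EFw k : E *m (F *m w k) = b k *: w k.
  by elim: k => [|k /Fw IHk]; rewrite ?EFu ?b0 ?scale0r // IHk -scalemxAr.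
have w0 k : w k != 0.
  elim: k => [//|k]; apply: contraNneq => wk0; have := Fw k (EFw k).
  by rewrite wk0 mulmx0 => /esym/eqP; rewrite scaler_eq0 (negbTE (bS k)).
have p_inj : injective (fun k => p ^+ (k * d).+1).
  have lt_neq k l : (k < l)%N -> p ^+ (k * d).+1 = p ^+ (l * d).+1 -> False.
    move=> lt_kl e; have kl : (0 < (l - k) * d)%N by rewrite muln_gt0 subn_gt0 lt_kl.
    case/eqP: (p_nr _ kl); apply: (mulfI (expf_neq0 (k * d).+1 p0)).
    by rewrite -exprD mulr1 e mulnBl addSn subnKC // leq_mul2r (ltnW lt_kl) orbT.
  by move=> k l e; case: (ltngtP k l) => // [/lt_neq/(_ e)|/lt_neq/(_ (esym e))].
by have [k /eqP] := eigenvectors_bound p_inj Kw; rewrite (negbTE (w0 k)).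
Qed.

Lemma eigenbasis_unitmx (C : fieldType) (m : nat) (K U : 'M[C]_m.+1) (d : 'rV[C]_m.+1) :
  injective (d 0) -> K *m U = U *m diag_mx d -> (forall a, col a U != 0) -> U \in unitmx.
Proof.
move=> d_inj KU U0; rewrite -unitmx_tr -row_free_unit; apply: inj_row_free => c cU.
(* P vanishes at every eigenvalue except d_a, so P (K) isolates column a in a vanishing combination
   of the columns. *)
apply/rowP=> a; rewrite mxE; pose P : {poly C} := \prod_(b | b != a) ('X - (d 0 b)%:P).
have PU (R : {poly C}) : horner_mx K R *m U = U *m diag_mx (map_mx (horner R) d).
  rewrite -horner_mx_diag; elim/poly_ind: R => [|R k IHR].
    by rewrite !rmorph0 mul0mx mulmx0.
  rewrite !rmorphD !rmorphM /= !horner_mx_X !horner_mx_C mulmxDl mulmxDr -!mulmxE.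
  by rewrite -mulmxA KU !mulmxA IHR mul_scalar_mx mul_mx_scalar.
have Pb b : P.[d 0 b] = if b == a then P.[d 0 a] else 0.
  case: eqVneq => [->//|ne_b]; rewrite horner_prod (bigD1 b) //=.
  by rewrite hornerXsubC subrr mul0r.
have Pa : P.[d 0 a] != 0.
  rewrite horner_prod; apply/prodf_neq0 => b ne_b.
  by rewrite hornerXsubC subr_eq0 (inj_eq d_inj) eq_sym.
have Uc : U *m c^T = 0 by rewrite -[U]trmxK -trmx_mul cU trmx0.
have e : U *m (diag_mx (map_mx (horner P) d) *m c^T) = 0.
  by rewrite mulmxA -PU -mulmxA Uc mulmx0.
have : (c 0 a * P.[d 0 a]) *: col a U = 0.
  rewrite -[RHS]e; apply/colP=> k; rewrite mul_diag_mx mxE [RHS]mxE (bigD1 a) //= big1 => [|b ne_b].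
    by rewrite !mxE addr0 [RHS]mulrC [P.[_] * _]mulrC.
  by rewrite !mxE Pb (negbTE ne_b) mul0r mulr0.
by move/eqP; rewrite scaler_eq0 (negbTE (U0 a)) orbF mulf_eq0 (negbTE Pa) orbF => /eqP.
Qed.

Section VectorModule.
Variables (C : fieldType) (n : nat) (A : qtype) (q : C).
Hypotheses (n_gt0 : (0 < n)%N) (q0 : q != 0).
Hypothesis q_not_root : forall k, (0 < k)%N -> q ^+ k != 1.
Local Notation p := (qparam A q).
Local Notation m := (2 * n).+1.
Local Notation sg := (osp_sign C A).
Variables (V : qops C n m) (v : 'cV[C]_m).
Hypotheses (HV : is_qmodule A q V) (v_hw : is_hwv A q V (weps n 0) v).
Hypothesis v_J : psign C (qpar V) true *m v = sg *: v.
Implicit Types (i j : 'I_n) (u : 'cV[C]_m).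
Local Notation E := (qE V).
Local Notation F := (qF V).
Local Notation K := (qK V).
Local Notation J := (psign C (qpar V) true).
Local Notation gsg i j := ((-1) ^+ (gen_odd A i && gen_odd A j) : C).

Lemma qKE_comm i j : K i *m E j = p ^ wform (wroot i) (wroot j) *: (E j *m K i).
Proof.
have := congr1 (fun X => X *m K i) (qKE HV i j).
by rewrite -!mulmxE mulmxKV ?(qK_unit HV) // -scalemxAl.
Qed.

Lemma qKF_comm i j : K i *m F j = p ^ (- wform (wroot i) (wroot j)) *: (F j *m K i).
Proof.
have := congr1 (fun X => X *m K i) (qKF HV i j).
by rewrite -!mulmxE mulmxKV ?(qK_unit HV) // -scalemxAl.
Qed.

Lemma qEF_mx i j : E i *m F j - gsg i j *: (F j *m E i) =
  if i == j then (p - p^-1)^-1 *: (K i - invmx (K i)) else 0.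
Proof. exact: (qEF HV i j). Qed.

Lemma qEF_neq0 i u : u != 0 -> K i *m u = p *: u -> E i *m (F i *m u) != 0.
Proof.
have p0 := qparam_neq0 A q0; have p_nr := qparam_not_root A q0 q_not_root.
have z0 := qparam_sub_inv A q0 q_not_root.
have lt_i : (i < 2 * n)%N by have := ltn_ord i; lia.
have ci : wform (wroot i) (wroot i) = 1 + (i.+1 != n)%:Z.
  rewrite (wform_roots n_gt0 i lt_i (step_id i)) -{1 3}(step_id i).
  by rewrite (kexp_step n_gt0 lt_i) (kexp_stepS n_gt0 lt_i); have := ltn_ord i; lia.
have KVK : invmx (K i) *m K i = 1%:M by rewrite mulVmx ?(qK_unit HV).
have EFi := qEF_mx i i; rewrite eqxx andbb in EFi.
case last_i : (i.+1 == n) in ci; last first.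
  have ev : gen_odd A i = false by rewrite /gen_odd last_i andbF.
  rewrite ev expr0 in EFi; have KEi := qKE_comm i i; rewrite ci in KEi.
  (* With [h] = (p^h - p^-h) / (p - p^-1) this is -[k]^2, and the recursion is [k+1]^2 - [k]^2 =
     [2k+1]. *)
  pose b k : C := - ((p - p^-1)^-1 * (p ^+ k - p ^- k)) ^+ 2.
  apply: (@raising_neq0 C m 2 _ _ _ _ p 1 b u p0 isT _ p_nr _ _ _ KVK KEi EFi).
  - by rewrite mulr1.
  - by rewrite /b expr0 invr1 subrr mulr0 expr0n oppr0.
  - move=> k; rewrite /b oppr_eq0 expf_eq0 /= mulf_neq0 ?invr_eq0 ?z0 //.
    have e0 : p ^+ k.+1 != 0 by rewrite expf_neq0.
    apply: contra (p_nr (2 * k.+1)%N isT); rewrite subr_eq0 => /eqP e.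
    by rewrite mul2n -addnn exprD {1}e mulVf.
  move=> k; rewrite /b mul1r.
  have -> : p ^+ (k * 2).+1 = p * p ^+ k * p ^+ k by rewrite muln2 -addnn exprS exprD mulrA.
  have e0 : p ^+ k != 0 by rewrite expf_neq0.
  have z0' : p * p - 1 != 0 by move: (p_nr 2 isT); rewrite expr2 subr_eq0.
  rewrite [p ^+ k.+1]exprS; move: (p ^+ k) e0 => P P0; field.
  by rewrite P0 p0 z0'.
set s : C := (-1) ^+ gen_odd A i in EFi.
have s2 : s * s = 1 by rewrite /s; case: (gen_odd A i); rewrite ?mulrNN mulr1.
have s0 : s != 0 by apply/eqP=> s0; move: s2; rewrite s0 mul0r => /eqP; rewrite eq_sym oner_eq0.
have KEi := qKE_comm i i; rewrite ci addr0 expr1z in KEi.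
pose t := s * p; have t_nr k : (0 < k)%N -> t ^+ k != 1.
  move=> k0; apply: contra (p_nr (2 * k)%N _) => [/eqP e|]; last by rewrite muln_gt0.
  have : (t * t) ^+ k = 1 by rewrite exprMn e mulr1.
  by rewrite /t mulrACA s2 mul1r -expr2 -exprM => ->.
have t0 : t != 0 by rewrite mulf_neq0.
have t1 : t - 1 != 0 by rewrite subr_eq0 -[t]expr1 t_nr.
(* The recursion makes s^k b k minus the sum of the s^j [j+1] over j < k; as s p = t, these are
   geometric series in t and t^-1. *)
pose b k : C := - (s ^+ k.+1 * (p - p^-1)^-1 * ((t ^+ k - 1) * (t - t ^- k) / (t - 1))).
apply: (@raising_neq0 C m 1 _ _ _ _ p s b u p0 isT s2 p_nr _ _ _ KVK KEi EFi).
- by rewrite /b expr0 subrr !(mul0r, mulr0) oppr0.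
- move=> k; rewrite /b oppr_eq0.
  have e0 : t ^+ k.+1 != 0 by rewrite expf_neq0.
  have e1 : t - t ^- k.+1 != 0.
    rewrite subr_eq0; apply: contra (t_nr k.+2 isT) => /eqP e.
    by rewrite exprS {1}e mulVf.
  have e2 : t ^+ k.+1 - 1 != 0 by rewrite subr_eq0 t_nr.
  have z0' : (p - p^-1)^-1 != 0 by rewrite invr_eq0.
  have t1' : (t - 1)^-1 != 0 by rewrite invr_eq0.
  exact: mulf_neq0 (mulf_neq0 (expf_neq0 _ s0) z0') (mulf_neq0 (mulf_neq0 e2 e1) t1').
move=> k; rewrite /b muln1.
have pt : p = s * t by rewrite /t mulrA s2 mul1r.
have sV : s^-1 = s by apply: (mulfI s0); rewrite mulfV // s2.
have -> : p ^+ k.+1 - p ^- k.+1 = s ^+ k.+1 * (t * t ^+ k - t^-1 * t ^- k).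
  by rewrite pt exprMn invfM -[(s ^+ _)^-1]exprVn sV -mulrBr [t ^+ k.+1]exprS invfM.
have e0 : t ^+ k != 0 by rewrite expf_neq0.
rewrite [s ^+ k.+2]exprS [t ^+ k.+1]exprS.
move: (t ^+ k) e0 (s ^+ k.+1) ((p - p^-1)^-1) => T T0 S z'.
have -> : s * - (s * S * z' * ((t * T - 1) * (t - (t * T)^-1) / (t - 1))) =
   - (S * z' * ((t * T - 1) * (t - (t * T)^-1) / (t - 1))).
  rewrite mulrN; congr (- _); rewrite !mulrA s2 mul1r; ring.
field.
by rewrite T0 t0 t1.
Qed.

Definition stp (a : nat) : 'I_n := insubd (Ordinal n_gt0) (step n a).

Fixpoint vvec (a : nat) : 'cV[C]_m := if a is b.+1 then F (stp b) *m vvec b else v.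

Definition vmx : 'M[C]_m := \matrix_(k, a) vvec a k 0.

Lemma stpE a : (a < 2 * n)%N -> step n a = stp a.
Proof. by move=> lt_a; rewrite val_insubd step_lt. Qed.

Lemma qK_vvec i a : (a <= 2 * n)%N -> K i *m vvec a = p ^ kexp n i a *: vvec a.
Proof.
elim: a => [_|a IHa lt_a].
  by have [_ _ ->] := v_hw; rewrite -(vweight0 n_gt0) (wform_vweight n_gt0).
rewrite /= mulmxA qKF_comm (wform_roots n_gt0 i lt_a (stpE lt_a)) -scalemxAl -mulmxA.
rewrite (IHa (ltnW lt_a)) -scalemxAr scalerA -expfzDr ?qparam_neq0 //.
by congr (p ^ _ *: _); lia.
Qed.

Lemma qKV_eigen i u (a : int) : K i *m u = p ^ a *: u -> invmx (K i) *m u = p ^ (- a) *: u.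
Proof.
move=> Ku; have e0 : p ^ a != 0 by rewrite expfz_neq0 ?qparam_neq0.
apply: (scalerI e0); rewrite scalerA -expfzDr ?qparam_neq0 // subrr expr0z scale1r.
by rewrite scalemxAr -Ku mulmxA mulVmx ?(qK_unit HV) // mul1mx.
Qed.

(** Outside a = n the vector u_a has k_i-eigenvalue p and [qEF_neq0] applies. At a = n the
    eigenvalue is 1, so e_i f_i u_n = +-f_i e_i u_n; this is f_i w for w = e_i u_n, which is nonzero
    of eigenvalue p, so [qEF_neq0] for w excludes f_i w = 0. *)
Lemma qE_vvec_neq0 a : (a < 2 * n)%N -> (forall b, (b <= a)%N -> vvec b != 0) ->
  E (stp a) *m vvec a.+1 != 0.
Proof.
have reg b : (b < 2 * n)%N -> b != n -> vvec b != 0 -> E (stp b) *m vvec b.+1 != 0.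
  move=> lt_b ne_b b0; apply: qEF_neq0 => //.
  by rewrite (qK_vvec _ (ltnW lt_b)) -(stpE lt_b) (kexp_step n_gt0 lt_b) ne_b expr1z.
move=> lt_a IHa; have [ea|ne_a] := eqVneq a n; last by apply: reg => //; apply: IHa.
have lt_b : (n.-1 < 2 * n)%N by lia.
have sn : stp n = stp n.-1.
  apply: val_inj; rewrite /= -(stpE lt_b) -stpE; last lia.
  by rewrite /step; case: ltnP; case: ltnP; lia.
set i := stp n; pose w := E i *m vvec n.
have w0 : w != 0.
  have := reg n.-1 lt_b; rewrite -sn prednK //; apply; first lia.
  by apply: IHa; lia.
have en : step n n = i by apply: stpE; lia.
have lt_n : (n < 2 * n)%N by lia.
have kn : kexp n i n = 0 by rewrite -en (kexp_step n_gt0 lt_n) eqxx.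
have Kn : K i *m vvec n = p ^ 0 *: vvec n by rewrite (qK_vvec _ (ltnW lt_n)) kn.
have Kw : K i *m w = p *: w.
  rewrite mulmxA qKE_comm (wform_roots n_gt0 i lt_n en) -scalemxAl -mulmxA Kn -scalemxAr.
  rewrite expr0z scale1r; congr (_ *: _); rewrite -[RHS]expr1z; congr (p ^ _).
  by rewrite kn -en (kexp_stepS n_gt0 lt_n); lia.
have Fw0 : F i *m w != 0.
  by have := qEF_neq0 w0 Kw; apply: contraNneq => ->; rewrite mulmx0.
have := congr1 (fun X => X *m vvec n) (qEF_mx i i).
rewrite eqxx -[RHS]scalemxAl mulmxBl -scalemxAl mulmxBl Kn (qKV_eigen Kn) oppr0 subrr scaler0.
move/eqP; rewrite subr_eq0 -!mulmxA ea /= => /eqP->.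
by rewrite scaler_eq0 negb_or Fw0 andbT signr_eq0.
Qed.

Lemma vvec_neq0 a : (a <= 2 * n)%N -> vvec a != 0.
Proof.
have [d] := ubnP a; elim: d a => // d IHd [|a]; first by have [] := v_hw.
rewrite ltnS => lt_ad lt_a.
have : E (stp a) *m vvec a.+1 != 0.
  by apply: (qE_vvec_neq0 lt_a) => b le_b; apply: IHd; lia.
by apply: contraNneq => ->; rewrite mulmx0.
Qed.

Lemma col_vmx a : col a vmx = vvec a.
Proof. by apply/colP=> k; rewrite !mxE. Qed.

Lemma mul_vmx (X : 'M[C]_m) (d : 'I_m -> C) : (forall a : 'I_m, X *m vvec a = d a *: vvec a) ->
  X *m vmx = vmx *m diag_mx (\row_a d a).
Proof.
move=> Xd; apply/matrixP=> k a; have := congr1 (fun y : 'cV_m => y k 0) (Xd a).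
rewrite mul_mx_diag !mxE mulrC => <-; apply: eq_bigr => l _; by rewrite mxE.
Qed.

Lemma qK_vmx i : K i *m vmx = vmx *m bK A q i.
Proof. by apply: mul_vmx => a; rewrite qK_vvec ?leq_ord. Qed.

Lemma qKV_vmx i : invmx (K i) *m vmx = vmx *m bKV A q i.
Proof. by apply: mul_vmx => a; apply: qKV_eigen; rewrite qK_vvec ?leq_ord. Qed.

Lemma K2rho_vmx : K2rho V *m vmx = vmx *m bH n A q.
Proof.
apply: mul_vmx => a; rewrite -(sum_two_rho_kexp n_gt0 (leq_ord a)).
have p0 := qparam_neq0 A q0.
rewrite /K2rho; elim/big_rec2: _ => [|i h X _ IH]; first by rewrite mul1mx expr0z scale1r.
rewrite -mulmxE -mulmxA IH -scalemxAr.
have -> k : K i ^+ k *m vvec a = p ^ (k%:Z * kexp n i a) *: vvec a.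
  elim: k => [|k IHk]; first by rewrite expr0 mul1mx mul0r expr0z scale1r.
  rewrite exprS -mulmxE -mulmxA IHk -scalemxAr (qK_vvec i (leq_ord a)) scalerA -expfzDr //.
  by congr (p ^ _ *: _); lia.
by rewrite scalerA -expfzDr // addrC.
Qed.

Lemma vmx_unit : vmx \in unitmx.
Proof.
apply: eigenbasis_unitmx K2rho_vmx _ => [a b|a]; last by rewrite col_vmx vvec_neq0 ?leq_ord.
rewrite !mxE => /(qparam_expz_inj q0 q_not_root) e.
exact/val_inj/(height_inj n_gt0 (leq_ord a) (leq_ord b)).
Qed.

Lemma J_vmx : J *m vmx = vmx *m bJ C n A.
Proof.
apply: mul_vmx => -[a lt_a] /=; elim: a lt_a => [|a IHa] lt_a.
  by rewrite v_J /wsign ltn_eqF.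
have JF i : J *m F i = (-1) ^+ gen_odd A i *: (F i *m J).
  apply/matrixP=> k l; rewrite mul_diag_mx mul_mx_diag !mxE /=.
  have [->|/(qF_homog HV)<-] := eqVneq (F i k l) 0; first by rewrite !(mulr0, mul0r).
  by case: (qpar V k); case: (qpar V l); rewrite /= ?expr0 ?expr1; ring.
have lt_a' : (a < 2 * n)%N := lt_a.
rewrite /= mulmxA JF -scalemxAl -mulmxA (IHa (ltnW lt_a)) -scalemxAr scalerA; congr (_ *: _).
rewrite /gen_odd -(stpE lt_a') /wsign /osp_sign /step; case: (is_osp A) => /=; last first.
  by rewrite !expr0 mul1r; case: ifP; case: ifP.
case: (ltngtP a n) => [lt_an|gt_an|->].
- have [_|_] := eqVneq a.+1 n; first by rewrite !expr1 mulrNN mulr1.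
  by rewrite expr0 mul1r.
- have -> : ((2 * n).-1 - a).+1 == n = false by lia.
  have -> : a.+1 == n = false by lia.
  by rewrite expr0 mul1r.
have -> : ((2 * n).-1 - n).+1 == n by lia.
have -> : n.+1 == n = false by lia.
by rewrite mulr1.
Qed.

Definition conj_vmx (X : 'M[C]_m) := invmx vmx *m X *m vmx.

Lemma conj_vmxE X : X *m vmx = vmx *m conj_vmx X.
Proof. by rewrite /conj_vmx !mulmxA mulmxV ?vmx_unit // mul1mx. Qed.

Lemma conj_vmxM X Y : conj_vmx (X *m Y) = conj_vmx X *m conj_vmx Y.
Proof. by rewrite /conj_vmx !mulmxA mulmxK ?vmx_unit. Qed.

Lemma conj_vmx_eq X Y : X *m vmx = vmx *m Y -> conj_vmx X = Y.
Proof. by move=> e; rewrite /conj_vmx -mulmxA e mulKmx ?vmx_unit. Qed.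

Definition veta (a : nat) : C := conj_vmx (E (stp a)) (inord a) (inord a.+1).

Lemma bK_shift (X : 'M[C]_m) (d : 'I_n -> int) :
  (forall k, bK A q k *m X = p ^ d k *: (X *m bK A q k)) ->
  forall a b, X a b != 0 -> forall k : 'I_n, kexp n k a = d k + kexp n k b.
Proof.
move=> KX a b X0 k; have := congr1 (fun Y : 'M[C]_m => Y a b) (KX k).
rewrite mul_diag_mx mul_mx_diag !mxE mulrC mulrCA => /(mulfI X0).
by rewrite -expfzDr ?qparam_neq0 // => /(qparam_expz_inj q0 q_not_root).
Qed.

Lemma qF_vmx i : F i *m vmx = vmx *m bF C i.
Proof.
have KF k : bK A q k *m conj_vmx (F i) =
    p ^ (- wform (wroot k) (wroot i)) *: (conj_vmx (F i) *m bK A q k).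
  rewrite -(conj_vmx_eq (qK_vmx k)) -!conj_vmxM qKF_comm.
  by rewrite /conj_vmx -scalemxAr -scalemxAl.
rewrite conj_vmxE; congr (_ *m _); apply/matrixP=> b a; rewrite [RHS]mxE.
case: andP => [[/eqP eb /eqP ei]|ne]; last first.
  apply/eqP/negPn/negP => F0; case: ne.
  have lt_i : (i < 2 * n)%N by have := ltn_ord i; lia.
  have [] // := @step_of_kexp n n_gt0 i a b (leq_ord a) (leq_ord b); last by move=> -> ->.
  move=> k; have := bK_shift KF F0 k.
  by rewrite (wform_roots n_gt0 k lt_i (step_id i)); lia.
have lt_a : (a < 2 * n)%N by have := ltn_ord b; rewrite eb.
have -> : conj_vmx (F i) b a = (invmx vmx *m vvec b) b 0.
  have <- : F i *m vvec a = vvec b.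
    by rewrite eb /=; congr (F _ *m _); apply: val_inj; rewrite /= -stpE.
  rewrite -!col_vmx /conj_vmx -[RHS]/(_ b 0) -mulmxA !mxE; apply: eq_bigr => k _.
  by congr (_ * _); rewrite !mxE; apply: eq_bigr => l _; rewrite !mxE.
by rewrite -col_vmx colE mulKmx ?vmx_unit // mxE !eqxx.
Qed.

Lemma qE_vmx i : E i *m vmx = vmx *m bE veta i.
Proof.
have KE k : bK A q k *m conj_vmx (E i) =
    p ^ wform (wroot k) (wroot i) *: (conj_vmx (E i) *m bK A q k).
  rewrite -(conj_vmx_eq (qK_vmx k)) -!conj_vmxM qKE_comm.
  by rewrite /conj_vmx -scalemxAr -scalemxAl.
rewrite conj_vmxE; congr (_ *m _); apply/matrixP=> a b; rewrite [RHS]mxE.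
case: andP => [[/eqP eb /eqP ei]|ne]; last first.
  rewrite mulr0n; apply/eqP/negPn/negP => E0; case: ne.
  have lt_i : (i < 2 * n)%N by have := ltn_ord i; lia.
  have [] // := @step_of_kexp n n_gt0 i a b (leq_ord a) (leq_ord b); last by move=> -> ->.
  move=> k; have := bK_shift KE E0 k.
  by rewrite (wform_roots n_gt0 k lt_i (step_id i)); lia.
have lt_a : (a < 2 * n)%N by have := ltn_ord b; rewrite eb.
rewrite mulr1n /veta inord_val -eb inord_val; congr (conj_vmx (E _) _ _).
by apply: val_inj; rewrite /= -stpE.
Qed.

Lemma veta_neq0 a : (a < 2 * n)%N -> veta a != 0.
Proof.
move=> lt_a; have lt_b : (a.+1 < m)%N by [].
have := qE_vvec_neq0 lt_a (fun b le_b => vvec_neq0 (leq_trans le_b (ltnW lt_a))).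
apply: contraNneq => eta0.
rewrite -[vvec _]/(vvec (Ordinal lt_b)) -col_vmx colE mulmxA qE_vmx -mulmxA -colE.
have -> : col (Ordinal lt_b) (bE veta (stp a)) = 0; last by rewrite mulmx0.
apply/colP=> c; rewrite !mxE /= eqSS.
by case: (eqVneq a c) => [<-|_]; rewrite ?mulr0n //= eta0 mul0rn.
Qed.

Lemma bEF_vmx i j : bE veta i *m bF C j - gsg i j *: (bF C j *m bE veta i) =
  if i == j then (p - p^-1)^-1 *: (bK A q i - bKV A q i) else 0.
Proof.
apply: (can_inj (mulKmx vmx_unit)); rewrite mulmxBr -scalemxAr !mulmxA.
rewrite -qE_vmx -qF_vmx -!mulmxA -qE_vmx -qF_vmx !mulmxA scalemxAl -mulmxBl qEF_mx.
case: ifP => _; last by rewrite mul0mx mulmx0.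
by rewrite -scalemxAl -scalemxAr mulmxBl mulmxBr qK_vmx qKV_vmx.
Qed.

End VectorModule.

(** * The R-matrix in the weight basis *)

Lemma braid_eval_conj (C : comUnitRingType) (M f : nat) (T : 'M[C]_M)
    (g gV h hV : 'I_f.-1 -> 'M[C]_M) (b : braid_word f) :
  (forall i, g i * T = T * h i) -> (forall i, gV i * T = T * hV i) ->
  braid_eval g gV b * T = T * braid_eval h hV b.
Proof.
move=> eg eV; have X (X Y : 'M[C]_M) k : X * T = T * Y -> X ^+ k * T = T * Y ^+ k.
  move=> e; elim: k => [|k IHk]; first by rewrite !expr0 mulr1 mul1r.
  by rewrite !exprS -mulrA IHk mulrA e mulrA.
rewrite /braid_eval; elim: b => [|[i [k|k]] b IHb]; rewrite ?big_nil ?big_cons /=.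
- by rewrite mulr1 mul1r.
- by rewrite -mulrA IHb mulrA (X _ (h i)) // mulrA.
by rewrite -mulrA IHb mulrA (X _ (hV i)) // mulrA.
Qed.

Lemma braid_eval_scale (C : fieldType) (M f : nat) (c : C) (g gV : 'I_f.-1 -> 'M[C]_M)
    (b : braid_word f) : c != 0 ->
  braid_eval (fun i => c *: g i) (fun i => c^-1 *: gV i) b =
  c ^ exponent_sum b *: braid_eval g gV b.
Proof.
move=> c0; rewrite /braid_eval /exponent_sum.
have X (k : C) (Y : 'M[C]_M) l : (k *: Y) ^+ l = k ^+ l *: Y ^+ l.
  elim: l => [|l IHl]; first by rewrite !expr0 scale1r.
  by rewrite !exprS IHl -!mulmxE -scalemxAl -scalemxAr scalerA.
elim: b => [|[i k] b IHb]; first by rewrite !big_nil expr0z scale1r.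
rewrite !big_cons IHb /= expfzDr // -scalerA.
by case: k => k; rewrite X -!mulmxE -scalemxAl -scalemxAr ?exprVn.
Qed.

(** The sign of a basis vector of the tensor power is the eigenvalue on it of the tensor power of
    the parity operator. *)
Lemma qtraceE (C : fieldType) (n f m : nat) (V : qops C n m) (X : 'M[C]_#|tidx f m|) :
  qtrace V X = \tr (tens_power f (psign C (qpar V) true *m K2rho V) * X).
Proof.
have -> : tens_power f (psign C (qpar V) true *m K2rho V) =
    tens_power f (psign C (qpar V) true) * tens_power f (K2rho V).
  by rewrite !tens_powerE prod_opM.
rewrite -mulrA -[RHS]/(\tr (tens_power f (psign C (qpar V) true) *m (tens_power f (K2rho V) *m X))).
rewrite /qtrace /str; move: (tens_power f (K2rho V) *m X) => Y; apply: eq_bigr => k _.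
rewrite [RHS]mxE [RHS](bigD1 k) //= [X in _ = _ + X]big1 ?addr0 => [|l ne_l].
  have -> : tens_power f (psign C (qpar V) true) k k =
      (-1) ^+ (\sum_(j < f) qpar V ((enum_val k : tidx f m) j)).
    by rewrite mxE expr_sum; apply: eq_bigr => j _; rewrite !mxE eqxx mulr1n.
  by [].
rewrite mxE; have [j ne_j] : exists j, (enum_val k : tidx f m) j != (enum_val l : tidx f m) j.
  apply/existsP; rewrite -negb_forall; apply: contra ne_l => /forallP e.
  by apply/eqP/enum_val_inj/ffunP => j; rewrite (eqP (e j)).
by rewrite (bigD1 j) //= !mxE (negbTE ne_j) mulr0n !mul0r.
Qed.

Section SumDecomposition.
Variables (C : fieldType) (M : nat) (W1 W2 W3 : {vspace 'cV[C]_M}).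
Hypothesis sumW : (W1 + W2 + W3)%VS = fullv.

Lemma mx_eq_on_sum (X Y : 'M[C]_M) :
  (forall y, y \in W1 -> X *m y = Y *m y) -> (forall y, y \in W2 -> X *m y = Y *m y) ->
  (forall y, y \in W3 -> X *m y = Y *m y) -> X = Y.
Proof.
move=> e1 e2 e3; have E (y : 'cV[C]_M) : X *m y = Y *m y.
  have : y \in (W1 + W2 + W3)%VS by rewrite sumW memvf.
  case/memv_addP=> y12 /memv_addP[y1 y1W [y2 y2W ->]] [y3 y3W ->].
  by rewrite !mulmxDr (e1 _ y1W) (e2 _ y2W) (e3 _ y3W).
apply/matrixP=> k l; have := congr1 (fun y : 'cV_M => y k 0) (E (delta_mx l 0)).
by rewrite -!colE !mxE.
Qed.

Variables (X : 'M[C]_M) (a1 a2 a3 : C).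
Hypotheses (X1 : acts_by_scalar X W1 a1) (X2 : acts_by_scalar X W2 a2).
Hypothesis X3 : acts_by_scalar X W3 a3.

Lemma scalar_comm Y : (forall y, y \in W1 -> Y *m y \in W1) ->
  (forall y, y \in W2 -> Y *m y \in W2) -> (forall y, y \in W3 -> Y *m y \in W3) ->
  X *m Y = Y *m X.
Proof.
move=> Y1 Y2 Y3; apply: mx_eq_on_sum => y yW; rewrite -!mulmxA.
- by rewrite (X1 (Y1 y yW)) (X1 yW) scalemxAr.
- by rewrite (X2 (Y2 y yW)) (X2 yW) scalemxAr.
by rewrite (X3 (Y3 y yW)) (X3 yW) scalemxAr.
Qed.

Lemma scalar_unitmx : a1 != 0 -> a2 != 0 -> a3 != 0 -> X \in unitmx.
Proof.
(* The inverse supplied by the cubic equation (X - a1) (X - a2) (X - a3) = 0. *)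
move=> n1 n2 n3; pose Y := (a1 * a2 * a3)^-1 *: (X *m X - (a1 + a2 + a3) *: X +
  (a1 * a2 + a2 * a3 + a3 * a1)%:M).
suff : X *m Y = 1%:M by case/mulmx1_unit.
have Yy (y : 'cV[C]_M) a : X *m y = a *: y -> X *m Y *m y =
    ((a1 * a2 * a3)^-1 * (a * (a * a - (a1 + a2 + a3) * a + (a1 * a2 + a2 * a3 + a3 * a1)))) *: y.
  move=> Xy; rewrite -mulmxA /Y -scalemxAl -scalemxAr -scalerA; congr (_ *: _).
  rewrite mulmxDl mulmxBl -scalemxAl mul_scalar_mx -mulmxA Xy -scalemxAr Xy !scalerA.
  by rewrite -scalerBl -scalerDl -scalemxAr Xy scalerA mulrC.
by apply: mx_eq_on_sum => y yW; rewrite mul1mx -[RHS]scale1r;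
  [rewrite (Yy _ _ (X1 yW)) | rewrite (Yy _ _ (X2 yW)) | rewrite (Yy _ _ (X3 yW))];
  congr (_ *: _); field; rewrite n1 n2 n3.
Qed.

Lemma invmx_scalar W a : X \in unitmx -> a != 0 -> acts_by_scalar X W a ->
  acts_by_scalar (invmx X) W a^-1.
Proof.
move=> uX a0 Xa y /Xa Xy; apply: (scalerI a0).
by rewrite scalerA divff // scale1r scalemxAr -Xy mulKmx.
Qed.

End SumDecomposition.

Section RMatrix.
Variables (C : fieldType) (n : nat) (A : qtype) (q : C).
Hypotheses (n_gt0 : (0 < n)%N) (q0 : q != 0).
Hypothesis q_not_root : forall k, (0 < k)%N -> q ^+ k != 1.
Local Notation p := (qparam A q).
Local Notation m := (2 * n).+1.
Local Notation sg := (osp_sign C A).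
Local Notation r := (sg * p ^+ (2 * n)).
Local Notation x := (bwm_x r p).
Variables (V : qops C n m) (v : 'cV[C]_m).
Hypotheses (HV : is_qmodule A q V) (v_hw : is_hwv A q V (weps n 0) v).
Hypothesis v_J : psign C (qpar V) true *m v = sg *: v.
Local Notation U := (vmx n_gt0 V v).
Local Notation eta := (veta n_gt0 V v).
Local Notation VV := (tens_module A V).
Local Notation psgn := (psign C (qpar V)).
Implicit Types (i : 'I_n) (X Y : 'M[C]_(m * m)) (y : 'cV[C]_(m * m)).
Let UU : 'M[C]_(m * m) := U *t U.

Let UU_unit : UU \in unitmx.
Proof. by rewrite tensmx_unit // (vmx_unit n_gt0 q0 q_not_root HV v_hw). Qed.

Let UU_tens (X X' Z Z' : 'M[C]_m) : X *m U = U *m X' -> Z *m U = U *m Z' ->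
  (X *t Z) *m UU = UU *m (X' *t Z').
Proof. by move=> eX eZ; rewrite !tensmx_mul eX eZ. Qed.

Let psgn0 : psgn false = 1%:M.
Proof. by apply/matrixP=> a b; rewrite !mxE. Qed.

Let psgn_U i : psgn (gen_odd A i) *m U = U *m bJi C A i.
Proof.
case odd_i : (gen_odd A i).
  rewrite (J_vmx n_gt0 q0 HV v_J); congr (_ *m diag_mx _).
  by apply/rowP=> a; rewrite !mxE /gsign odd_i.
have -> : bJi C A i = 1%:M by apply/matrixP=> a b; rewrite !mxE /gsign odd_i.
by rewrite psgn0 mul1mx mulmx1.
Qed.

Let qE_UU i : qE VV i *m UU = UU *m vE A q eta i.
Proof.
rewrite /= /gtens mul1mx psgn0 mulmx1 mulmxDl mulmxDr; congr (_ + _); apply: UU_tens.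
- exact: (qE_vmx n_gt0 q0 q_not_root HV v_hw).
- exact: (qK_vmx n_gt0 q0 HV v_hw).
- exact: psgn_U.
exact: (qE_vmx n_gt0 q0 q_not_root HV v_hw).
Qed.

Let qF_UU i : qF VV i *m UU = UU *m vF A q i.
Proof.
rewrite /= /gtens psgn0 mulmx1 mulmxDl mulmxDr; congr (_ + _); apply: UU_tens.
- exact: (qF_vmx n_gt0 q0 q_not_root HV v_hw).
- by rewrite mul1mx mulmx1.
- rewrite -mulmxA psgn_U mulmxA (qKV_vmx n_gt0 q0 HV v_hw) -mulmxA; congr (_ *m _).
  by apply/matrixP=> a b; rewrite mul_diag_mx !mxE; case: (a == b); rewrite ?mulr0n ?mulr0.
exact: (qF_vmx n_gt0 q0 q_not_root HV v_hw).
Qed.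

Let qK_UU i : qK VV i *m UU = UU *m (bK A q i *t bK A q i).
Proof.
by rewrite /= /gtens psgn0 mulmx1; apply: UU_tens; apply: (qK_vmx n_gt0 q0 HV v_hw).
Qed.

Let J_UU : psign C (qpar VV) true *m UU = UU *m (bJ C n A *t bJ C n A).
Proof.
have -> : psign C (qpar VV) true = psgn true *t psgn true.
  apply/matrixP=> k l; case: (mxtens_indexP k) => a b; case: (mxtens_indexP l) => c d.
  rewrite tensmxE !mxE (can_eq (@mxtens_indexK _ _)) xpair_eqE /= /tpar mxtens_indexK.
  by case: (a == c); case: (b == d); rewrite ?(mulr0, mul0r) // !mulr1n signr_addb.
by apply: UU_tens; apply: (J_vmx n_gt0 q0 HV v_J).
Qed.

Definition tens_vec y : 'M[C]_m := mat_of (invmx UU *m y).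

Let tens_vec_neq0 y : y != 0 -> tens_vec y != 0.
Proof.
apply: contraNneq => /(congr1 (@vec_of C m)); rewrite mat_ofK => e.
rewrite -[y](mulKVmx UU_unit) e; apply/eqP/matrixP=> k l.
by rewrite !mxE big1 // => ? _; rewrite !mxE mulr0.
Qed.

Let op_tens_vec X Y y : X *m UU = UU *m Y -> op Y (tens_vec y) = tens_vec (X *m y).
Proof.
move=> e; rewrite /tens_vec -mat_of_mul; congr mat_of.
by rewrite -{2}[y](mulKVmx UU_unit) (mulmxA X) e -!mulmxA mulKmx.
Qed.

Let tens_vecZ c y : tens_vec (c *: y) = c *: tens_vec y.
Proof. by rewrite /tens_vec -scalemxAr linearZ. Qed.

Let weight_height a b : (a <= 2 * n)%N -> (b <= 2 * n)%N -> forall Z : 'M[C]_m,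
  (forall i, op (bK A q i *t bK A q i) Z = p ^ (kexp n i a + kexp n i b) *: Z) ->
  has_height A q (height n a + height n b) Z.
Proof.
move=> le_a le_b Z KZ; apply/matrixP=> c d; rewrite diag_conj_ent scalemx_ent !mxE.
have [->|Z0] := eqVneq (Z c d) 0; first by rewrite !mulr0.
congr (_ * _); rewrite -expfzDr ?qparam_neq0 //; congr (p ^ _).
rewrite -!(sum_two_rho_kexp n_gt0) ?leq_ord // -!big_split; apply: eq_bigr => i _.
rewrite /= -!mulrDr; congr (_ * _); have := congr1 (fun Z : 'M_m => Z c d) (KZ i).
rewrite op_bK diag_conj_ent scalemx_ent !mxE => /(mulIf Z0); rewrite -expfzDr ?qparam_neq0 //.
exact: (qparam_expz_inj q0 q_not_root).
Qed.

Variables (Rv : 'M[C]_(m * m)) (W2 Wm W0 : {vspace 'cV[C]_(m * m)}).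
Hypotheses (W2_irr : is_irr_hw A q VV (weps n 0 *+ 2) W2).
Hypotheses (Wm_irr : is_irr_hw A q VV (mu_weight n) Wm) (W0_irr : is_irr_hw A q VV 0 W0).
Hypothesis sumW : (W2 + Wm + W0)%VS = fullv.
Hypotheses (R2 : acts_by_scalar Rv W2 (- q)) (Rm : acts_by_scalar Rv Wm q^-1).
Hypothesis R0 : acts_by_scalar Rv W0 (q ^- (2 * n)).

Let sgp : - q = sg * p.
Proof. by rewrite /osp_sign /qparam; case: (is_osp A); rewrite ?expr1 ?expr0 ?mulN1r ?mul1r. Qed.

Let sg2 : sg * sg = 1 := osp_sign2 C A.

Let q2 : q ^- (2 * n) = p ^- (2 * n).
Proof.
have e2 : q ^+ 2 = p ^+ 2 by rewrite /qparam; case: (is_osp A); rewrite ?sqrrN.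
by rewrite !exprM e2.
Qed.

Let qV : q^-1 = sg * - p^-1.
Proof. by rewrite -[LHS]opprK -(invrN q) sgp invfM osp_signV mulrN. Qed.

Let Rv_unit : Rv \in unitmx.
Proof.
by apply: (scalar_unitmx sumW R2 Rm R0); rewrite ?oppr_eq0 ?invr_eq0 ?expf_neq0.
Qed.

Let Rv_comm X : (forall W, is_submodule VV W -> forall y, y \in W -> X *m y \in W) ->
  Rv *m X = X *m Rv.
Proof.
move=> XW; apply: (scalar_comm sumW R2 Rm R0); apply: XW.
- by have [[]] := W2_irr.
- by have [[]] := Wm_irr.
by have [[]] := W0_irr.
Qed.

Definition vec_braid : 'M[C]_(m * m) := invmx UU *m (sg *: Rv) *m UU.
Definition vec_braidV : 'M[C]_(m * m) := invmx UU *m (sg *: invmx Rv) *m UU.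

Let vec_braidK : vec_braid *m vec_braidV = 1%:M.
Proof.
have e : (sg *: Rv) *m (sg *: invmx Rv) = 1%:M.
  by rewrite -scalemxAl -scalemxAr scalerA sg2 scale1r mulmxV.
by rewrite /vec_braid /vec_braidV !mulmxA mulmxK // -(mulmxA (invmx UU)) e mulmx1 mulVmx.
Qed.

Let vec_braid_comm X Y : X *m UU = UU *m Y -> Rv *m X = X *m Rv ->
  vec_braid *m Y = Y *m vec_braid.
Proof.
move=> e eR; rewrite /vec_braid -!scalemxAr -!scalemxAl -!scalemxAr; congr (_ *: _).
have -> : Y *m (invmx UU *m Rv *m UU) = invmx UU *m (UU *m Y) *m (invmx UU *m Rv *m UU).
  by rewrite mulKmx.
by rewrite -e -!mulmxA mulKVmx // (mulmxA X) -eR -mulmxA e.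
Qed.

Let op_vec_braid y a : Rv *m y = a *: y -> op vec_braid (tens_vec y) = (sg * a) *: tens_vec y.
Proof.
move=> Ry; rewrite (@op_tens_vec (sg *: Rv)); last by rewrite /vec_braid !mulmxA mulmxV // mul1mx.
by rewrite -scalemxAl Ry scalerA tens_vecZ.
Qed.

Let hw_tens_vec y : (forall i, qE VV i *m y = 0) -> hw_vec A q eta (tens_vec y).
Proof. by move=> Ey i; rewrite (op_tens_vec _ (qE_UU i)) Ey /tens_vec mulmx0 linear0. Qed.

Let K_tens_vec y (h : 'I_n -> int) : (forall i, qK VV i *m y = p ^ h i *: y) ->
  forall i, op (bK A q i *t bK A q i) (tens_vec y) = p ^ h i *: tens_vec y.
Proof. by move=> Ky i; rewrite (op_tens_vec _ (qK_UU i)) Ky tens_vecZ. Qed.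

(** By [c0_vF] the f_i kill y as well, so its line is already a submodule, and W0 is irreducible. *)
Let W0_line y : y \in W0 -> is_hwv A q VV 0 y -> W0 = <[y]>%VS.
Proof.
move=> yW [y_neq0 Ey Ky0]; have Ky i : qK VV i *m y = y by rewrite Ky0 wform_root0 expr0z scale1r.
have [[_ _ W0_min] _] := W0_irr.
have c_hw := hw_tens_vec Ey; set c := tens_vec y in c_hw.
have c_K i : bK A q i *m c *m bK A q i = c.
  have Ky1 j : qK VV j *m y = p ^ 0 *: y by rewrite expr0z scale1r Ky.
  by have := K_tens_vec Ky1 i; rewrite op_bK expr0z scale1r.
have c_F := c0_vF n_gt0 q0 q_not_root (@veta_neq0 _ _ _ _ n_gt0 q0 q_not_root _ _ HV v_hw)
  (bEF_vmx n_gt0 q0 q_not_root HV v_hw) c_hw c_K.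
have inj z : tens_vec z = 0 -> z = 0.
  by move=> z0; apply/eqP; apply: contraTT isT => /tens_vec_neq0; rewrite z0 eqxx.
have Fy i : qF VV i *m y = 0 by apply: inj; rewrite -(op_tens_vec _ (qF_UU i)) c_F.
(* Submodules must also be stable under parity: y involves only u_a (x) u_(2n-a), whose factors have
   equal parity. *)
have Jy : psign C (qpar VV) true *m y = y.
  apply/eqP; rewrite -subr_eq0; apply/eqP/inj.
  rewrite /tens_vec mulmxBr linearB /= -/(tens_vec _) -/(tens_vec y) -/c.
  rewrite -(op_tens_vec _ J_UU) -/c op_tens tr_diag_mx.
  apply/matrixP=> a b; rewrite [LHS]mxE diag_conj_ent [in RHS]mxE [(- c) a b]mxE.
  have [->|cab] := eqVneq (c a b) 0; first by rewrite mulr0 subr0.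
  have hab := c0_height n_gt0 q0 q_not_root c_K cab.
  rewrite !mxE (height_opp n_gt0 (leq_ord a) (leq_ord b) hab).
  have -> : wsign C n A (2 * n - a) = wsign C n A a.
    have le_a := leq_ord a; have e : (2 * n - a == n)%N = (a == n :> nat) by clear -le_a; lia.
    by rewrite /wsign e.
  by rewrite wsign2 mul1r subrr.
have sub : is_submodule VV <[y]>%VS.
  move=> _ /vlineP[k ->]; split=> [i|i|i|i|]; rewrite -scalemxAr memvZ //.
  - by rewrite Ey mem0v.
  - by rewrite Fy mem0v.
  - by rewrite Ky memv_line.
  - rewrite -{1}(Ky i) mulKmx ?memv_line //.
    have := congr1 (fun X => X *m invmx UU) (qK_UU i); rewrite mulmxK // => ->.
    rewrite !unitmx_mul UU_unit unitmx_inv UU_unit andbT /= tensmx_unit //.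
      by case/mulmx1_unit: (bKKV A q0 i).
    by case/mulmx1_unit: (bKKV A q0 i).
  by rewrite Jy memv_line.
have [|e|->//] := W0_min _ sub; first by rewrite -memvE.
by case/eqP: y_neq0; apply/eqP; rewrite -memv0 -e memv_line.
Qed.

(** On an eigenvector of eigenvalue a, e is 1 - (a - 1/a) / (p - 1/p), which vanishes for p and
    -1/p. So e kills W2 and Wm and has its image in the line W0. *)
Let vec_cupcap y0 : y0 \in W0 -> is_hwv A q VV 0 y0 ->
  exists cap, cupcap A q vec_braid vec_braidV = vec_of (tens_vec y0) *m cap.
Proof.
move=> y0W y0_hw; have W0E := W0_line y0W y0_hw.
pose X : 'M[C]_(m * m) := 1%:M - (p - p^-1)^-1 *: (sg *: Rv - sg *: invmx Rv).
have z0 := qparam_sub_inv A q0 q_not_root; have p0 := qparam_neq0 A q0.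
have Xy (y : 'cV[C]_(m * m)) a : a != 0 -> Rv *m y = (sg * a) *: y ->
    X *m y = (1 - (p - p^-1)^-1 * (a - a^-1)) *: y.
  move=> a0 Ry; have sa0 : sg * a != 0 by rewrite mulf_neq0 ?osp_sign_neq0.
  have RVy : invmx Rv *m y = (sg * a^-1) *: y.
    have := @invmx_scalar _ _ Rv <[y]>%VS _ Rv_unit sa0 _ y (memv_line y).
    rewrite invfM osp_signV; apply=> _ /vlineP[k ->].
    by rewrite -scalemxAr Ry !scalerA mulrC.
  rewrite mulmxBl mul1mx -scalemxAl mulmxBl -!scalemxAl Ry RVy !scalerA !mulrA sg2 !mul1r.
  by rewrite -scalerBl scalerA -{1}[y]scale1r -scalerBl.
have X2 y : y \in W2 -> X *m y = 0.
  move=> /R2; rewrite sgp => /(Xy _ _ p0) ->.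
  by rewrite mulVf // subrr scale0r.
have Xm y : y \in Wm -> X *m y = 0.
  have p0' : - p^-1 != 0 by rewrite oppr_eq0 invr_eq0.
  move=> /Rm; rewrite qV => /(Xy _ _ p0') ->.
  by rewrite invrN invrK opprK [- _ + _]addrC mulVf // subrr scale0r.
have X0 y : exists k, X *m y = k *: y0.
  have : y \in (W2 + Wm + W0)%VS by rewrite sumW memvf.
  case/memv_addP=> y12 /memv_addP[y1 y1W [y2 y2W ->]] [y3 y3W ->].
  rewrite !mulmxDr (X2 _ y1W) (Xm _ y2W) !add0r.
  have y3_line : y3 \in <[y0]>%VS by rewrite -W0E.
  have [k ->] := vlineP _ _ y3_line.
  have e0 : sg * q ^- (2 * n) != 0 by rewrite mulf_neq0 ?osp_sign_neq0 ?invr_eq0 ?expf_neq0.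
  have Ry0 : Rv *m y0 = (sg * (sg * q ^- (2 * n))) *: y0 by rewrite mulrA sg2 mul1r R0.
  by rewrite -scalemxAr (Xy _ _ e0 Ry0) scalerA; eexists.
have [k kE] := choice (fun l => X0 (delta_mx l 0)).
exists ((\row_l k l) *m UU).
have XE : X = y0 *m \row_l k l.
  apply/matrixP=> a b; have := congr1 (fun y : 'cV_(m * m) => y a 0) (kE b).
  rewrite -colE [LHS]mxE [RHS]mxE [RHS]mulrC => ->.
  by rewrite [RHS]mxE big_ord1 [(\row_l _) _ _]mxE.
rewrite /tens_vec mat_ofK mulmxA -(mulmxA (invmx UU)) -XE /X mulmxBr mulmxBl mulmx1 mulVmx //.
by rewrite -scalemxAr -scalemxAl mulmxBr mulmxBl.
Qed.

Let vec_kauffman f (b : braid_word f) : (1 < f)%N ->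
  kauffman r p b = x ^+ f.-1 * r ^ (- exponent_sum b) *
    (\tr (tens_power f (bM n A q) * braid_eval (local_op vec_braid) (local_op vec_braidV) b) /
     x ^+ f).
Proof.
have [_ [y2 y2W [y2_neq0 Ey2 Ky2]]] := W2_irr.
have [_ [ym ymW [ym_neq0 Eym Kym]]] := Wm_irr.
have [_ [y0 y0W y0_hw]] := W0_irr; have [y0_neq0 Ey0 Ky0] := y0_hw.
have [cap capE] := vec_cupcap y0W y0_hw.
have Vcomm X Y : X *m UU = UU *m Y ->
    (forall W, is_submodule VV W -> forall y, y \in W -> X *m y \in W) ->
    vec_braid *m Y = Y *m vec_braid.
  by move=> e /Rv_comm; apply: vec_braid_comm.
apply: (@vector_kauffman C n A q n_gt0 q0 q_not_root eta
  (@veta_neq0 _ _ _ _ n_gt0 q0 q_not_root _ _ HV v_hw)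
  (bEF_vmx n_gt0 q0 q_not_root HV v_hw) (tens_vec y0) (hw_tens_vec Ey0) _
  vec_braid vec_braidV (tens_vec y2) (tens_vec ym) cap vec_braidK (mulmx1C vec_braidK)).
- move=> i; have Ky0' j : qK VV j *m y0 = p ^ 0 *: y0 by rewrite Ky0 wform_root0.
  by have := K_tens_vec Ky0' i; rewrite op_bK expr0z scale1r.
- by move=> i; apply: (Vcomm _ _ (qE_UU i)) => W WV y /WV[].
- by move=> i; apply: (Vcomm _ _ (qF_UU i)) => W WV y /WV[].
- by move=> i; apply: (Vcomm _ _ (qK_UU i)) => W WV y /WV[].
- by apply: (Vcomm _ _ J_UU) => W WV y /WV[].
- exact: tens_vec_neq0.
- exact: hw_tens_vec.
- apply: weight_height => // i.
  apply: (K_tens_vec (h := fun j : 'I_n => kexp n j 0 + kexp n j 0)) => j.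
  by rewrite Ky2 mulr2n wformD -(vweight0 n_gt0) (wform_vweight n_gt0).
- by rewrite (op_vec_braid (R2 y2W)) sgp mulrA sg2 mul1r.
- exact: tens_vec_neq0.
- exact: hw_tens_vec.
- apply: weight_height => // [|i]; first by clear -n_gt0; lia.
  apply: (K_tens_vec (h := fun j : 'I_n => kexp n j 1 + kexp n j 0)) => j.
  by rewrite Kym (mu_weightE n_gt0) wformD !(wform_vweight n_gt0) addrC.
- by rewrite (op_vec_braid (Rm ymW)) qV mulrA sg2 mul1r.
- exact: tens_vec_neq0.
- by rewrite (op_vec_braid (R0 y0W)) q2 invfM osp_signV.
exact: capE.
Qed.

(** The change of basis by the tensor power of U does not affect the trace; each letter of the braid
    contributes one factor sg from the rescaling. *)
Let trace_vec f (b : braid_word f) :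
  \tr (tens_power f (psgn true *m K2rho V) * braid_eval (local_op Rv) (local_op (invmx Rv)) b) =
  sg ^ exponent_sum b *
  \tr (tens_power f (bM n A q) * braid_eval (local_op vec_braid) (local_op vec_braidV) b).
Proof.
set T := tens_power f U; pose TV := tens_power f (invmx U).
have TK : T * TV = 1.
  rewrite /T /TV !tens_powerE prod_opM prod_op1 // => j.
  by rewrite -mulmxE mulmxV // (vmx_unit n_gt0 q0 q_not_root HV v_hw).
have sgR X : sg *: (sg *: X) = X :> 'M[C]_(m * m) by rewrite scalerA sg2 scale1r.
have X1 : braid_eval (local_op Rv) (local_op (invmx Rv)) b * T =
    T * (sg ^ exponent_sum b *: braid_eval (local_op vec_braid) (local_op vec_braidV) b).
  rewrite -braid_eval_scale ?osp_sign_neq0 //; apply: braid_eval_conj => i.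
    rewrite -local_opZ; apply: tens_power_intertwine; rewrite -!mulmxE /vec_braid.
    by rewrite -scalemxAr !mulmxA mulmxV // mul1mx scalemxAl sgR.
  rewrite osp_signV -local_opZ; apply: tens_power_intertwine; rewrite -!mulmxE /vec_braidV.
  by rewrite -scalemxAr !mulmxA mulmxV // mul1mx scalemxAl sgR.
have N1 : tens_power f (psgn true *m K2rho V) * T = T * tens_power f (bM n A q).
  rewrite !tens_powerE !prod_opM; apply: eq_prod_op => _.
  rewrite -!mulmxE -mulmxA (K2rho_vmx n_gt0 q0 HV v_hw) mulmxA (J_vmx n_gt0 q0 HV v_J) -mulmxA.
  congr (_ *m _); apply/matrixP=> k l; rewrite mul_diag_mx !mxE.
  by case: (k == l); rewrite ?mulr0n ?mulr0.
rewrite -[X in \tr X]mulr1 -TK mulrA -(mulrA (tens_power _ _)) X1 mulrA N1 -!mulrA.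
have trC (Y Z : 'M[C]_#|tidx f m|) : \tr (Y * Z) = \tr (Z * Y) by exact: mxtrace_mulC.
rewrite (trC T) -!mulrA.
have -> : TV * T = 1 by apply: mulmx1C.
by rewrite mulr1 -!mulmxE -scalemxAr linearZ.
Qed.

(** With sg^-1 = sg, the framing factor p^(-2n e(b)) and the sign sg^e(b) combine to r^-e(b). *)
Lemma trace_kauffman f (b : braid_word f) : (1 < f)%N ->
  x ^+ f.-1 * (q ^- (2 * n)) ^ exponent_sum b *
  (\tr (tens_power f (psgn true *m K2rho V) * braid_eval (local_op Rv) (local_op (invmx Rv)) b) /
   x ^+ f) = kauffman r p b.
Proof.
move=> f_gt1; have rE : r ^ (- exponent_sum b) =
    (p ^- (2 * n)) ^ exponent_sum b * sg ^ exponent_sum b.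
  by rewrite -exprz_inv invfM osp_signV expfzMl mulrC.
rewrite (vec_kauffman b f_gt1) trace_vec q2 rE; move: (\tr _) => t.
by rewrite -!mulrA.
Qed.

End RMatrix.

Lemma qdimVE (C : fieldType) (n : nat) (A : qtype) (q : C) :
  qdimV n q = bwm_x (osp_sign C A * qparam A q ^+ (2 * n)) (qparam A q).
Proof.
rewrite /qdimV /bwm_x /osp_sign /qparam; case: (is_osp A).
  by rewrite expr1 mulN1r invrN opprK.
have -> : (- q) ^+ (2 * n) = q ^+ (2 * n) by rewrite !exprM sqrrN.
rewrite expr0 mul1r; have -> : - q - (- q)^-1 = - (q - q^-1) by rewrite invrN opprB opprK addrC.
by rewrite invrN mulrN -mulNr opprB [- _ + _]addrC.
Qed.

Lemma link_invariant_kauffman (C : fieldType) (n : nat) (A : qtype) (q : C)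
    (f : nat) (b : braid_word f) (V : qops C n (2 * n).+1)
    (Rm : 'M[C]_((2 * n).+1 * (2 * n).+1)) :
  (0 < n)%N -> q != 0 -> (forall k, (0 < k)%N -> q ^+ k != 1) -> (1 < f)%N ->
  is_vector_module A q V -> is_R_matrix A q V Rm ->
  link_invariant q V Rm b = kauffman (osp_sign C A * qparam A q ^+ (2 * n)) (qparam A q) b.
Proof.
move=> n_gt0 q0 q_nr f_gt1 [HV _ [v v_hw v_J]].
case=> _ _ _ [W2 [Wm [W0 [W2_irr Wm_irr W0_irr [sumW _] [R2 Rmu R0]]]]].
rewrite /link_invariant /markov_trace qtraceE (qdimVE n A).
exact: (trace_kauffman n_gt0 q0 q_nr HV v_hw v_J W2_irr Wm_irr W0_irr sumW R2 Rmu R0).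
Qed.

Theorem theorem1p1 (R : realType) (n : nat) (q : R[i]) (f : nat) (b : braid_word f)
    (n_gt0 : (0 < n)%N) (q_neq0 : q != 0)
    (q_not_root : forall k : nat, (0 < k)%N -> q ^+ k != 1)
    (f_ge2 : (2 <= f)%N) :
  (forall (V : qops R[i] n (2 * n).+1) (Rm : 'M[R[i]]_((2 * n).+1 * (2 * n).+1)),
     is_vector_module OSP q V -> is_R_matrix OSP q V Rm ->
     link_invariant q V Rm b = kauffman (- q ^+ (2 * n)) q b)
  /\
  (forall (V : qops R[i] n (2 * n).+1) (Rm : 'M[R[i]]_((2 * n).+1 * (2 * n).+1)),
     is_vector_module SO q V -> is_R_matrix SO q V Rm ->
     link_invariant q V Rm b = kauffman (q ^+ (2 * n)) (- q) b).
Proof.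
split=> V Rm HV HR;
  rewrite (link_invariant_kauffman b n_gt0 q_neq0 q_not_root f_ge2 HV HR) /osp_sign /qparam /=.
  by rewrite expr1 mulN1r.
have -> : (- q) ^+ (2 * n) = q ^+ (2 * n) by rewrite !exprM sqrrN.
by rewrite expr0 mul1r.
Qed.
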